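(* Consider the closed-loop system $$\dot x = f_0\big(x,\mathcal N(u_I+\tau_p k(r-g(x)))\big),\qquad \dot u_I=\Pi_U\big(u_I,k(r-g(x))\big),\qquad y=g(x),$$ where $\tau_p\ge 0$ and the plant $\mathbf{P_0}$ (given by $\dot x=f_0(x,v)$, $y=g(x)$) satisfies Assumption 2 stated in the context. Then there exists $\kappa>0$ such that if the gain $k\in(0,\kappa]$, then for any $r\in Y=G(\mathcal N(U))$, the point $(\Xi(\mathcal N(u_r)),u_r)$ is a (locally) exponentially stable equilibrium point of the closed-loop system, with state space $\mathcal X=\mathbb R^n\times\mathcal U$. If the initial state $\begin{bmatrix}x_0\\ u_0\end{bmatrix}\in\mathcal D_r$ of the closed-loop system satisfies $u_0\in U$ and $\|x_0-\Xi(\mathcal N(u_0))\|\le\varepsilon_0$, then $$x(t)\to\Xi(\mathcal N(u_r)),\qquad u_I(t)\to u_r,\qquad y(t)\to r\qquad (t\to\infty),$$ and this convergence is at an exponential rate.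
   Context: Setting: $m\ge p$; $\mathcal V\subset\mathbb R^m$ is an open domain; $f_0\in C^2(\mathbb R^n\times\mathcal V;\mathbb R^n)$; $g\in C^1(\mathbb R^n;\mathbb R^p)$. The plant $\mathbf{P_0}$ is $\dot x=f_0(x,v)$, $y=g(x)$. Norms and inner products are Euclidean. Assumption 1: There exists a function $\Xi\in C^1(\mathcal V;\mathbb R^n)$ such that $f_0(\Xi(v),v)=0$ for all $v\in\mathcal V$. Moreover, the equilibrium points $\{\Xi(v)\mid v\in\mathcal V\}$ are uniformly exponentially stable: there exist $\varepsilon_0>0$, $\lambda>0$ and $\rho\ge1$ such that for each constant input $v_0\in\mathcal V$, if $\|x(0)-\Xi(v_0)\|\le\varepsilon_0$, then the solution of $\dot x=f_0(x,v_0)$ satisfies $\|x(t)-\Xi(v_0)\|\le\rho e^{-\lambda t}\|x(0)-\Xi(v_0)\|$ for every $t\ge0$. Steady-state input-output map: $G(v):=g(\Xi(v))$, $G\in C^1(\mathcal V;\mathbb R^p)$. Assumption 2: $\mathbf{P_0}$ satisfies Assumption 1, and there exist an open domain $\mathcal U\subset\mathbb R^p$, a function $\mathcal N\in C^2(\mathcal U,\mathcal V)$ and $\mu>0$ such that $$\langle G(\mathcal N(u_1))-G(\mathcal N(u_2)),u_1-u_2\rangle\ge\mu\|u_1-u_2\|^2\qquad\forall\,u_1,u_2\in\mathcal U.$$ The constant $\varepsilon_0$ and function $\Xi$ are those of Assumption 1; $\mathcal U$ and $\mathcal N$ are those of Assumption 2. The set $U\subset\mathcal U$ is compact and convex with nonempty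 interior, $Y=G(\mathcal N(U))$, and for $r\in Y$, $u_r:=(G\circ\mathcal N)^{-1}(r)$ (well defined since $G\circ\mathcal N$ is one-to-one on $\mathcal U$). Projection operator: for a closed convex set $X\subset\mathbb R^q$ let $P_X(v)=\arg\min_{w\in X}\|v-w\|$. For $z\in X$, $v\in\mathbb R^q$ put $$\Pi_X(z,v)=\lim_{\delta\to0^+}\frac{P_X(z+\delta v)-z}{\delta},$$ and for $z\in\mathbb R^q\setminus X$ put $\Pi_X(z,v)=\dfrac{P_X(z)-z}{\|P_X(z)-z\|}$. Here $\Pi_U$ is this operator for $X=U$, $q=p$. The state of the closed-loop system is $\begin{bmatrix}x\\ u_I\end{bmatrix}\in\mathbb R^n\times\mathcal U$; the first equation only makes sense on the open set $$\mathcal D_r=\left\{\begin{bmatrix}x\\ u_I\end{bmatrix}\in\mathbb R^n\times\mathcal U\ \Big|\ u_I+\tau_pk(r-g(x))\in\mathcal U\right\}.$$ Solutions are Carathéodory solutions: (locally) absolutely continuous functions satisfying the differential equations for almost every $t$. *)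

(* Defs.v *)
From HB Require Import structures.
From mathcomp Require Import all_boot all_order all_algebra.
From mathcomp Require Import all_classical all_reals all_analysis.

Set Implicit Arguments.
Unset Strict Implicit.
Unset Printing Implicit Defensive.

Import Order.TTheory GRing.Theory Num.Theory.
Import numFieldNormedType.Exports.

Local Open Scope classical_set_scope.
Local Open Scope ring_scope.

(* The library norm `|v| on 'cV[R]_q is the maximum norm: it provides the
   topology and the differential calculus below, while all quantitative
   estimates use the Euclidean norm enorm. *)
Definition dot (R : realType) (q : nat) (u v : 'cV[R]_q) : R :=
  \sum_(i < q) u i 0 * v i 0.

Definition enorm (R : realType) (q : nat) (v : 'cV[R]_q) : R :=
  Num.sqrt (dot v v).

(* Meant for open A and finite-dimensional V, where f is C^(k+1) on A iff it is
   differentiable on A with all its directional derivatives of class C^k. *)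
Fixpoint Ck (R : realType) (V W : normedModType R) (k : nat) (A : set V)
    (f : V -> W) : Prop :=
  if k is k'.+1 then
    (forall x, A x -> differentiable f x) /\ (forall v, Ck k' A ('D_v f))
  else forall x, A x -> {for x, continuous f}.

Definition absolutely_continuous_on (R : realType) (q : nat) (a b : R)
    (z : R -> 'cV[R]_q) : Prop :=
  forall e : R, 0 < e -> exists2 d : R, 0 < d &
    forall (N : nat) (s t : 'I_N -> R),
      (forall i, [/\ a <= s i, s i <= t i & t i <= b]) ->
      trivIset setT (fun i => `]s i, t i[%classic) ->
      \sum_(i < N) (t i - s i) < d ->
      \sum_(i < N) enorm (z (t i) - z (s i)) < e.

(* z is a Caratheodory solution on [0, +oo[, staying in the domain D of the
   vector field F, of z' = F z with z 0 = z0; the values of z on ]-oo, 0[ are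
   irrelevant. *)
Definition is_solution (R : realType) (q : nat) (D : set 'cV[R]_q)
    (F : 'cV[R]_q -> 'cV[R]_q) (z0 : 'cV[R]_q) (z : R -> 'cV[R]_q) : Prop :=
  [/\ z 0 = z0,
      forall t, 0 <= t -> D (z t),
      forall b, 0 <= b -> absolutely_continuous_on 0 b z
    & {ae (@lebesgue_measure R), forall t, 0 < t ->
         is_derive (t : R^o) 1 (z : R^o -> 'cV[R]_q) (F (z t))}].

(* "The solution starting from z0 satisfies P": a global solution exists, and
   uniqueness is not presupposed, so every solution must satisfy P. *)
Definition solution_satisfies (R : realType) (q : nat) (D : set 'cV[R]_q)
    (F : 'cV[R]_q -> 'cV[R]_q) (z0 : 'cV[R]_q)
    (P : (R -> 'cV[R]_q) -> Prop) : Prop :=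
  (exists z, is_solution D F z0 z) /\
  (forall z, is_solution D F z0 z -> P z).

Definition exponentially_stable_equilibrium (R : realType) (q : nat)
    (X D : set 'cV[R]_q) (F : 'cV[R]_q -> 'cV[R]_q) (ze : 'cV[R]_q) : Prop :=
  [/\ X ze, D ze, F ze = 0 &
    exists delta M alpha : R, [/\ 0 < delta, 0 < M, 0 < alpha &
      forall z0, X z0 -> enorm (z0 - ze) <= delta ->
        solution_satisfies D F z0 (fun z => forall t, 0 <= t ->
          enorm (z t - ze) <= M * expR (- alpha * t) * enorm (z0 - ze))]].

Definition exponentially_converges (R : realType) (q : nat)
    (z : R -> 'cV[R]_q) (l : 'cV[R]_q) : Prop :=
  z t @[t --> +oo] --> l /\
  exists M alpha : R, 0 < alpha /\
    forall t, 0 <= t -> enorm (z t - l) <= M * expR (- alpha * t).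

Definition proj (R : realType) (q : nat) (X : set 'cV[R]_q) (v : 'cV[R]_q) :
    'cV[R]_q :=
  get [set w | X w /\ forall w', X w' -> enorm (v - w) <= enorm (v - w')].

Definition Pi (R : realType) (q : nat) (X : set 'cV[R]_q) (z v : 'cV[R]_q) :
    'cV[R]_q :=
  if `[< X z >] then
    lim ((delta^-1 *: (proj X (z + delta *: v) - z)) @[delta --> 0^'+])
  else (enorm (proj X z - z))^-1 *: (proj X z - z).

Definition assumption1 (R : realType) (n m : nat)
    (f0 : 'cV[R]_n -> 'cV[R]_m -> 'cV[R]_n) (calV : set 'cV[R]_m)
    (Xi : 'cV[R]_m -> 'cV[R]_n) (eps0 : R) : Prop :=
  [/\ Ck 1 calV Xi,
      forall v, calV v -> f0 (Xi v) v = 0,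
      0 < eps0
    & exists lambda rho : R, [/\ 0 < lambda, 1 <= rho &
        forall v0, calV v0 -> forall x0, enorm (x0 - Xi v0) <= eps0 ->
          solution_satisfies setT (f0^~ v0) x0 (fun x => forall t, 0 <= t ->
            enorm (x t - Xi v0)
              <= rho * expR (- lambda * t) * enorm (x0 - Xi v0))]].

Definition assumption2 (R : realType) (n m p : nat)
    (f0 : 'cV[R]_n -> 'cV[R]_m -> 'cV[R]_n) (g : 'cV[R]_n -> 'cV[R]_p)
    (calV : set 'cV[R]_m) (Xi : 'cV[R]_m -> 'cV[R]_n) (eps0 : R)
    (calU : set 'cV[R]_p) (N : 'cV[R]_p -> 'cV[R]_m) : Prop :=
  [/\ assumption1 f0 calV Xi eps0,
      open calU,
      (forall u, calU u -> calV (N u)) /\ Ck 2 calU N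
    & exists2 mu : R, 0 < mu & forall u1 u2, calU u1 -> calU u2 ->
        mu * enorm (u1 - u2) ^+ 2
          <= dot (g (Xi (N u1)) - g (Xi (N u2))) (u1 - u2)].

(* The state [x; u_I] of the closed loop is a column of height n + p. *)
Definition closed_loop_field (R : realType) (n m p : nat)
    (f0 : 'cV[R]_n -> 'cV[R]_m -> 'cV[R]_n) (g : 'cV[R]_n -> 'cV[R]_p)
    (N : 'cV[R]_p -> 'cV[R]_m) (U : set 'cV[R]_p) (taup k : R) (r : 'cV[R]_p)
    (z : 'cV[R]_(n + p)) : 'cV[R]_(n + p) :=
  let x := usubmx z in
  let uI := dsubmx z in
  col_mx (f0 x (N (uI + (taup * k) *: (r - g x))))
         (Pi U uI (k *: (r - g x))).

Definition state_space (R : realType) (n p : nat) (calU : set 'cV[R]_p) :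
    set 'cV[R]_(n + p) :=
  [set z | calU (dsubmx z)].

Definition closed_loop_domain (R : realType) (n p : nat)
    (g : 'cV[R]_n -> 'cV[R]_p) (calU : set 'cV[R]_p) (taup k : R)
    (r : 'cV[R]_p) : set 'cV[R]_(n + p) :=
  [set z | calU (dsubmx z) /\
           calU (dsubmx z + (taup * k) *: (r - g (usubmx z)))].

(* Main.v *)
Require Import Defs.
From HB Require Import structures.
From mathcomp Require Import all_boot all_order all_algebra.
From mathcomp Require Import all_classical all_reals all_analysis.
From mathcomp Require Import ring lra.

Set Implicit Arguments.
Unset Strict Implicit.
Unset Printing Implicit Defensive.

Import Order.TTheory GRing.Theory Num.Theory.
Import numFieldNormedType.Exports.

(** For a small gain [k] the integrator state [u] moves slowly, and the plant
    state [x] follows the equilibrium [Gam u = Xi (N u)] belonging to the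
    current input. Along this slow motion the integrator sees the output
    [g (Gam u)], and strong monotonicity of [g \o Gam] makes
    [u' = Pi U u (k (r - g x))] contract towards the input [ur] whose steady
    output is [r]; the projection onto the convex set [U] only helps, because
    [ur] belongs to [U]. The proof makes this quantitative without a converse
    Lyapunov theorem. With [e = enorm (x - Gam u)] and [w = enorm (u - ur)],
    the closed loop is compared, on a time window of a length [T] that does
    not depend on [k], with the plant solution for the constant input equal to
    the value of [u] at the beginning of the window. Exponential stability of
    the plant halves [e] over the window, the perturbation being
    [O(k (e + w))] ([window_excursion]), while [w ^+ 2] shrinks by a factor
    [1 - k mu T / 2] up to an error of order [k (e ^+ 2 + k ^+ 2 w ^+ 2)]
    ([window_decay]). For small [k] the sum [e ^+ 2 + w ^+ 2] is then
    contracted by [1 - k mu T / 4] ([contraction_arith], [evi_decay]), and the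
    bound on [e] keeps the state inside the ball where the data are Lipschitz.

    All differential inequalities are stated through [upper_rate], a one-sided
    bound on difference quotients over the intervals that contain a given
    time. An interval induction ([cousin]) integrates such bounds, also when
    they hold only outside a null set and the curve is absolutely continuous
    ([ac_le_rate]). The closed loop itself enters as an evolution variational
    inequality ([cl_evi]): the rate of [enorm (z - w) ^+ 2 / 2] is at most
    [dot (f z) (z - w)] for every test point [w] of a compact convex set. This
    form is stable under pointwise limits, so Euler polygons with projection,
    along an ultrafilter, converge to a solution of it ([evi_exists]); and it
    can be tested along another trajectory ([moving_test]), which is what the
    comparison above needs.

    Existence of a genuine solution follows because a Lipschitz curve is
    differentiable almost everywhere ([lipschitz_ae_vderiv]), and at such a
    time the variational inequality forces the velocity to be [Pi U u h]
    ([velocity_Pi]), the projection of [h] on the tangent cone of [U] at [u].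
    When the integrator state starts outside [U], as it may in the definition
    of stability, it first runs at unit speed on the segment towards its
    projection ([solution_exists]). Conversely every solution whose
    integrator state starts at distance less than 1 from [U] has it in [U] after
    one unit of time ([solution_enters]), does not leave it
    ([solution_stays]), and satisfies the variational inequality from then on
    ([solution_continue]), so the decay estimate applies to all solutions.
    Up to that time it is controlled by a Gronwall estimate around the
    equilibrium ([near_solution]). *)

Local Open Scope classical_set_scope.
Local Open Scope ring_scope.

(** * Euclidean norm and inner product *)

Section euclid.
Variables (R : realType) (q : nat).
Implicit Types (u v w : 'cV[R]_q) (a : R).

Lemma dotC u v : dot u v = dot v u.
Proof. by apply: eq_bigr => i _; rewrite mulrC. Qed.

Lemma dotDl u v w : dot (u + v) w = dot u w + dot v w.
Proof. by rewrite -big_split; apply: eq_bigr => i _; rewrite mxE mulrDl. Qed.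

Lemma dotDr u v w : dot u (v + w) = dot u v + dot u w.
Proof. by rewrite dotC dotDl !(dotC u). Qed.

Lemma dotZl a u v : dot (a *: u) v = a * dot u v.
Proof. by rewrite mulr_sumr; apply: eq_bigr => i _; rewrite mxE mulrA. Qed.

Lemma dotZr a u v : dot u (a *: v) = a * dot u v.
Proof. by rewrite dotC dotZl dotC. Qed.

Lemma dotNl u v : dot (- u) v = - dot u v.
Proof. by rewrite -scaleN1r dotZl mulN1r. Qed.

Lemma dotNr u v : dot u (- v) = - dot u v.
Proof. by rewrite dotC dotNl dotC. Qed.

Lemma dot0l u : dot 0 u = 0.
Proof. by apply: big1 => i _; rewrite mxE mul0r. Qed.

Lemma dot0r u : dot u 0 = 0.
Proof. by rewrite dotC dot0l. Qed.

Definition dotE := (dotDl, dotDr, dotNl, dotNr, dotZl, dotZr).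

Lemma dot_ge0 v : 0 <= dot v v.
Proof. by apply: sumr_ge0 => i _; rewrite -expr2 sqr_ge0. Qed.

Lemma enorm_ge0 v : 0 <= enorm v.
Proof. exact: sqrtr_ge0. Qed.

Lemma enormE v : enorm v ^+ 2 = dot v v.
Proof. by rewrite sqr_sqrtr// dot_ge0. Qed.

Lemma enorm_sqrt v : enorm v = Num.sqrt (dot v v).
Proof. by []. Qed.

Lemma enorm0 : enorm (0 : 'cV[R]_q) = 0.
Proof. by rewrite /enorm dot0l sqrtr0. Qed.

Lemma enorm_eq0 v : enorm v = 0 -> v = 0.
Proof.
move=> /(congr1 (fun x => x ^+ 2)); rewrite enormE expr0n/= => /eqP.
rewrite psumr_eq0 => [/allP h|i _]; last by rewrite -expr2 sqr_ge0.
apply/matrixP => i j; rewrite (ord1 j) mxE; apply/eqP.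
by have := h i; rewrite mem_index_enum mulf_eq0 orbb => /(_ isT).
Qed.

Lemma enormZ a v : enorm (a *: v) = `|a| * enorm v.
Proof. by rewrite /enorm dotZl dotZr mulrA sqrtrM -?expr2 ?sqr_ge0// sqrtr_sqr. Qed.

Lemma enormN v : enorm (- v) = enorm v.
Proof. by rewrite -scaleN1r enormZ normrN1 mul1r. Qed.

Lemma enormB u v : enorm (u - v) = enorm (v - u).
Proof. by rewrite -opprB enormN. Qed.

(** Expand [0 <= dot d d] for [d = enorm v *: u - enorm u *: v]. *)
Lemma cauchy_schwarz u v : dot u v <= enorm u * enorm v.
Proof.
have [->|u0] := eqVneq u 0; first by rewrite dot0l enorm0 mul0r.
have eu : 0 < enorm u.
  by rewrite lt_neqAle enorm_ge0 andbT eq_sym; apply: contra_neq u0; exact: enorm_eq0.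
have [->|v0] := eqVneq v 0; first by rewrite dot0r enorm0 mulr0.
have ev : 0 < enorm v.
  by rewrite lt_neqAle enorm_ge0 andbT eq_sym; apply: contra_neq v0; exact: enorm_eq0.
have := dot_ge0 (enorm v *: u - enorm u *: v).
rewrite !dotE -!enormE (dotC v u) => h.
have : 0 <= (2 * (enorm u * enorm v)) * (enorm u * enorm v - dot u v).
  by apply: le_trans h _; rewrite le_eqVlt; apply/orP; left; apply/eqP; ring.
by rewrite pmulr_rge0 ?subr_ge0// mulr_gt0 ?mulr_gt0.
Qed.

Lemma cauchy_schwarz_abs u v : `|dot u v| <= enorm u * enorm v.
Proof.
rewrite ler_norml cauchy_schwarz andbT lerNl -dotNl.
by apply: le_trans (cauchy_schwarz _ _) _; rewrite enormN.
Qed.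

Lemma enormD u v : enorm (u + v) <= enorm u + enorm v.
Proof.
rewrite -(ler_pXn2r (n:=2))// ?nnegrE ?addr_ge0 ?enorm_ge0//.
rewrite enormE !dotE -!enormE (dotC v u).
have := cauchy_schwarz u v; nra.
Qed.

Lemma enorm_triangle w u v : enorm (u - v) <= enorm (u - w) + enorm (w - v).
Proof. by rewrite -{1}(subrK w u) -addrA; exact: enormD. Qed.

Lemma enorm_dist u v : `|enorm u - enorm v| <= enorm (u - v).
Proof.
rewrite ler_norml; apply/andP; split.
  by rewrite lerNl opprB lerBlDr enormB; have := enormD (v - u) u; rewrite subrK.
by rewrite lerBlDr; have := enormD (u - v) v; rewrite subrK.
Qed.

Lemma coord_le_enorm v i : `|v i 0| <= enorm v.
Proof.
rewrite -(ler_pXn2r (n:=2))// ?nnegrE ?enorm_ge0//.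
rewrite enormE /dot (bigD1 i)//= real_normK ?num_real// expr2 lerDl.
by apply: sumr_ge0 => j _; rewrite -expr2 sqr_ge0.
Qed.

Lemma enorm_le_sum v : enorm v <= \sum_(i < q) `|v i 0|.
Proof.
have s0 : 0 <= \sum_(i < q) `|v i 0| by apply: sumr_ge0.
rewrite -(ler_pXn2r (n:=2))// ?nnegrE ?enorm_ge0//.
rewrite enormE /dot expr2 mulr_suml; apply: ler_sum => i _.
apply: (@le_trans _ _ (`|v i 0| * `|v i 0|)).
  by rewrite -normrM ler_norm.
by apply: ler_wpM2l => //; rewrite (bigD1 i)//= lerDl sumr_ge0.
Qed.

Lemma coord_le_norm v i : `|v i 0| <= `|v|.
Proof.
rewrite [leRHS]/Num.norm/= mx_normrE.
by apply/bigmax_geP; right => /=; exists (i, 0).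
Qed.

Lemma enorm_le_norm v : enorm v <= q%:R * `|v|.
Proof.
apply: (le_trans (enorm_le_sum v)).
apply: (@le_trans _ _ (\sum_(i < q) `|v|)); first by apply: ler_sum => i _; exact: coord_le_norm.
by rewrite sumr_const card_ord mulr_natl.
Qed.

Lemma norm_le_enorm v : `|v| <= enorm v.
Proof.
rewrite [leLHS]/Num.norm/= mx_normrE; apply/bigmax_leP; split; first exact: enorm_ge0.
by move=> [i j] _ /=; rewrite (ord1 j); exact: coord_le_enorm.
Qed.

(** The topology is that of the maximum norm; the two norms being equivalent,
    Euclidean balls form a basis of neighbourhoods as well. *)
Lemma enorm_nbhsP v (A : set 'cV[R]_q) :
  nbhs v A <-> exists2 e : R, 0 < e & forall w, enorm (w - v) < e -> A w.
Proof.
split=> [/nbhs_ballP[e /= e0 eA]|[e e0 eA]].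
  exists e => // w wv; apply: eA; rewrite -ball_normE/= distrC.
  exact: le_lt_trans (norm_le_enorm _) wv.
have q0 : 0 < (q.+1)%:R :> R by rewrite ltr0n.
apply/nbhs_ballP; exists (e / q.+1%:R) => /=; first by rewrite divr_gt0.
move=> w; rewrite -ball_normE/= => h; apply: eA; rewrite enormB.
apply: le_lt_trans (enorm_le_norm _) _.
apply: (@le_lt_trans _ _ (q.+1%:R * `|v - w|)).
  by apply: ler_wpM2r; rewrite ?ler_nat.
by rewrite mulrC -ltr_pdivlMr.
Qed.

Lemma enorm_continuous : continuous (@enorm R q).
Proof.
move=> v A /nbhs_ballP[e /= e0 eA].
change (nbhs v (@enorm R q @^-1` A)); apply/enorm_nbhsP.
exists e => // w h; apply: eA; rewrite -ball_normE/=.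
by apply: le_lt_trans h; rewrite enormB; exact: enorm_dist.
Qed.

Lemma enorm_cvgP (T : Type) (F : set_system T) (FF : Filter F) (f : T -> 'cV[R]_q) v :
  f @ F --> v <-> forall e : R, 0 < e -> \forall x \near F, enorm (f x - v) < e.
Proof.
split=> [h e e0|h A].
  apply: (h [set w | enorm (w - v) < e]); apply/enorm_nbhsP.
  by exists e.
move=> /enorm_nbhsP[e e0 eA]; apply: (filterS _ (h _ e0)) => x; exact: eA.
Qed.

End euclid.

Section euclid_col.
Variables (R : realType) (n p : nat).

Lemma dot_col_mx (x x' : 'cV[R]_n) (u u' : 'cV[R]_p) :
  dot (col_mx x u) (col_mx x' u') = dot x x' + dot u u'.
Proof.
rewrite /dot big_split_ord/=; congr (_ + _); apply: eq_bigr => i _.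
  by rewrite !col_mxEu.
by rewrite !col_mxEd.
Qed.

Lemma dot_split (z z' : 'cV[R]_(n + p)) :
  dot z z' = dot (usubmx z) (usubmx z') + dot (dsubmx z) (dsubmx z').
Proof. by rewrite -dot_col_mx !vsubmxK. Qed.

Lemma enorm_split (z : 'cV[R]_(n + p)) :
  enorm z ^+ 2 = enorm (usubmx z) ^+ 2 + enorm (dsubmx z) ^+ 2.
Proof. by rewrite !enormE dot_split. Qed.

Lemma enorm_usubmx (z : 'cV[R]_(n + p)) : enorm (usubmx z) <= enorm z.
Proof.
rewrite -(ler_pXn2r (n:=2))// ?nnegrE ?enorm_ge0//.
by rewrite (enorm_split z) lerDl sqr_ge0.
Qed.

Lemma enorm_dsubmx (z : 'cV[R]_(n + p)) : enorm (dsubmx z) <= enorm z.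
Proof.
rewrite -(ler_pXn2r (n:=2))// ?nnegrE ?enorm_ge0//.
by rewrite (enorm_split z) lerDr sqr_ge0.
Qed.

Lemma enorm_col_le (z : 'cV[R]_(n + p)) :
  enorm z <= enorm (usubmx z) + enorm (dsubmx z).
Proof.
rewrite -(ler_pXn2r (n:=2))// ?nnegrE ?addr_ge0 ?enorm_ge0//.
rewrite enorm_split sqrrD -addrA lerD2l lerDr mulrn_wge0//.
by rewrite mulr_ge0 ?enorm_ge0.
Qed.

End euclid_col.

(** * Interval induction and growth rates *)

Lemma absolutely_continuous_on_sub (R : realType) (q : nat) (a b a' b' : R)
    (z : R -> 'cV[R]_q) : a <= a' -> b' <= b ->
  absolutely_continuous_on a b z -> absolutely_continuous_on a' b' z.
Proof.
move=> aa bb zac e e0; have [d d0 H] := zac e e0; exists d => // N s t st.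
apply: H => i; have [h1 h2 h3] := st i; split => //.
  exact: le_trans aa h1.
exact: le_trans h3 bb.
Qed.

Section interval_induction.
Variable R : realType.
Implicit Types (a b : R) (P : R -> R -> Prop).

(** Real induction: an additive property of intervals that holds for all small
    intervals around each point holds for [a, b]. The supremum of the [t] for
    which [P a t] holds belongs to a good small interval, hence is [b]. It
    replaces every partition argument below. *)
Lemma cousin a b P : a <= b ->
  (forall s t u, a <= s -> s <= t -> t <= u -> u <= b ->
     P s t -> P t u -> P s u) ->
  (forall t, a <= t -> t <= b -> exists2 d : R, 0 < d &
     forall s s', a <= s -> s <= t -> t <= s' -> s' <= b ->
       t - s < d -> s' - t < d -> P s s') ->
  P a b.
Proof.
move=> ab Padd Ploc.
pose A := [set t | [/\ a <= t, t <= b & P a t]].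
have Aa : A a.
  split => //; have [d d0 h] := Ploc a (lexx _) ab.
  by apply: h => //; rewrite subrr.
have ubA : ubound A b by move=> t [].
have hsA : has_sup A by split; [exists a|exists b].
have ac : a <= sup A by apply: (sup_upper_bound hsA).
have cb : sup A <= b by apply: ge_sup => //; exists a.
have [d d0 h] := Ploc _ ac cb.
have [t [at_ tb Pt] ct] := sup_adherent d0 hsA.
have tc : t <= sup A by apply: (sup_upper_bound hsA).
pose s := Num.min b (sup A + d / 2).
have cs : sup A <= s by rewrite le_min cb lerDl divr_ge0// ltW.
have sb : s <= b by rewrite ge_min lexx.
have As : A s.
  split => //; first exact: le_trans ac cs.
  apply: (Padd a t s) => //; first exact: le_trans tc cs.
  apply: h => //; first lra.
  by have : s <= sup A + d / 2 by [rewrite ge_min lexx orbT|]; lra.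
have : s <= sup A by apply: (sup_upper_bound hsA).
rewrite /s ge_min => /orP[bc|]; last lra.
suff -> : b = s by case: As.
by apply/eqP; rewrite eq_le sb andbT (le_trans bc).
Qed.

(** The intervals straddle [t], on both sides, because these are the intervals
    that [cousin] asks for. *)
Definition upper_rate a b (f : R -> R) (t c : R) :=
  forall e : R, 0 < e -> exists2 d : R, 0 < d &
    forall s s', a <= s -> s <= t -> t <= s' -> s' <= b ->
      t - s < d -> s' - t < d -> f s' - f s <= (c + e) * (s' - s).

Lemma upper_rate_sub a b a' b' f t c : a <= a' -> b' <= b ->
  upper_rate a b f t c -> upper_rate a' b' f t c.
Proof.
move=> aa bb h e e0; have [d d0 H] := h e e0; exists d => // s s' *.
by apply: H => //; [exact: le_trans aa _|exact: le_trans bb].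
Qed.

Lemma upper_rate_le a b f t c c' : c <= c' ->
  upper_rate a b f t c -> upper_rate a b f t c'.
Proof.
move=> cc h e e0; have [d d0 H] := h e e0; exists d => // s s' as_ st ts sb h1 h2.
apply: le_trans (H _ _ as_ st ts sb h1 h2) _.
apply: ler_wpM2r; last lra.
by rewrite subr_ge0 (le_trans st).
Qed.

(** Measures the exceptional intervals met by [ac_le_rate], which all lie in one
    open set of small measure. *)
Lemma disjoint_length (l : seq (R * R)) (V : set R) : open V ->
  all (fun x => x.1 <= x.2) l ->
  pairwise (fun x y : R * R => x.2 <= y.1) l ->
  (forall x, x \in l -> `]x.1, x.2[ `<=` V) ->
  ((\sum_(x <- l) (x.2 - x.1))%:E <= lebesgue_measure V)%E.
Proof.
move=> oV /allP bl /(pairwiseP (0, 0)) pl lV.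
pose F i := `](nth (0, 0) l i).1, (nth (0, 0) l i).2[%classic : set R.
have nthd i : (size l <= i)%N -> F i = set0.
  by move=> li; rewrite /F nth_default//= set_itv_ge// bnd_simp ltxx.
have tF : trivIset [set: nat] F.
  apply/trivIsetP => i j _ _ ij.
  wlog {ij} ij : i j / (i < j)%N.
    move=> w; case: (ltngtP i j) ij => // ij _; first exact: w.
    by rewrite setIC; exact: w.
  have [lj|jl] := leqP (size l) j; first by rewrite (nthd j)// setI0.
  have := pl i j; rewrite !inE => /(_ (ltn_trans ij jl) jl ij) h.
  rewrite -subset0 => x []; rewrite /F /= !in_itv/= => /andP[_ x1] /andP[x2 _].
  by move: h; rewrite leNgt (lt_trans x2 x1).
have mF i : measurable (F i) by exact: measurable_itv.
have <- : lebesgue_measure (\big[setU/set0]_(i < size l) F i)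
    = (\sum_(x <- l) (x.2 - x.1))%:E.
  rewrite measure_bigsetU// (big_nth (0, 0)) big_mkord -sumEFin.
  apply: eq_bigr => i _; rewrite [LHS]lebesgue_measure_itv/= lte_fin.
  have h := bl _ (mem_nth (0, 0) (ltn_ord i)).
  by case: ltgtP h => // -> _; rewrite subrr.
apply: le_measure; rewrite ?inE.
- by apply: bigsetU_measurable => i _; exact: mF.
- exact: measurable_realfun.open_measurable.
- by rewrite -bigcup_mkord => x [i /= il]; apply: lV; exact: mem_nth.
Qed.

Lemma negligible_open_cover (E : set R) d : lebesgue_measure.-negligible E ->
  0 < d -> exists V : set R, [/\ open V, E `<=` V & (lebesgue_measure V < d%:E)%E].
Proof.
move=> [M [mM M0 EM]] d0.
have [|V [oV MV Vd]] := lebesgue_regularity_outer mM _ d0; first by rewrite [ltLHS]M0.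
exists V; split => //; first exact: subset_trans EM MV.
have -> : lebesgue_measure V = (lebesgue_measure (V `\` M) + lebesgue_measure (V `&` M))%E.
  by apply: measureDI => //; exact: measurable_realfun.open_measurable.
by rewrite (setIidr MV) [X in (_ + X)%E]M0 adde0.
Qed.

Section absolute_continuity.
Variables (q : nat) (a b : R) (z : R -> 'cV[R]_q).
Hypothesis zac : absolutely_continuous_on a b z.

(** Absolute continuity for ordered lists of intervals, the form in which
    intervals are collected in [ac_le_rate]. *)
Lemma absolutely_continuous_seq e : 0 < e -> exists2 d : R, 0 < d &
  forall l : seq (R * R),
    all (fun x => [&& a <= x.1, x.1 <= x.2 & x.2 <= b]) l ->
    pairwise (fun x y : R * R => x.2 <= y.1) l ->
    \sum_(x <- l) (x.2 - x.1) < d ->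
    \sum_(x <- l) enorm (z x.2 - z x.1) < e.
Proof.
move=> e0; have [d d0 H] := zac e0; exists d => // l /allP bl /(pairwiseP (0, 0)) pl.
rewrite !(big_nth (0, 0)) !big_mkord => len.
apply: (H _ (fun i : 'I__ => (nth (0, 0) l i).1) (fun i : 'I__ => (nth (0, 0) l i).2)) => //.
  by move=> i; have /and3P[] := bl _ (mem_nth (0, 0) (ltn_ord i)).
apply/trivIsetP => i j _ _ ij.
wlog {ij} ij : i j / (i < j)%N.
  move=> w; case: (ltngtP i j) ij => // [||/val_inj ->]; last by rewrite eqxx.
    by move=> ij _; exact: w.
  by move=> ij _; rewrite setIC; exact: w.
have := pl i j; rewrite !inE => /(_ (ltn_ord _) (ltn_ord _) ij) h.
rewrite -subset0 => x [] /=; rewrite !in_itv/= => /andP[_ x1] /andP[x2 _].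
by move: h; rewrite leNgt (lt_trans x2 x1).
Qed.

(** Cover the null set [E] by an open set [V] of small measure. Around a point
    outside [E] the rate bound applies; around a point of [E] the interval is
    put into the list [l] of intervals inside [V], and absolute continuity of
    the dominating curve [z] makes their total contribution small. Interval
    induction adds the two kinds of intervals. *)
Lemma ac_le_rate (f : R -> R) (C k : R) (E : set R) : a <= b -> 0 <= C ->
  (forall s t, a <= s -> s <= t -> t <= b -> `|f t - f s| <= C * enorm (z t - z s)) ->
  lebesgue_measure.-negligible E ->
  (forall t, a <= t -> t <= b -> ~ E t -> upper_rate a b f t k) ->
  f b - f a <= k * (b - a).
Proof.
move=> ab C0 fz nE hf; apply/ler_addgt0Pr => e e0.
pose D := (b - a) + C + `|k| + 2.
have D0 : 0 < D by have := normr_ge0 k; rewrite /D; lra.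
pose eps := Num.min 1 (e / D).
have eps0 : 0 < eps by rewrite lt_min ltr01 divr_gt0.
have eps1 : eps <= 1 by rewrite ge_min lexx.
have epsD : eps * D <= e by rewrite -ler_pdivlMr// ge_min lexx orbT.
have [d d0 zd] := absolutely_continuous_seq eps0.
have d'0 : 0 < Num.min d eps by rewrite lt_min d0.
have [V [oV EV Vd]] := negligible_open_cover nE d'0.
pose K := `|k| + eps.
have K0 : 0 <= K by rewrite addr_ge0// ltW.
pose P s s' := exists l : seq (R * R),
  [/\ all (fun x => [&& s <= x.1, x.1 <= x.2 & x.2 <= s']) l,
      pairwise (fun x y : R * R => x.2 <= y.1) l,
      forall x, x \in l -> `]x.1, x.2[ `<=` V
    & f s' - f s <= (k + eps) * (s' - s) + C * (\sum_(x <- l) enorm (z x.2 - z x.1))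
         + K * (\sum_(x <- l) (x.2 - x.1))].
have [|t at_ tb|l [bl pl lV fl]] := @cousin a b P ab.
- move=> s t u as_ st tu ub [l [bl pl lV fl]] [l' [bl' pl' lV' fl']].
  exists (l ++ l'); split.
  + rewrite all_cat; apply/andP; split.
      apply: sub_all bl => x /and3P[h1 h2 h3]; apply/and3P; split => //; exact: le_trans h3 tu.
    apply: sub_all bl' => x /and3P[h1 h2 h3]; apply/and3P; split => //; exact: le_trans st h1.
  + rewrite pairwise_cat pl pl' !andbT; apply/allrelP => x y /(allP bl) /and3P[_ _ h].
    by move=> /(allP bl') /and3P[h' _ _]; exact: le_trans h h'.
  + by move=> x; rewrite mem_cat => /orP[/lV|/lV'].
  + rewrite !big_cat/=; lra.
- have [tE|tE] := pselect (E t).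
    have /nbhs_ballP[r /= r0 rV] : nbhs t V.
      by apply: open_nbhs_nbhs; split => //; exact: EV.
    exists r => // s s' as_ st ts sb h1 h2; exists [:: (s, s')]; split => //=.
    + by rewrite !lexx (le_trans st ts).
    + move=> x; rewrite inE => /eqP -> y /=; rewrite in_itv/= => /andP[y1 y2].
      apply: rV; rewrite /ball/= ltr_norml; apply/andP; split; lra.
    + rewrite !big_seq1/=.
      have := fz s s' as_ (le_trans st ts) sb.
      have : - (k + eps) * (s' - s) <= K * (s' - s).
        apply: ler_wpM2r; first by rewrite subr_ge0 (le_trans st).
        by rewrite /K; have := ler_norm (- k); rewrite normrN; lra.
      have := ler_norm (f s' - f s); lra.
  have [r r0 h] := hf t at_ tb tE _ eps0.
  exists r => // s s' as_ st ts sb h1 h2; exists [::]; split => //=.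
  by rewrite !big_nil !mulr0 !addr0; exact: h.
have len : \sum_(x <- l) (x.2 - x.1) < Num.min d eps.
  rewrite -lte_fin; apply: le_lt_trans Vd; apply: disjoint_length => //.
  by apply: sub_all bl => x /and3P[].
have zl : \sum_(x <- l) enorm (z x.2 - z x.1) < eps.
  by apply: zd => //; apply: lt_le_trans len _; rewrite ge_min lexx.
have {}len : \sum_(x <- l) (x.2 - x.1) < eps.
  by apply: lt_le_trans len _; rewrite ge_min lexx orbT.
apply: le_trans fl _.
have := ler_wpM2l C0 (ltW zl); have := ler_wpM2l K0 (ltW len).
have : K * eps <= (`|k| + 1) * eps by apply: ler_wpM2r; [exact: ltW|rewrite /K; lra].
move: epsD; rewrite /D; lra.
Qed.

End absolute_continuity.

Lemma le_rate a b (f : R -> R) k : a <= b ->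
  (forall t, a <= t -> t <= b -> upper_rate a b f t k) ->
  f b - f a <= k * (b - a).
Proof.
move=> ab hf; apply/ler_addgt0Pr => e e0.
have D0 : 0 < b - a + 1 by lra.
pose eps := e / (b - a + 1); have eps0 : 0 < eps by rewrite divr_gt0.
apply: (@le_trans _ _ ((k + eps) * (b - a))); last first.
  have : eps * (b - a + 1) = e by rewrite /eps mulfVK ?gt_eqF.
  lra.
pose P s s' := f s' - f s <= (k + eps) * (s' - s).
apply: (@cousin a b P ab) => [s t u _ _ _ _|t at_ tb]; first by rewrite /P; lra.
exact: hf.
Qed.

End interval_induction.

(** * Differential inequalities along curves *)

Section rates.
Variable R : realType.
Implicit Types (a b t c : R) (f g : R -> R).

(** Continuity and differentiability relative to [a, b] are taken in
    epsilon-delta form, so that restriction to a subinterval is immediate and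
    the endpoints need no separate treatment. *)
Definition rcont a b f t := forall e : R, 0 < e -> exists2 d : R, 0 < d &
  forall s, a <= s -> s <= b -> `|s - t| < d -> `|f s - f t| <= e.

Definition rderiv a b f t c := forall e : R, 0 < e -> exists2 d : R, 0 < d &
  forall s, a <= s -> s <= b -> `|s - t| < d ->
    `|f s - f t - (s - t) * c| <= e * `|s - t|.

Lemma min_gt0 (x y : R) : 0 < x -> 0 < y -> 0 < Num.min x y.
Proof. by move=> x0 y0; rewrite lt_min x0. Qed.

Lemma lt_min_l (x y z : R) : z < Num.min x y -> z < x.
Proof. by rewrite lt_min => /andP[]. Qed.

Lemma lt_min_r (x y z : R) : z < Num.min x y -> z < y.
Proof. by rewrite lt_min => /andP[]. Qed.

Lemma rderiv_rate a b f t c : rderiv a b f t c -> upper_rate a b f t c.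
Proof.
move=> h e e0; have [d d0 H] := h e e0; exists d => // s s' as_ st ts sb h1 h2.
have := H s as_ (le_trans st (le_trans ts sb)).
rewrite ler0_norm ?subr_le0// opprB => /(_ h1).
have := H s' (le_trans as_ (le_trans st ts)) sb.
rewrite ger0_norm ?subr_ge0// => /(_ h2).
by rewrite !ler_norml => /andP[_ k1] /andP[k2 _]; lra.
Qed.

Lemma upper_rateD a b f g t c c' : upper_rate a b f t c ->
  upper_rate a b g t c' -> upper_rate a b (fun s => f s + g s) t (c + c').
Proof.
move=> hf hg e e0; have e20 : 0 < e / 2 by rewrite divr_gt0.
have [d d0 H] := hf _ e20; have [d' d'0 H'] := hg _ e20.
exists (Num.min d d'); first exact: min_gt0.
move=> s s' as_ st ts sb h1 h2.
have := H s s' as_ st ts sb (lt_min_l h1) (lt_min_l h2).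
have := H' s s' as_ st ts sb (lt_min_r h1) (lt_min_r h2).
rewrite !(mulrDl _ _ (s' - s)); lra.
Qed.

Lemma upper_rateZ a b f t c k : 0 <= k -> upper_rate a b f t c ->
  upper_rate a b (fun s => k * f s) t (k * c).
Proof.
move=> k0 hf e e0.
have k10 : 0 < k + 1 by lra.
have [d d0 H] := hf (e / (k + 1)) (divr_gt0 e0 k10).
exists d => // s s' as_ st ts sb h1 h2.
have := ler_wpM2l k0 (H s s' as_ st ts sb h1 h2).
have ss : 0 <= s' - s by lra.
have : k * (e / (k + 1)) * (s' - s) <= e * (s' - s).
  apply: ler_wpM2r => //.
  by rewrite mulrCA ler_piMr ?(ltW e0)// ler_pdivrMr//; lra.
rewrite -mulrBr; lra.
Qed.

Lemma upper_rate_ext a b f g t c : f =1 g -> upper_rate a b f t c ->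
  upper_rate a b g t c.
Proof. by move=> /funext ->. Qed.

Lemma rderiv_cst a b k t : rderiv a b (fun=> k) t 0.
Proof.
move=> e e0; exists 1 => // s _ _ _.
by rewrite subrr sub0r mulr0 normrN normr0 mulr_ge0// ltW.
Qed.

Lemma rderivZ a b f t c k : rderiv a b f t c ->
  rderiv a b (fun s => k * f s) t (k * c).
Proof.
move=> hf e e0.
have k10 : 0 < `|k| + 1 by have := normr_ge0 k; lra.
have [d d0 H] := hf (e / (`|k| + 1)) (divr_gt0 e0 k10).
exists d => // s as_ sb h.
rewrite mulrCA -!mulrBr normrM.
apply: le_trans (ler_wpM2l (normr_ge0 _) (H s as_ sb h)) _.
rewrite mulrA; apply: ler_wpM2r => //.
by rewrite mulrCA ler_piMr ?(ltW e0)// ler_pdivrMr//; lra.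
Qed.

(** A nonnegative value of the weight preserves the direction of the rate
    bound, and the product of the two increments is of second order. *)
Lemma upper_rateM a b f g t c k : rcont a b f t -> upper_rate a b f t c ->
  rderiv a b g t k -> 0 <= g t ->
  upper_rate a b (fun s => f s * g s) t (g t * c + f t * k).
Proof.
move=> cf hf hg g0.
have r3 : rderiv a b (fun s => (g s - g t) * (f s - f t)) t 0.
  move=> e e0.
  have [d1 d10 H1] := hg 1 ltr01.
  have k0 : 0 < `|k| + 1 by have := normr_ge0 k; lra.
  have [d2 d20 H2] := cf (e / (`|k| + 1)) (divr_gt0 e0 k0).
  exists (Num.min d1 d2); first exact: min_gt0.
  move=> s as_ sb st; rewrite subrr mul0r mulr0 !subr0 normrM.
  have h1 : `|g s - g t| <= (`|k| + 1) * `|s - t|.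
    have -> : g s - g t = (g s - g t - (s - t) * k) + (s - t) * k by rewrite subrK.
    apply: le_trans (ler_normD _ _) _; rewrite normrM.
    by have := H1 s as_ sb (lt_min_l st); lra.
  apply: le_trans (ler_pM (normr_ge0 _) (normr_ge0 _) h1 (H2 s as_ sb (lt_min_r st))) _.
  by rewrite mulrAC mulrCA divff ?gt_eqF// mulr1.
have r2 := rderiv_rate (rderivZ (f t) hg).
have r0 := rderiv_rate (rderiv_cst a b (- (f t * g t)) t).
have := upper_rateD (upper_rateD (upper_rateZ g0 hf) r2)
   (upper_rateD (rderiv_rate r3) r0).
rewrite !addr0; apply: upper_rate_ext => s /=; ring.
Qed.

Lemma expR_taylor1 (h : R) : `|h| <= 1 / 2 -> `|expR h - 1 - h| <= 2 * h ^+ 2.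
Proof.
rewrite ler_norml => /andP[h1 h2].
have k1 := expR_ge1Dx h.
have k2 := expR_ge1Dx (- h).
have k3 : expR h * expR (- h) = 1 by rewrite -expRD subrr expR0.
have k4 := expR_gt0 h.
rewrite ger0_norm; nra.
Qed.

Lemma rderiv_expR a b k t0 t :
  rderiv a b (fun s => expR (k * (s - t0))) t (k * expR (k * (t - t0))).
Proof.
move=> e e0.
set E := expR (k * (t - t0)).
have E0 : 0 < E by exact: expR_gt0.
pose D := 2 * E * k ^+ 2 + 1.
have D0 : 0 < D by rewrite /D; have := sqr_ge0 k; nra.
have k10 : 0 < `|k| + 1 by have := normr_ge0 k; lra.
exists (Num.min (1 / 2 / (`|k| + 1)) (e / D)).
  by rewrite min_gt0// divr_gt0// divr_gt0.
move=> s _ _ st; have := lt_min_r st; have := lt_min_l st.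
rewrite !ltr_pdivlMr// => h1 h2.
have -> : expR (k * (s - t0)) - E - (s - t) * (k * E)
   = E * (expR (k * (s - t)) - 1 - k * (s - t)).
  have -> : k * (s - t0) = k * (t - t0) + k * (s - t) by ring.
  by rewrite expRD -/E; ring.
rewrite normrM (gtr0_norm E0).
have h3 : `|k * (s - t)| <= 1 / 2.
  rewrite normrM; have := normr_ge0 (s - t); have := normr_ge0 k; nra.
apply: le_trans (ler_wpM2l (ltW E0) (expR_taylor1 h3)) _.
rewrite exprMn -[(s - t) ^+ 2]real_normK ?num_real//.
have := normr_ge0 (s - t); rewrite /D in h2; nra.
Qed.

(** Apply [le_rate] to [f] multiplied by the integrating factor
    [expR (- k (t - a))]. *)
Lemma gronwall_weight a b f k D D' : a <= b ->
  (forall t, a <= t -> t <= b -> rcont a b f t) ->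
  (forall t, a <= t -> t <= b -> upper_rate a b f t (k * f t + D)) ->
  (forall t, a <= t -> t <= b -> expR (- k * (t - a)) * D <= D') ->
  f b * expR (- k * (b - a)) <= f a + D' * (b - a).
Proof.
move=> ab cf hf hD.
have := @le_rate R a b (fun s => f s * expR (- k * (s - a))) D' ab.
rewrite subrr mulr0 expR0 mulr1 => h.
rewrite -lerBlDl; apply: h => t at_ tb.
have E0 := expR_ge0 (- k * (t - a)).
have := upper_rateM (cf t at_ tb) (hf t at_ tb) (@rderiv_expR a b (- k) a t) E0.
apply: upper_rate_le; apply: le_trans (hD t at_ tb).
by rewrite le_eqVlt; apply/orP; left; apply/eqP; ring.
Qed.

Lemma gronwall a b f k D : a <= b -> 0 <= k -> 0 <= D ->
  (forall t, a <= t -> t <= b -> rcont a b f t) ->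
  (forall t, a <= t -> t <= b -> upper_rate a b f t (k * f t + D)) ->
  f b <= expR (k * (b - a)) * (f a + D * (b - a)).
Proof.
move=> ab k0 D0 cf hf.
have : f b * expR (- k * (b - a)) <= f a + D * (b - a).
  apply: (gronwall_weight ab cf hf) => t at_ _.
  apply: ler_piMl => //.
  by rewrite -expR0 ler_expR mulNr oppr_le0 mulr_ge0// subr_ge0.
by rewrite mulNr expRN ler_pdivrMr ?expR_gt0// mulrC.
Qed.

Lemma gronwall_decay a b f k D : a <= b -> 0 <= k -> 0 <= D ->
  (forall t, a <= t -> t <= b -> rcont a b f t) ->
  (forall t, a <= t -> t <= b -> upper_rate a b f t (- k * f t + D)) ->
  f b <= expR (- k * (b - a)) * f a + D * (b - a).
Proof.
move=> ab k0 D0 cf hf.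
have : f b * expR (- - k * (b - a)) <= f a + expR (k * (b - a)) * D * (b - a).
  apply: (gronwall_weight ab cf hf) => t at_ tb.
  apply: ler_wpM2r => //.
  by rewrite opprK ler_expR; apply: ler_wpM2l => //; lra.
rewrite opprK mulNr expRN => h.
have E0 := expR_gt0 (k * (b - a)).
rewrite -(ler_pM2r E0); apply: le_trans h _.
rewrite le_eqVlt; apply/orP; left; apply/eqP; field.
by rewrite gt_eqF.
Qed.

(** A bound that improves itself propagates: if [h <= r'] on an initial interval
    implies the stronger [h <= r] at its end, then by continuity the interval
    can be prolonged, with a step that interval induction takes care of. *)
Lemma bound_continuation a b (h : R -> R) (r r' : R) : a <= b -> r < r' ->
  (forall t, a <= t -> t <= b -> rcont a b h t) ->
  (forall s, a <= s -> s <= b -> (forall t, a <= t -> t <= s -> h t <= r') ->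
     h s <= r) ->
  h a <= r' -> forall t, a <= t -> t <= b -> h t <= r'.
Proof.
move=> ab rr ch hh ha.
pose P s s' := (forall t, a <= t -> t <= s -> h t <= r') ->
  (forall t, a <= t -> t <= s' -> h t <= r').
suff : P a b.
  by apply => t at_ ta; have -> : t = a by [apply/eqP; rewrite eq_le ta].
apply: (@cousin R a b P ab) => [s t u _ _ _ _ P1 P2 /P1/P2//|t at_ tb].
have e0 : 0 < (r' - r) / 2 by lra.
have [d d0 H] := ch t at_ tb _ e0.
exists d => // s s' as_ st ts sb h1 h2 hs v av vs'.
have [vs|/ltW sv] := leP v s; first exact: hs.
have h3 : h s <= r by apply: hh => //; lra.
have : `|h s - h t| <= (r' - r) / 2 by apply: H => //; [lra|rewrite ltr_norml; lra].
have : `|h v - h t| <= (r' - r) / 2 by apply: H => //; [lra|rewrite ltr_norml; lra].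
by rewrite !ler_norml => /andP[_ k1] /andP[k2 _]; lra.
Qed.

(** A rate bound known off a null set holds at every point when the bound [c]
    is continuous: integrate it over small intervals around [t]. *)
Lemma ac_upper_rate (q : nat) a b (z : R -> 'cV[R]_q) f (c : R -> R) (C : R)
    (E : set R) t :
  absolutely_continuous_on a b z -> 0 <= C ->
  (forall s t, a <= s -> s <= t -> t <= b ->
    `|f t - f s| <= C * enorm (z t - z s)) ->
  lebesgue_measure.-negligible E ->
  (forall t, a <= t -> t <= b -> ~ E t -> upper_rate a b f t (c t)) ->
  rcont a b c t -> upper_rate a b f t (c t).
Proof.
move=> zac C0 fz nE hf cc e e0; have [d d0 H] := cc e e0.
exists d => // s s' as_ st ts sb h1 h2.
apply: (ac_le_rate (absolutely_continuous_on_sub as_ sb zac) _ C0 _ nE); first lra.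
  by move=> u v su uv vs; apply: fz => //; lra.
move=> u su us Eu.
have au : a <= u by lra.
have ub : u <= b by lra.
apply: (upper_rate_sub as_ sb).
apply: upper_rate_le (hf u au ub Eu).
have : `|c u - c t| <= e by apply: H => //; rewrite ltr_norml; lra.
by rewrite ler_norml; lra.
Qed.

End rates.

Section vector_rates.
Variables (R : realType) (q : nat).
Implicit Types (a b t : R) (z y : R -> 'cV[R]_q) (d w : 'cV[R]_q).

Definition vcont a b z t := forall e : R, 0 < e -> exists2 d : R, 0 < d &
  forall s, a <= s -> s <= b -> `|s - t| < d -> enorm (z s - z t) <= e.

Definition vderiv a b z t d := forall e : R, 0 < e -> exists2 r : R, 0 < r &
  forall s, a <= s -> s <= b -> `|s - t| < r ->
    enorm (z s - z t - (s - t) *: d) <= e * `|s - t|.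

(** Half the squared norm, whose derivative along [z] is [dot z' z] without a
    factor 2. *)
Definition hsq (v : 'cV[R]_q) : R := dot v v / 2.

Lemma hsqE v : hsq v = enorm v ^+ 2 / 2.
Proof. by rewrite enormE. Qed.

Lemma hsq_le v w : enorm v <= enorm w -> hsq v <= hsq w.
Proof.
move=> vw; rewrite !hsqE ler_pM2r ?invr_gt0// ler_pXn2r ?nnegrE ?enorm_ge0//.
Qed.

Lemma hsq_ge0 v : 0 <= hsq v.
Proof. by rewrite hsqE divr_ge0// sqr_ge0. Qed.

Lemma hsqD v w : hsq (v + w) = hsq v + dot v w + hsq w.
Proof. by rewrite /hsq !dotE (dotC w v); field. Qed.

Lemma hsqN v : hsq (- v) = hsq v.
Proof. by rewrite /hsq dotNl dotNr opprK. Qed.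

Lemma vcont_sub a b a' b' z t : a <= a' -> b' <= b ->
  vcont a b z t -> vcont a' b' z t.
Proof.
move=> aa bb h e e0; have [d d0 H] := h e e0; exists d => // s *.
by apply: H => //; [exact: le_trans aa _|exact: le_trans bb].
Qed.

Lemma vderiv_lip a b z t d : vderiv a b z t d -> exists2 r : R, 0 < r &
  forall s, a <= s -> s <= b -> `|s - t| < r ->
    enorm (z s - z t) <= (enorm d + 1) * `|s - t|.
Proof.
move=> h; have [r r0 H] := h 1 ltr01; exists r => // s as_ sb st.
rewrite -(subrK ((s - t) *: d) (z s - z t)).
apply: le_trans (enormD _ _) _; rewrite enormZ.
by have := H s as_ sb st; lra.
Qed.

Lemma vderiv_vcont a b z t d : vderiv a b z t d -> vcont a b z t.
Proof.
move=> /vderiv_lip[r r0 H] e e0.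
have d0 : 0 < enorm d + 1 by have := enorm_ge0 d; lra.
exists (Num.min r (e / (enorm d + 1))); first by rewrite min_gt0// divr_gt0.
move=> s as_ sb st; apply: le_trans (H s as_ sb (lt_min_l st)) _.
by have := lt_min_r st; rewrite ltr_pdivlMr// mulrC => /ltW.
Qed.

Lemma ac_vcont a b z t : absolutely_continuous_on a b z -> a <= t -> t <= b ->
  vcont a b z t.
Proof.
move=> zac at_ tb e e0; have [d d0 H] := zac e e0; exists d => // s as_ sb st.
have tr (x y : R) : trivIset setT (fun i : 'I_1 => `]x, y[%classic).
  by apply/trivIsetP => i j _ _; rewrite (ord1 i) (ord1 j) eqxx.
have [ts|/ltW ts] := leP t s.
  have := H 1%N (fun=> t) (fun=> s); rewrite !big_ord1 => k; apply/ltW/k => //.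
  by move: st; rewrite ger0_norm ?subr_ge0.
rewrite enormB.
have := H 1%N (fun=> s) (fun=> t); rewrite !big_ord1 => k; apply/ltW/k => //.
by move: st; rewrite ler0_norm ?subr_le0// opprB.
Qed.

Lemma rcont_lip a b z (f : R -> R) (C : R) t : 0 <= C ->
  (forall s, a <= s -> s <= b -> `|f s - f t| <= C * enorm (z s - z t)) ->
  vcont a b z t -> rcont a b f t.
Proof.
move=> C0 h cz e e0.
have C10 : 0 < C + 1 by lra.
have [d d0 H] := cz (e / (C + 1)) (divr_gt0 e0 C10); exists d => // s as_ sb st.
apply: le_trans (h s as_ sb) _.
apply: le_trans (ler_wpM2l C0 (H s as_ sb st)) _.
by rewrite mulrCA ler_piMr ?(ltW e0)// ler_pdivrMr//; lra.
Qed.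

Lemma rcont_hsq a b z w t : vcont a b z t -> rcont a b (fun s => hsq (z s - w)) t.
Proof.
move=> cz e e0; set B := enorm (z t - w) + 1.
have B0 : 0 < B by have := enorm_ge0 (z t - w); rewrite /B; lra.
have eB0 : 0 < Num.min 1 (e / B) by rewrite min_gt0// divr_gt0.
have [d d0 H] := cz _ eB0.
exists d => // s as_ sb st; have := H s as_ sb st.
rewrite le_min ler_pdivlMr// => /andP[h1 h2].
have -> : z s - w = (z t - w) + (z s - z t) by rewrite [RHS]addrC addrA subrK.
rewrite hsqD (_ : _ - _ = dot (z t - w) (z s - z t) + hsq (z s - z t)); last by ring.
rewrite hsqE.
have := cauchy_schwarz_abs (z t - w) (z s - z t).
rewrite ler_norml => /andP[k1 k2].
have x0 := enorm_ge0 (z s - z t); rewrite ler_norml.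
move: h2; rewrite /B => h2.
have xx : enorm (z s - z t) ^+ 2 <= enorm (z s - z t) by rewrite expr2 ler_piMr.
have := sqr_ge0 (enorm (z s - z t)).
by move=> ?; apply/andP; split; lra.
Qed.

Lemma rderiv_hsq a b z w t d : vderiv a b z t d ->
  rderiv a b (fun s => hsq (z s - w)) t (dot d (z t - w)).
Proof.
move=> dz e e0.
set M := enorm (z t - w) + 1.
have M0 : 0 < M by have := enorm_ge0 (z t - w); rewrite /M; lra.
have [r1 r10 H1] := vderiv_lip dz.
set L := enorm d + 1 in H1.
have L0 : 0 < L by have := enorm_ge0 d; rewrite /L; lra.
have e1 : 0 < e / 2 / M by rewrite !divr_gt0.
have [r2 r20 H2] := dz _ e1.
have e2 : 0 < e / L ^+ 2 by rewrite divr_gt0// exprn_gt0.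
exists (Num.min (Num.min r1 r2) (e / L ^+ 2)); first by rewrite !min_gt0.
move=> s as_ sb st.
have s1 := lt_min_l (lt_min_l st); have s2 := lt_min_r (lt_min_l st).
have s3 := lt_min_r st; rewrite ltr_pdivlMr ?exprn_gt0// in s3.
have -> : hsq (z s - w) - hsq (z t - w) - (s - t) * dot d (z t - w)
    = dot (z s - z t - (s - t) *: d) (z t - w) + hsq (z s - z t).
  have -> : z s - w = (z t - w) + (z s - z t) by rewrite [RHS]addrC addrA subrK.
  by rewrite hsqD (dotC (z t - w) (z s - z t)) !dotE; ring.
apply: le_trans (ler_normD _ _) _.
have -> : e * `|s - t| = e / 2 / M * `|s - t| * M + (e / 2) * `|s - t|.
  by field; rewrite gt_eqF.
apply: lerD.
  apply: le_trans (cauchy_schwarz_abs _ _) _.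
  apply: ler_pM; rewrite ?enorm_ge0//; first exact: H2.
  by rewrite /M; lra.
rewrite hsqE ger0_norm ?divr_ge0 ?sqr_ge0//.
have := H1 s as_ sb s1; have := enorm_ge0 (z s - z t); have := normr_ge0 (s - t).
set x := `|s - t| in s3 *; set y := enorm _ => x0 y0 yx.
have : y ^+ 2 <= (L * x) ^+ 2 by rewrite ler_pXn2r ?nnegrE// (le_trans y0).
rewrite exprMn; nra.
Qed.

(** The variational inequality can be tested along a trajectory: the function
    [hsq (z s - y s)] differs from [hsq (z s - y t)] by [B s], which is
    differentiable at [t] although [z] is only continuous there. *)
Lemma moving_test a b z y t d fz :
  vcont a b z t -> vderiv a b y t d ->
  upper_rate a b (fun s => hsq (z s - y t)) t (dot fz (z t - y t)) ->
  upper_rate a b (fun s => hsq (z s - y s)) t (dot (fz - d) (z t - y t)).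
Proof.
move=> cz dy hz.
pose B s := - dot (z s - y t) (y s - y t) + hsq (y s - y t).
have rB : rderiv a b B t (- dot d (z t - y t)).
  move=> e e0.
  set M := enorm (z t - y t) + 1.
  have M0 : 0 < M by have := enorm_ge0 (z t - y t); rewrite /M; lra.
  have [r1 r10 H1] := vderiv_lip dy.
  set L := enorm d + 1 in H1.
  have L0 : 0 < L by have := enorm_ge0 d; rewrite /L; lra.
  have e1 : 0 < e / 3 / M by rewrite !divr_gt0.
  have [r2 r20 H2] := dy _ e1.
  have e2 : 0 < e / 3 / L by rewrite !divr_gt0.
  have [r3 r30 H3] := cz _ e2.
  have e3 : 0 < e / 3 / L ^+ 2 by rewrite !divr_gt0// exprn_gt0.
  exists (Num.min (Num.min r1 r2) (Num.min r3 (e / 3 / L ^+ 2))).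
    by rewrite !min_gt0.
  move=> s as_ sb st.
  have s1 := lt_min_l (lt_min_l st); have s2 := lt_min_r (lt_min_l st).
  have s3 := lt_min_l (lt_min_r st); have s4 := lt_min_r (lt_min_r st).
  rewrite ltr_pdivlMr ?exprn_gt0// in s4.
  have -> : B s - B t - (s - t) * - dot d (z t - y t)
    = - dot (y s - y t - (s - t) *: d) (z t - y t)
      + (- dot (z s - z t) (y s - y t)) + hsq (y s - y t).
    have h0 : hsq (0 : 'cV[R]_q) = 0 by rewrite /hsq dot0r mul0r.
    have zE : z s - y t = (z s - z t) + (z t - y t) by rewrite addrA subrK.
    rewrite /B subrr dot0r h0 zE (dotDl (z s - z t)) (dotDl (y s - y t)).
    by rewrite dotNl dotZl (dotC (y s - y t) (z t - y t)); ring.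
  have -> : e * `|s - t| = e / 3 / M * `|s - t| * M + (e / 3 / L) * (L * `|s - t|)
      + e / 3 * `|s - t|.
    by field; rewrite !gt_eqF.
  apply: le_trans (ler_normD _ _) _; apply: lerD.
    apply: le_trans (ler_normD _ _) _; rewrite !normrN; apply: lerD.
      apply: le_trans (cauchy_schwarz_abs _ _) _.
      apply: ler_pM; rewrite ?enorm_ge0//; first exact: H2.
      by rewrite /M; lra.
    apply: le_trans (cauchy_schwarz_abs _ _) _.
    by apply: ler_pM; rewrite ?enorm_ge0//; [exact: H3|exact: H1].
  rewrite hsqE ger0_norm ?divr_ge0 ?sqr_ge0//.
  have := H1 s as_ sb s1; have := enorm_ge0 (y s - y t); have := normr_ge0 (s - t).
  set x := `|s - t| in s4 *; set u := enorm _ => x0 y0 yx.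
  have : u ^+ 2 <= (L * x) ^+ 2 by rewrite ler_pXn2r ?nnegrE// (le_trans y0).
  rewrite exprMn; nra.
have := upper_rateD hz (rderiv_rate rB); rewrite dotDl dotNl.
apply: upper_rate_ext => s /=; rewrite /B.
have -> : z s - y s = (z s - y t) + - (y s - y t) by rewrite opprB addrA subrK.
by rewrite [RHS]hsqD [in RHS]dotNr hsqN addrA.
Qed.

End vector_rates.

Lemma hsq_sub_le (R : realType) (q : nat) (M : R) (v w y : 'cV[R]_q) :
  enorm (v - y) <= M -> enorm (w - y) <= M ->
  `|hsq (v - y) - hsq (w - y)| <= M * enorm (v - w).
Proof.
move=> vM wM.
have -> : hsq (v - y) - hsq (w - y) = (dot (v - w) (v - y) + dot (v - w) (w - y)) / 2.
  by rewrite /hsq !dotE (dotC y v) (dotC y w) (dotC w v); field.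
rewrite normrM [`|2^-1|]ger0_norm ?invr_ge0// ler_pdivrMr//.
apply: le_trans (ler_normD _ _) _.
have h1 := le_trans (cauchy_schwarz_abs (v - w) (v - y)) (ler_wpM2l (enorm_ge0 _) vM).
have h2 := le_trans (cauchy_schwarz_abs (v - w) (w - y)) (ler_wpM2l (enorm_ge0 _) wM).
by move: h1 h2; move: `|dot _ _| `|dot _ _| (enorm _) => *; lra.
Qed.

(** * Almost everywhere differentiability of Lipschitz curves *)

Section rademacher.
Variable R : realType.
Notation mu := (@lebesgue_measure R).

Section stieltjes.
Variables (v : R -> R) (H : R).
Hypothesis H0 : 0 <= H.
Hypothesis vnd : {homo v : s t / s <= t}.
Hypothesis vlip : forall s t, s <= t -> v t - v s <= H * (t - s).

Lemma v_right_continuous : right_continuous v.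
Proof.
move=> x; apply: cvg_at_right_filter; apply/cvgrPdist_le => e e0.
have H10 : 0 < H + 1 by rewrite ltr_wpDl.
apply/nbhs_ballP; exists (e / (H + 1)) => /=; first by rewrite divr_gt0.
move=> y; rewrite /ball/= => xy.
have : H * `|x - y| <= e.
  have := normr_ge0 (x - y); move: xy; rewrite ltr_pdivlMr//; nra.
have [h|/ltW h] := leP x y => hxy.
  rewrite distrC ger0_norm ?subr_ge0; last exact: vnd.
  apply: (le_trans (vlip h)).
  by move: hxy; rewrite ler0_norm ?subr_le0// opprB.
rewrite ger0_norm ?subr_ge0; last exact: vnd.
apply: (le_trans (vlip h)).
by move: hxy; rewrite ger0_norm ?subr_ge0.
Qed.

HB.instance Definition _ := isCumulative.Build R _ R v vnd v_right_continuous.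

Let nu := lebesgue_stieltjes_measure (v : cumulative R R).

Lemma wlength_lip (A : set R) : ocitv A ->
  (wlength v A <= H%:E * wlength idfun A)%E.
Proof.
move=> /ocitvP[->|[[x y] /= xy ->]]; first by rewrite !wlength0 mule0.
by rewrite !wlength_itv_bnd ?(ltW xy)//= -EFinM lee_fin; apply: vlip; exact: ltW.
Qed.

(** A cover by intervals of total length [l] has total [v]-length at most
    [H * l], so the Stieltjes measure of [v] is absolutely continuous with
    respect to Lebesgue measure. *)
Lemma stieltjes_null (A : set R) : mu A = 0%E -> nu A = 0%E.
Proof.
move=> A0; apply/eqP; rewrite eq_le measure_ge0 andbT.
apply/lee_addgt0Pr => e e0; rewrite add0e.
have H10 : 0 < H + 1 by rewrite ltr_wpDl.
have : (mu A < (e / (H + 1))%:E)%E by rewrite A0 lte_fin divr_gt0.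
rewrite {1}/mu /lebesgue_stieltjes_measure /measure_extension/= /mu_ext.
move=> /ereal_inf_lt[_ [B [Bm AB] <-] hB].
apply: (@le_trans _ _ (\sum_(k <oo) wlength v (B k))%E).
  by apply: ereal_inf_lbound; exists B.
apply: (@le_trans _ _ (\sum_(k <oo) H%:E * wlength idfun (B k))%E).
  apply: lee_nneseries => k *; first exact: wlength_ge0.
  exact/wlength_lip/Bm.
rewrite nneseriesZl; last by move=> k _; exact: wlength_ge0.
apply: (@le_trans _ _ (H%:E * (e / (H + 1))%:E)%E).
  by apply: lee_wpmul2l; [rewrite lee_fin|exact: ltW].
rewrite -EFinM lee_fin mulrCA ler_piMr ?(ltW e0)// ler_pdivrMr//; lra.
Qed.

Lemma stieltjes_itv (a b : R) : a <= b -> nu `]a, b]%classic = (v b - v a)%:E.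
Proof.
move=> ab; rewrite /nu /lebesgue_stieltjes_measure /measure_extension/=.
by rewrite measurable_mu_extE//=; [rewrite wlength_itv_bnd|exact: is_ocitv].
Qed.

(** On [a, b], [v] is the indefinite integral of the Radon-Nikodym density of its
    Stieltjes measure, hence differentiable almost everywhere by Lebesgue's
    differentiation theorem. *)
Lemma ae_derivable_itv (a b : R) :
  mu.-negligible [set t | a < t /\ t < b /\ ~ derivable v t 1].
Proof.
have [ab|ba] := ltP a b; last first.
  by apply: negligibleS (negligible_set0 _) => t [at_ [tb _]]; lra.
pose D := `]a, b]%classic : set (measurableTypeR R).
have mD : measurable D by exact: measurable_itv.
have nuD : (nu D < +oo)%E by rewrite stieltjes_itv ?ltW// ltry.
pose nuf : {finite_measure set (measurableTypeR R) -> \bar R} := mfrestr mD nuD.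
have dom : nuf `<< mu.
  move=> N hN A mA AN.
  apply: (@subset_measure0 _ _ _ nu _ A) => //; first exact: measurableI.
  by apply: stieltjes_null; exact: hN.
have [f [f0 ff fi fE]] := radon_nikodym_sigma_finite dom.
pose g := fine \o f.
have gf : EFin \o g = f by apply/funext => x; rewrite /g/= fineK.
have gi : mu.-integrable setT (EFin \o g) by rewrite gf.
have gi' (y : R) : mu.-integrable `]-oo, y] (EFin \o g).
  by apply: integrableS gi => //.
have gl : locally_integrable setT g.
  by apply: open_integrable_locally => //; exact: openT.
have := FTC1Ny gi' gl; apply: negligibleS => t [at_ [tb hv]] [hF _]; apply: hv.
move: hF; set F := (fun x => _).
have Fv (x : R) : a < x -> x < b -> F x = v x - v a.
  move=> ax xb; rewrite /F /Rintegral.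
  under eq_integral do rewrite -[X in X%:E]/(g _) -[(g _)%:E]/((EFin \o g) _) gf.
  rewrite -fE//= /mfrestr/= /mrestr.
  have -> : `]-oo, x]%classic `&` D = `]a, x]%classic.
    apply/seteqP; split => y /=; rewrite !in_itv/=.
      by move=> [yx]; rewrite /D/= in_itv/= => /andP[ay _]; rewrite ay.
    by move=> /andP[ay yx]; split => //; rewrite /D/= in_itv/= ay (le_trans yx (ltW xb)).
  exact: (congr1 fine (stieltjes_itv (ltW ax))).
move=> hF.
have : derivable (fun x => F x + v a) t 1 by apply: derivableD.
apply: near_eq_derivable => //.
near=> x; rewrite Fv ?subrK//.
- by near: x; exact: lt_nbhsr.
- by near: x; exact: lt_nbhsl.
Unshelve. all: by end_near. Qed.

End stieltjes.
(** Adding [H * t] to an [H]-Lipschitz function makes it nondecreasing. *)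
Lemma lipschitz_ae_derivable (f : R -> R) (H : R) :
  (forall s t, `|f t - f s| <= H * `|t - s|) ->
  exists2 E : set R, mu.-negligible E & forall t, ~ E t -> derivable f t 1.
Proof.
move=> flip; pose v t := f t + H * t.
have H0 : 0 <= H.
  by have := flip 0 1; rewrite subr0 normr1 mulr1; exact: le_trans.
have vnd : {homo v : s t / s <= t}.
  move=> s t st; have := flip s t; rewrite [`|t - s|]ger0_norm ?subr_ge0// ler_norml => /andP[+ _].
  by rewrite /v; lra.
have vlip s t : s <= t -> v t - v s <= (2 * H) * (t - s).
  move=> st; have := flip s t; rewrite [`|t - s|]ger0_norm ?subr_ge0// ler_norml => /andP[_].
  by rewrite /v; lra.
have H20 : 0 <= 2 * H by rewrite mulr_ge0.
exists (\bigcup_(n : nat) [set t | - n%:R < t /\ t < n%:R /\ ~ derivable v t 1]).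
  by apply: negligible_bigcup => n; exact: (ae_derivable_itv H20 vnd vlip).
move=> t Et.
have dv : derivable v t 1.
  apply: contrapT => h; apply: Et; exists (Num.trunc `|t|).+1 => //=.
  have : `|t| < (Num.trunc `|t|).+1%:R by exact: truncnS_gt.
  by rewrite ltr_norml => /andP[].
have -> : f = (fun s => v s + (- H) * s) by apply/funext => s; rewrite /v mulNr addrK.
apply: derivableD => //.
Qed.

End rademacher.

Section vector_derivative.
Variables (R : realType) (q : nat).
Implicit Types (z : R -> 'cV[R]_q) (d : 'cV[R]_q).

Definition vderivT z (t : R) d := forall e : R, 0 < e -> exists2 r : R, 0 < r &
  forall s, `|s - t| < r -> enorm (z s - z t - (s - t) *: d) <= e * `|s - t|.

Lemma vderivTW a b z t d : vderivT z t d -> vderiv a b z t d.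
Proof. by move=> h e e0; have [r r0 H] := h e e0; exists r => // s _ _; exact: H. Qed.

(** The Euclidean epsilon-delta form of the derivative that occurs in
    [is_solution]. *)
Lemma is_deriveP z (t : R) d :
  is_derive (t : R^o) (1 : R^o) (z : R^o -> 'cV[R]_q) d <-> vderivT z t d.
Proof.
split.
  move=> [dz ze] e e0.
  have : (fun h : R => h^-1 *: ((z : R^o -> 'cV[R]_q) (h *: (1 : R^o) + (t : R^o)) - z t)) @ 0^' --> d.
    by rewrite -ze.
  move=> /enorm_cvgP/(_ e e0) /nbhs_ballP[r /= r0 hr].
  exists r => // s st.
  have [->|sn] := eqVneq s t; first by rewrite !subrr scale0r subr0 normr0 mulr0 enorm0.
  have sn0 : s - t != 0 by rewrite subr_eq0.
  have := hr (s - t); rewrite /ball/= sub0r normrN => /(_ st sn0).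
  rewrite [_ *: (1 : R^o)]mulr1 subrK => /ltW h.
  have -> : z s - z t - (s - t) *: d = (s - t) *: ((s - t)^-1 *: (z s - z t) - d).
    by rewrite scalerBr scalerA divff// scale1r.
  by rewrite enormZ mulrC; apply: ler_wpM2r.
move=> h.
have cv : (fun h : R => h^-1 *: ((z : R^o -> 'cV[R]_q) (h *: (1 : R^o) + (t : R^o)) - z t)) @ 0^' --> d.
  apply/enorm_cvgP => e e0.
  have e20 : 0 < e / 2 by rewrite divr_gt0.
  have [r r0 hr] := h _ e20.
  apply/nbhs_ballP; exists r => //= s; rewrite /ball/= sub0r normrN => sr s0.
  rewrite [_ *: (1 : R^o)]mulr1.
  have := hr (s + t); rewrite addrK => /(_ sr) hs.
  have -> : s^-1 *: (z (s + t) - z t) - d = s^-1 *: (z (s + t) - z t - s *: d).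
    by rewrite [RHS]scalerBr scalerA mulVf// scale1r.
  rewrite enormZ normfV mulrC ltr_pdivrMr ?normr_gt0//.
  apply: (le_lt_trans hs); rewrite ltr_pM2r ?normr_gt0//; lra.
split; first by apply/cvg_ex; exists d.
by apply: cvg_lim => //; exact: norm_hausdorff.
Qed.

(** Differential equations that hold almost everywhere for [0 < t], read as
    holding off a null set; the point [0] is added to that set. *)
Lemma ae_vderiv (G : 'cV[R]_q -> 'cV[R]_q) z :
  {ae (@lebesgue_measure R), forall t, 0 < t ->
    is_derive (t : R^o) 1 (z : R^o -> 'cV[R]_q) (G (z t))} ->
  exists2 E : set R, (@lebesgue_measure R).-negligible E &
    forall a b t, 0 <= t -> ~ E t -> vderiv a b z t (G (z t)).
Proof.
move=> zae.
exists (~` [set t : R | 0 < t ->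
    is_derive (t : R^o) 1 (z : R^o -> 'cV[R]_q) (G (z t))] `|` [set 0]).
  apply: negligibleU; first exact: zae.
  apply/negligibleP; [exact: measurable_set1|exact: lebesgue_measure_set1].
move=> a b t t0 tE; apply: vderivTW; apply/is_deriveP.
have tn0 : 0 < t.
  by rewrite lt_neqAle t0 andbT eq_sym; apply/eqP => e; apply: tE; right.
by apply: contrapT => h; apply: tE; left => /= /(_ tn0).
Qed.

(** The components are scalar Lipschitz functions. *)
Lemma lipschitz_ae_vderiv z (H : R) :
  (forall s t, enorm (z t - z s) <= H * `|t - s|) ->
  exists2 E : set R, (@lebesgue_measure R).-negligible E &
    forall t, ~ E t -> exists d, vderivT z t d.
Proof.
move=> zlip.
have /choice[E hE] : forall i : 'I_q, exists E : set R,
    (@lebesgue_measure R).-negligible E /\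
    forall t, ~ E t -> derivable (fun s => z s i 0) t 1.
  move=> i; have [|E] := @lipschitz_ae_derivable R (fun s => z s i 0) H.
    move=> s t; apply: le_trans (zlip s t).
    by have := coord_le_enorm (z t - z s) i; rewrite !mxE.
  by exists E.
exists (\big[setU/set0]_(i < q) E i).
  elim/big_ind : _ => [|A B nA nB|i _]; [exact: negligible_set0|exact: negligibleU|].
  by have [] := hE i.
move=> t Et.
have dz i : derivable (fun s => z s i 0) t 1.
  have [_] := hE i; apply; apply: contra_not Et => Eit.
  by rewrite (bigD1 i)//=; left.
have /choice[c hc] : forall i, exists c : R, forall e : R, 0 < e -> exists2 r : R, 0 < r &
    forall s, `|s - t| < r -> `|z s i 0 - z t i 0 - (s - t) * c| <= e * `|s - t|.
  move=> i; have /cvg_ex[/= c hc] := dz i; exists c => e e0.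
  have /cvgrPdist_le/(_ e e0) := hc => /nbhs_ballP[r /= r0 hr].
  exists r => // s st.
  have [->|sn] := eqVneq s t; first by rewrite !subrr mul0r subr0 normr0 mulr0.
  have sn0 : s - t != 0 by rewrite subr_eq0.
  have := hr (s - t); rewrite /ball/= sub0r normrN => /(_ st sn0).
  rewrite [_ *: 1]mulr1 subrK distrC => h.
  have -> : z s i 0 - z t i 0 - (s - t) * c = (s - t) * ((s - t)^-1 * (z s i 0 - z t i 0) - c).
    by rewrite mulrBr mulrA divff// mul1r.
  by rewrite normrM mulrC; apply: ler_wpM2r.
exists (\col_i c i) => e e0.
have e1 : 0 < e / q.+1%:R by rewrite divr_gt0.
have /choice[r hr] : forall i, exists r : R, 0 < r /\
    forall s, `|s - t| < r -> `|z s i 0 - z t i 0 - (s - t) * c i| <= e / q.+1%:R * `|s - t|.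
  by move=> i; have [r r0 h] := hc i _ e1; exists r.
exists (\big[Num.min/1]_(i < q) r i).
  elim/big_ind : _ => // [x y x0 y0|i _]; first exact: min_gt0.
  by have [] := hr i.
move=> s st; apply: le_trans (enorm_le_sum _) _.
apply: (@le_trans _ _ (\sum_(i < q) e / q.+1%:R * `|s - t|)).
  apply: ler_sum => i _; rewrite !mxE; have [_] := hr i; apply.
  by apply: lt_le_trans st _; exact: bigmin_le.
rewrite sumr_const card_ord -[leLHS]mulr_natl mulrA; apply: ler_wpM2r => //.
rewrite mulrCA ler_piMr ?(ltW e0)// ler_pdivrMr ?ltr0n// mul1r ler_nat//.
Qed.

End vector_derivative.

(* [proj] is also the name of the coordinate projections of a product. *)
Local Notation proj := Defs.proj.

(* Keeps unification from unfolding norms into sums of coordinates. *)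
Local Opaque enorm dot.

(** * Projection on a convex set and its one-sided derivative *)

Section projection.
Variables (R : realType) (q : nat) (X : set 'cV[R]_q).
Implicit Types (u v w z n d : 'cV[R]_q).

Definition segment_closed := forall u v (t : R), X u -> X v ->
  0 <= t -> t <= 1 -> X (u + t *: (v - u)).

Lemma convex_set_segment : convex_set X -> segment_closed.
Proof.
move=> cX u v t Xu Xv t0 t1.
have := cX v u (Itv01 t0 t1); rewrite !inE => /(_ Xv Xu).
congr X; rewrite /conv/=.
by rewrite scalerBl scale1r scalerBr addrCA addrC.
Qed.

Hypothesis Xc : compact X.
Hypothesis Xseg : segment_closed.
Hypothesis X0 : X !=set0.

(** A continuous function attains its minimum on a nonempty compact set, so the
    choice made by [proj] is not a default value. *)
Lemma proj_min v : X (proj X v) /\ forall w, X w -> enorm (v - proj X v) <= enorm (v - w).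
Proof.
apply: (@getPex _ [set w | X w /\ forall w', X w' -> enorm (v - w) <= enorm (v - w')]).
have cf : {within X, continuous (fun w => enorm (v - w))}.
  apply: continuous_subspaceT => w.
  apply: (@continuous_comp _ _ _ (fun w => v - w) (@enorm R q)).
    by apply: continuousB; [exact: cst_continuous|exact: cvg_id].
  exact: enorm_continuous.
have [w] := compact_EVT_min X0 Xc cf.
rewrite inE => Xw h; exists w; split => // w' Xw'.
by apply: h; rewrite inE.
Qed.

Lemma proj_in v : X (proj X v). Proof. by have [] := proj_min v. Qed.

Lemma proj_le v w : X w -> enorm (v - proj X v) <= enorm (v - w).
Proof. by have [_] := proj_min v; exact. Qed.

(** Moving from [proj X v] towards [w] by the fraction [t] changes the squared
    distance to [v] by [- 2 t dot (v - proj X v) (w - proj X v)] up to a term in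
    [t ^+ 2]; a positive inner product would contradict minimality. *)
Lemma proj_obtuse v w : X w -> dot (v - proj X v) (w - proj X v) <= 0.
Proof.
move=> Xw; set P := proj X v; rewrite leNgt; apply/negP => h.
set a := v - P in h *; set b := w - P in h *.
have b0 : 0 < dot b b.
  rewrite lt_neqAle dot_ge0 andbT eq_sym; apply/eqP => b0.
  have := cauchy_schwarz a b; rewrite (enorm_sqrt b) b0 sqrtr0 mulr0; lra.
pose t := Num.min 1 (dot a b / dot b b).
have t0 : 0 < t by rewrite min_gt0// divr_gt0.
have t1 : t <= 1 by rewrite ge_min lexx.
have tb : t * dot b b <= dot a b by rewrite -ler_pdivlMr// ge_min lexx orbT.
have := proj_le v (Xseg (proj_in v) Xw (ltW t0) t1).
rewrite -(ler_pXn2r (n:=2))// ?nnegrE ?enorm_ge0// !enormE -/P -/b.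
have -> : v - (P + t *: b) = a - t *: b by rewrite opprD addrA.
rewrite -/a; clearbody t a b; rewrite !dotE (dotC b a); nra.
Qed.

Lemma proj_unique v w : X w -> (forall w', X w' -> dot (v - w) (w' - w) <= 0) ->
  proj X v = w.
Proof.
move=> Xw h; have h1 := h _ (proj_in v); have h2 := proj_obtuse v Xw.
apply/eqP; rewrite -subr_eq0; apply/eqP/enorm_eq0/eqP.
rewrite -sqrf_eq0 enormE eq_le dot_ge0 andbT.
move: h1 h2; set P := proj X v; clearbody P.
rewrite !dotE (dotC P w); lra.
Qed.

Lemma proj_id v : X v -> proj X v = v.
Proof.
by move=> Xv; apply: proj_unique => // w _; rewrite subrr dot0l.
Qed.

Lemma proj_step z v : X z -> enorm (proj X (z + v) - z) <= enorm v.
Proof.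
move=> Xz; have := proj_obtuse (z + v) Xz.
set p := proj X (z + v).
have -> : z + v - p = v - (p - z) by rewrite opprB addrA (addrC v).
rewrite -(opprB p z) dotNr oppr_le0 dotDl dotNl subr_ge0 -enormE => h.
have := le_trans h (cauchy_schwarz _ _).
have [->|e0] := eqVneq (enorm (p - z)) 0; first by rewrite enorm_ge0.
by rewrite expr2 ler_pM2r// lt_neqAle eq_sym e0 enorm_ge0.
Qed.

Let pq z v (d : R) : 'cV[R]_q := d^-1 *: (proj X (z + d *: v) - z).

Lemma proj_quotientE z v (d : R) : 0 < d -> proj X (z + d *: v) = z + d *: pq z v d.
Proof.
by move=> d0; rewrite scalerA divff ?gt_eqF// scale1r [RHS]addrC subrK.
Qed.

(** The obtuse angle condition for the difference quotient [pq], which does not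
    degenerate as [d] tends to [0]. *)
Lemma quotient_obtuse z v (d : R) w : 0 < d -> X w ->
  dot (v - pq z v d) (w - z - d *: pq z v d) <= 0.
Proof.
move=> d0 Xw; have := proj_obtuse (z + d *: v) Xw.
rewrite proj_quotientE//.
have -> : z + d *: v - (z + d *: pq z v d) = d *: (v - pq z v d).
  by rewrite opprD addrACA subrr add0r -scalerBr.
by rewrite dotZl pmulr_rle0// opprD addrA.
Qed.

(** The quotient at [d] is an admissible competitor at every smaller [d'], since
    [X] is convex; the obtuse angle then gives a Pythagorean inequality. *)
Lemma quotient_pythagoras z v (d d' : R) : X z -> 0 < d' -> d' <= d ->
  enorm (v - pq z v d') ^+ 2 + enorm (pq z v d - pq z v d') ^+ 2
    <= enorm (v - pq z v d) ^+ 2.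
Proof.
move=> Xz d'0 dd.
have d0 : 0 < d by exact: lt_le_trans dd.
have Xw : X (z + d' *: pq z v d).
  have -> : z + d' *: pq z v d = z + (d' / d) *: (proj X (z + d *: v) - z).
    by rewrite /pq scalerA.
  apply: Xseg => //; first exact: proj_in.
    by rewrite divr_ge0// ltW.
  by rewrite ler_pdivrMr// mul1r.
have := @quotient_obtuse z v _ _ d'0 Xw.
have -> : z + d' *: pq z v d - z - d' *: pq z v d' = d' *: (pq z v d - pq z v d').
  by rewrite (addrAC z) subrr add0r -scalerBr.
rewrite dotZr pmulr_rle0//.
move: (pq z v d) (pq z v d') => a b h; rewrite 3!enormE.
move: h.
have -> : v - a = (v - b) - (a - b) by rewrite opprB addrA subrK.
set x := v - b; set y := a - b; clearbody x y.
rewrite !dotE (dotC y x); lra.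
Qed.

(** By [quotient_pythagoras] the numbers [enorm (v - pq z v d) ^+ 2] decrease
    as [d] does, and their increments bound the squared distances of the
    quotients: the quotients are Cauchy. *)
Lemma quotient_cvg z v : X z -> cvg (pq z v d @[d --> 0^'+]).
Proof.
move=> Xz; apply: cauchy_cvg; apply: cauchy_exP => e e0.
pose S := [set enorm (v - pq z v d) ^+ 2 | d in [set d : R | 0 < d]].
have hS : has_inf S.
  split; first by exists (enorm (v - pq z v 1) ^+ 2); exists 1 => //=.
  by exists 0 => _ [d _ <-]; exact: sqr_ge0.
have e20 : 0 < e ^+ 2 by rewrite exprn_gt0.
have [_ [d /= d0 <-] hd] := inf_adherent e20 hS.
exists (pq z v d); near=> d'.
rewrite -ball_normE/=; apply: le_lt_trans (norm_le_enorm _) _.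
have d'0 : 0 < d' by near: d'; exact: nbhs_right_gt.
have d'd : d' <= d by near: d'; exact: nbhs_right_le.
rewrite -(ltr_pXn2r (n:=2))// ?nnegrE ?enorm_ge0 ?(ltW e0)//.
have := quotient_pythagoras v Xz d'0 d'd.
move=> hp; rewrite -(ltrD2l (enorm (v - pq z v d') ^+ 2)).
apply: (le_lt_trans hp); apply: (lt_le_trans hd); rewrite lerD2r.
by apply: (ge_inf hS.2); exists d'.
Unshelve. all: by end_near. Qed.

Lemma Pi_cvg z v : X z -> pq z v d @[d --> 0^'+] --> Pi X z v.
Proof.
by move=> Xz; rewrite /Pi; case: asboolP => // _; exact: quotient_cvg.
Qed.

Lemma Pi_approx z v (e : R) : X z -> 0 < e ->
  exists d : R, [/\ 0 < d, d <= e & enorm (pq z v d - Pi X z v) < e].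
Proof.
move=> Xz e0.
have h := (enorm_cvgP _ _ _).1 (@Pi_cvg z v Xz) e e0.
have : \forall d \near ((0 : R)^'+), [/\ 0 < d, d <= e & enorm (pq z v d - Pi X z v) < e].
  near=> d; split; [near: d; exact: nbhs_right_gt|near: d; exact: nbhs_right_le|].
  near: d; exact: h.
by move=> /filter_ex[d hd]; exists d.
Unshelve. all: by end_near. Qed.

(** Together with the next two facts this is the decomposition of [v] by
    Moreau: [Pi X z v] is the projection of [v] on the tangent cone of [X] at
    [z]. Here the residual is seen to be normal to [X], by letting [d] tend to
    [0] in [quotient_obtuse]. *)
Lemma Pi_residual_normal z v w : X z -> X w -> dot (v - Pi X z v) (w - z) <= 0.
Proof.
move=> Xz Xw; apply/ler_addgt0Pr => e e0; rewrite add0r.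
set p := Pi X z v; set A := enorm (w - z); set B := enorm (v - p).
have A0 : 0 <= A by exact: enorm_ge0.
have B0 : 0 <= B by exact: enorm_ge0.
set C := enorm p.
have C0 : 0 <= C by exact: enorm_ge0.
pose D := A + (B + 1) * (C + 1) + 1.
have D0 : 0 < D by rewrite /D; nra.
have r0 : 0 < Num.min 1 (e / D) by rewrite min_gt0// divr_gt0.
have [d [d0 dr hd]] := @Pi_approx z v _ Xz r0.
have d1 : d <= 1 by apply: le_trans dr _; rewrite ge_min lexx.
have := @quotient_obtuse z v _ _ d0 Xw.
set pd := pq z v d in hd *; rewrite -/p in hd.
rewrite dotDr dotNr dotZr => h.
have -> : v - p = (v - pd) + (pd - p) by rewrite addrA subrK.
rewrite dotDl.
have h1 : dot (pd - p) (w - z) <= Num.min 1 (e / D) * A.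
  by apply: le_trans (cauchy_schwarz _ _) _; apply: ler_wpM2r => //; exact: ltW.
have pd1 : enorm (pd - p) <= 1 by apply: le_trans (ltW hd) _; rewrite ge_min lexx.
have h2 : dot (v - pd) pd <= (B + 1) * (C + 1).
  apply: le_trans (cauchy_schwarz _ _) _; apply: ler_pM; rewrite ?enorm_ge0//.
    by apply: le_trans (enorm_triangle p _ _) _; rewrite lerD2l enormB.
  by rewrite -(subrK p pd); apply: le_trans (enormD _ _) _; rewrite addrC lerD2l.
have h3 : d * dot (v - pd) pd <= Num.min 1 (e / D) * ((B + 1) * (C + 1)).
  apply: (@le_trans _ _ (d * ((B + 1) * (C + 1)))); first by apply: ler_wpM2l => //; exact: ltW.
  by apply: ler_wpM2r => //; nra.
have : Num.min 1 (e / D) * D <= e by rewrite -ler_pdivlMr// ge_min lexx orbT.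
by rewrite /D; move: r0 h1 h3; set r := Num.min _ _; lra.
Qed.

(** Each quotient is a multiple of [w - z] for some [w] in [X], so the limit
    lies in the closed tangent cone, here described by its polar. *)
Lemma Pi_tangent z v n : X z -> (forall w, X w -> dot n (w - z) <= 0) ->
  dot n (Pi X z v) <= 0.
Proof.
move=> Xz hn; apply/ler_addgt0Pr => e e0; rewrite add0r.
have N0 : 0 < enorm n + 1 by have := enorm_ge0 n; lra.
have [d [d0 _ hd]] := @Pi_approx z v _ Xz (divr_gt0 e0 N0).
have : dot n (pq z v d) <= 0.
  by rewrite dotZr pmulr_rle0 ?invr_gt0//; exact/hn/proj_in.
have -> : Pi X z v = pq z v d - (pq z v d - Pi X z v) by rewrite subKr.
rewrite dotDr dotNr.
have := cauchy_schwarz (- n) (pq z v d - Pi X z v); rewrite dotNl enormN.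
move: hd; rewrite ltr_pdivlMr//.
have := enorm_ge0 (pq z v d - Pi X z v); have := enorm_ge0 n; nra.
Qed.

(** The test point [w = z] in [quotient_obtuse]; with [Pi_tangent] applied to
    the normal residual, the inner product vanishes. *)
Lemma Pi_residual_ge0 z v : X z -> 0 <= dot (v - Pi X z v) (Pi X z v).
Proof.
move=> Xz; set p := Pi X z v; rewrite -oppr_le0; apply/ler_addgt0Pr => e e0; rewrite add0r.
set A := enorm p; set B := enorm (v - p).
have A0 : 0 <= A by exact: enorm_ge0.
have B0 : 0 <= B by exact: enorm_ge0.
pose D := A + B + 1.
have D0 : 0 < D by rewrite /D; lra.
have r0 : 0 < Num.min 1 (e / D) by rewrite min_gt0// divr_gt0.
have [d [d0 dr hd]] := @Pi_approx z v _ Xz r0.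
have := @quotient_obtuse z v _ _ d0 Xz.
set pd := pq z v d in hd *; rewrite -/p in hd.
rewrite subrr sub0r dotNr dotZr oppr_le0 pmulr_rge0// => h.
have rD : Num.min 1 (e / D) * D <= e by rewrite -ler_pdivlMr// ge_min lexx orbT.
have r1 : Num.min 1 (e / D) <= 1 by rewrite ge_min lexx.
move: hd r0 rD r1; set r := Num.min _ _ => hd r0 rD r1.
have k1 := cauchy_schwarz_abs (v - p) (pd - p).
have k2 := cauchy_schwarz_abs (pd - p) p.
have k3 := dot_ge0 (pd - p).
have x0 := enorm_ge0 (pd - p).
have : dot (v - pd) pd = dot (v - p) p + dot (v - p) (pd - p) - dot (pd - p) p
   - dot (pd - p) (pd - p).
  have -> : v - pd = (v - p) - (pd - p) by rewrite opprB addrA subrK.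
  have {2}-> : pd = p + (pd - p) by rewrite addrC subrK.
  by rewrite dotDl !dotDr !dotNl; ring.
move: k1 k2; rewrite -/A -/B !ler_norml => /andP[_ k1] /andP[k2 _] k4.
have : B * enorm (pd - p) + enorm (pd - p) * A <= r * D by rewrite /D; nra.
lra.
Qed.

(** The Moreau decomposition of [v] along the tangent and the normal cone is
    unique. *)
Lemma Pi_eq z v d : X z -> (forall w, X w -> dot (v - d) (w - z) <= 0) ->
  dot (v - d) d = 0 -> (forall n, (forall w, X w -> dot n (w - z) <= 0) -> dot n d <= 0) ->
  Pi X z v = d.
Proof.
move=> Xz h1 h2 h3.
have k1 := Pi_tangent v Xz h1.
have k2 := h3 _ (fun w => @Pi_residual_normal z v w Xz).
have k3 := Pi_residual_ge0 v Xz.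
apply/eqP; rewrite -subr_eq0; apply/eqP/enorm_eq0/eqP.
rewrite -sqrf_eq0 enormE eq_le dot_ge0 andbT.
move: h2 k1 k2 k3; set P := Pi X z v; clearbody P.
rewrite !dotE (dotC P d); lra.
Qed.

(** The squared distance to [X] is differentiable, with gradient
    [u - proj X u]. *)
Lemma dist_hsq_lower u v : hsq (u - proj X u) + dot (u - proj X u) (v - u)
  <= hsq (v - proj X v).
Proof.
have h := proj_obtuse u (proj_in v).
set a := u - proj X u in h *; set b := v - proj X v.
have -> : b = a + (b - a) by rewrite addrC subrK.
have h0 : 0 <= hsq (b - a) by rewrite hsqE divr_ge0// sqr_ge0.
have -> : v - u = (b - a) + (proj X v - proj X u).
  by apply/matrixP => i j; rewrite !mxE; ring.
clearbody a b; rewrite (hsqD a) (dotDr a (b - a)); lra.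
Qed.

Lemma dist_hsq_upper u v : hsq (v - proj X v) <= hsq (v - proj X u).
Proof.
exact/hsq_le/proj_le/proj_in.
Qed.

Lemma dist_lip u v : `|enorm (v - proj X v) - enorm (u - proj X u)| <= enorm (v - u).
Proof.
have h x y : enorm (x - proj X x) <= enorm (x - y) + enorm (y - proj X y).
  apply: le_trans (proj_le x (proj_in y)) _; exact: enorm_triangle.
have := h u v; have := h v u; rewrite (enormB u v) ler_norml.
move: (enorm (v - u)) (enorm (u - proj X u)) (enorm (v - proj X v)) => x y w *.
by apply/andP; split; lra.
Qed.

End projection.

(** * Euler polygons and evolution variational inequalities *)

Section compact_bound.
Variables (R : realType) (q : nat) (X : set 'cV[R]_q).

Lemma compact_enorm_bounded : compact X -> exists2 M : R, 0 <= M & forall v, X v -> enorm v <= M.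
Proof.
move=> Xc; have [X0|/set0P X0] := eqVneq X set0.
  by exists 0 => // v; rewrite X0.
have [|c _ hc] := compact_EVT_max X0 Xc (f := @enorm R q).
  by apply: continuous_subspaceT; exact: enorm_continuous.
exists (enorm c); first exact: enorm_ge0.
by move=> v Xv; apply: hc; rewrite inE.
Qed.

End compact_bound.

(** Ultrafilters replace the extraction of subsequences: in a compact set every
    sequence converges along an ultrafilter, for all times at once. *)
Lemma ultra_fmap (S T : Type) (U : set_system S) (h : S -> T) :
  UltraFilter U -> UltraFilter (h @ U).
Proof.
move=> UU; split; first exact: fmap_proper_filter.
move=> G GG hG; apply/seteqP; split => // A GA.
have [//|hA] := in_ultra_setVsetC (h @^-1` A) UU.
have : G (A `&` ~` A) by apply: filterI => //; apply: hG.
by rewrite setICr => /filter_not_empty.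
Qed.

(** Curves in the convex set [X] that follow [f] as far as [X] permits are
    obtained from the polygons that take an Euler step of length
    [d] and project it on [X]. *)
Section euler.
Variables (R : realType) (q : nat) (X : set 'cV[R]_q) (f : 'cV[R]_q -> 'cV[R]_q).
Variables (z0 : 'cV[R]_q) (L H D : R).
Hypothesis Xc : compact X.
Hypothesis Xseg : segment_closed X.
Hypothesis Xz0 : X z0.
Hypothesis L0 : 0 <= L.
Hypothesis flip : forall u v, X u -> X v -> enorm (f u - f v) <= L * enorm (u - v).
Hypothesis H0 : 0 <= H.
Hypothesis fbnd : forall u, X u -> enorm (f u) <= H.
Hypothesis D0 : 0 <= D.
Hypothesis Xdiam : forall u v, X u -> X v -> enorm (u - v) <= D.

Let X0 : X !=set0. Proof. by exists z0. Qed.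
Let B := L * D + H.
Let B0 : 0 <= B. Proof. by rewrite addr_ge0// mulr_ge0. Qed.

Let test_lip w u v : X w -> X u -> X v ->
  `|dot (f u) (u - w) - dot (f v) (v - w)| <= B * enorm (u - v).
Proof.
move=> Xw Xu Xv.
have -> : dot (f u) (u - w) - dot (f v) (v - w)
    = dot (f u - f v) (u - w) + dot (f v) (u - v).
  by rewrite !dotE; ring.
apply: le_trans (ler_normD _ _) _; rewrite /B mulrDl mulrAC; apply: lerD.
  apply: le_trans (cauchy_schwarz_abs _ _) _.
  by apply: ler_pM; rewrite ?enorm_ge0//; [exact: flip|exact: Xdiam].
apply: le_trans (cauchy_schwarz_abs _ _) _.
by apply: ler_wpM2r; rewrite ?enorm_ge0//; exact: fbnd.
Qed.

Fixpoint euler (d : R) (j : nat) : 'cV[R]_q :=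
  if j is j'.+1 then proj X (euler d j' + d *: f (euler d j')) else z0.

Let euler_in d j : X (euler d j).
Proof. by case: j => [|j] //=; exact: proj_in. Qed.

Let euler_step (d : R) j : 0 <= d -> enorm (euler d j.+1 - euler d j) <= H * d.
Proof.
move=> d0 /=; apply: le_trans (proj_step Xc Xseg X0 _ (euler_in d j)) _.
by rewrite enormZ ger0_norm// mulrC; apply: ler_wpM2r => //; exact/fbnd/euler_in.
Qed.

Let euler_lip (d : R) i m : 0 <= d -> enorm (euler d (i + m) - euler d i) <= H * (m%:R * d).
Proof.
move=> d0; elim: m => [|m IH]; first by rewrite addn0 subrr enorm0 mul0r mulr0.
apply: le_trans (enorm_triangle (euler d (i + m)) _ _) _.
rewrite addnS -natr1 mulrDl mul1r mulrDr addrC; apply: lerD => //.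
exact: euler_step.
Qed.

(** By the obtuse angle at the projected point, a step that is projected back
    loses at least as much distance to a test point [w] of [X] as the free step
    does, up to a term of second order. *)
Let euler_test_step (d : R) j w : 0 <= d -> X w ->
  hsq (euler d j.+1 - w) <= hsq (euler d j - w)
    + d * dot (f (euler d j)) (euler d j - w) + d ^+ 2 * H ^+ 2.
Proof.
move=> d0 Xw; have := proj_obtuse Xc Xseg X0 (euler d j + d *: f (euler d j)) Xw.
have Xz := euler_in d j; have := euler_step j d0 => /=.
have := fbnd Xz.
move: (euler d j) Xz => z Xz; move: (proj X _) => p; move: (f z) => g gH pz.
have -> : z + d *: g - p = d *: g - (p - z).
  by apply/matrixP => i k; rewrite !mxE; ring.
have -> : z - w = (p - w) - (p - z) by apply/matrixP => i k; rewrite !mxE; ring.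
rewrite -(opprB p w) dotNr oppr_le0 (hsqD (p - w)) hsqN.
have k0 := hsq_ge0 (p - z).
have k1 := cauchy_schwarz g (p - z).
have : enorm g * enorm (p - z) <= H * (H * d) by apply: ler_pM; rewrite ?enorm_ge0.
move=> k2; have := ler_wpM2l d0 (le_trans k1 k2).
move: (p - w) (p - z) k0 => x y k0.
rewrite !(dotDl, dotDr, dotNl, dotNr, dotZl) (dotC y x).
move: (hsq x) (hsq y) (dot g x) (dot x y) (dot g y) k0 => *; lra.
Qed.

Let euler_test (d : R) i m w : 0 <= d -> X w ->
  hsq (euler d (i + m) - w) <= hsq (euler d i - w)
    + (m%:R * d) * dot (f (euler d i)) (euler d i - w)
    + B * H * (m%:R * d) ^+ 2 + m%:R * d * d * H ^+ 2.
Proof.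
move=> d0 Xw; elim: m => [|m IH].
  by rewrite addn0 mul0r !mul0r expr0n/= mulr0 !addr0.
rewrite addnS; apply: le_trans (euler_test_step _ d0 Xw) _.
have := test_lip Xw (euler_in d (i + m)) (euler_in d i).
rewrite ler_norml => /andP[_ h1].
have h2 := ler_wpM2l B0 (euler_lip i m d0).
have h3 : d * (dot (f (euler d (i + m))) (euler d (i + m) - w)
   - dot (f (euler d i)) (euler d i - w)) <= d * (B * (H * (m%:R * d))).
  by apply: ler_wpM2l => //; exact: le_trans h1 h2.
have BH : 0 <= B * H * (m%:R * d + d) * d.
  by rewrite !mulr_ge0// addr_ge0// mulr_ge0.
rewrite -natr1 mulrDl mul1r.
move: IH h3; move: (hsq _) (hsq _) (dot _ _) (dot _ _) => a b c e IH h3.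
by move: (m%:R * d) IH h3 BH => md *; nra.
Qed.

Let zN (N : nat) (t : R) := euler N.+1%:R^-1 (Num.trunc (t * N.+1%:R)).

Let zN_lim : exists z : R -> 'cV[R]_q, (forall t, X (z t)) /\
  forall s t (e : R), 0 < e -> exists N : nat,
    [/\ N.+1%:R^-1 < e, enorm (zN N s - z s) < e & enorm (zN N t - z t) < e].
Proof.
have [U [UU Uoo]] := @ultraFilterLemma nat \oo _.
have /choice[z hz] : forall t, exists p, X p /\ zN^~ t @ U --> p.
  move=> t.
  have Xu := Xc; rewrite compact_ultra in Xu.
  have [|p [Xp hp]] := Xu (zN^~ t @ U) (ultra_fmap _ _).
    by apply: (@filterS _ U _ setT) => //; [move=> N _ /=; exact: euler_in|exact: filterT].
  by exists p.
exists z; split => [t|s t e e0]; first by have [] := hz t.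
have near_t r : \forall N \near U, enorm (zN N r - z r) < e.
  have [_ h] := hz r.
  exact: ((enorm_cvgP _ _ _).1 h e e0).
have near_N : \forall N \near U, N.+1%:R^-1 < e.
  exact: Uoo _ (near_infty_natSinv_lt (PosNum e0)).
have : \forall N \near U, [/\ N.+1%:R^-1 < e, enorm (zN N s - z s) < e & enorm (zN N t - z t) < e].
  by apply: filterS3 near_N (near_t s) (near_t t) => N.
by move=> /filter_ex[N hN]; exists N.
Qed.

(** The grid times used at [s] and [t] are each off by less than one mesh. *)
Let zN_gap (N : nat) (s t : R) : 0 <= s -> s <= t -> exists2 m : nat,
  Num.trunc (t * N.+1%:R) = (Num.trunc (s * N.+1%:R) + m)%N &
  t - s - N.+1%:R^-1 <= m%:R * N.+1%:R^-1 /\ m%:R * N.+1%:R^-1 <= t - s + N.+1%:R^-1.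
Proof.
move=> s0 st; set n : R := N.+1%:R.
have n0 : 0 < n by rewrite ltr0n.
have sn : s * n <= t * n by apply: ler_wpM2r => //; exact: ltW.
have sn0 : 0 <= s * n by rewrite mulr_ge0// ltW.
have /andP[s1 s2] := truncn_itv sn0.
have /andP[t1 t2] := truncn_itv (le_trans sn0 sn).
set i := Num.trunc (s * n) in s1 s2 *; set j := Num.trunc (t * n) in t1 t2 *.
have ij : (i <= j)%N.
  rewrite -ltnS -(ltr_nat R); exact: le_lt_trans s1 (le_lt_trans sn t2).
exists (j - i)%N; first by rewrite subnKC.
rewrite -natr1 in s2; rewrite -natr1 in t2.
have nV : n^-1 * n = 1 by rewrite mulVf// gt_eqF.
rewrite natrB//; split; rewrite -(ler_pM2r n0) -mulrA nV mulr1.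
  by rewrite !mulrBl nV; lra.
by rewrite mulrDl mulrBl nV; lra.
Qed.

(** Both the Lipschitz bound and the summed inequality [euler_test] pass to
    pointwise limits of the polygons. The curve is prolonged by its initial
    value to negative times. *)
Lemma evi_exists : exists z : R -> 'cV[R]_q,
  [/\ forall t, t <= 0 -> z t = z0, forall t, X (z t),
      forall s t, enorm (z t - z s) <= H * `|t - s|
    & forall b t w, 0 <= t -> X w ->
        upper_rate 0 b (fun s => hsq (z s - w)) t (dot (f (z t)) (z t - w))].
Proof.
have [z [zX zlim]] := zN_lim.
(* Limit of [euler_lip]. *)
have zlip s t : 0 <= s -> s <= t -> enorm (z t - z s) <= H * (t - s).
  move=> s0 st; apply/ler_addgt0Pr => e e0.
  have H20 : 0 < H + 2 by rewrite ltr_wpDl.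
  have [N [N1 N2 N3]] := zlim s t _ (divr_gt0 e0 H20).
  set n := N.+1%:R^-1 in N1.
  have n0 : 0 <= n by rewrite invr_ge0.
  have [m jm [m1 m2]] := zN_gap N s0 st.
  have := euler_lip (Num.trunc (s * N.+1%:R)) m n0; rewrite -jm -/(zN N t) -/(zN N s) => h.
  have := enorm_triangle (zN N t) (z t) (z s).
  have := enorm_triangle (zN N s) (zN N t) (z s).
  rewrite (enormB (z t) (zN N t)).
  have : H * (m%:R * n) <= H * (t - s + n) by apply: ler_wpM2l.
  have rE : e / (H + 2) * (H + 2) = e by rewrite mulfVK// gt_eqF.
  have := ler_wpM2l H0 (ltW N1).
  move: N2 N3 h rE.
  move: (enorm _) (enorm _) (enorm _) (enorm _) (enorm _) => a a' c d r.
  move: (e / (H + 2)) => k *; lra.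
(* Limit of [euler_test]; the constant [C] collects the errors made when the
polygon is replaced by its limit and the number of steps by [t - s]. *)
have ztest s t w : 0 <= s -> s <= t -> X w ->
  hsq (z t - w) <= hsq (z s - w) + (t - s) * dot (f (z s)) (z s - w)
     + B * H * (t - s) ^+ 2.
  move=> s0 st Xw; apply/ler_addgt0Pr => e e0.
  set T := t - s; have T0 : 0 <= T by rewrite subr_ge0.
  pose C := D + D + H * D + T * B + B * H * (2 * T + 1) + (T + 1) * H ^+ 2 + 1.
  have HD : 0 <= H * D by exact: mulr_ge0.
  have TB : 0 <= T * B by exact: mulr_ge0.
  have BH : 0 <= B * H by exact: mulr_ge0.
  have HH : 0 <= H ^+ 2 by exact: sqr_ge0.
  have BHT : 0 <= B * H * (2 * T + 1) by apply: mulr_ge0 => //; lra.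
  have THH : 0 <= (T + 1) * H ^+ 2 by apply: mulr_ge0 => //; lra.
  have C0 : 0 < C by rewrite /C; have := D0; lra.
  set r := Num.min 1 (e / C).
  have r0 : 0 < r by rewrite /r min_gt0// divr_gt0.
  have r1 : r <= 1 by rewrite /r ge_min lexx.
  have rC : r * C <= e by rewrite -ler_pdivlMr// /r ge_min lexx orbT.
  have [N [N1 N2 N3]] := zlim s t _ r0.
  set n := N.+1%:R^-1 in N1.
  have n0 : 0 <= n by rewrite invr_ge0.
  have [m jm [m1 m2]] := zN_gap N s0 st.
  have := euler_test (Num.trunc (s * N.+1%:R)) m n0 Xw.
  rewrite -jm -/(zN N t) -/(zN N s) -/n in m1 m2 * => h.
  have Xs : X (zN N s) by exact: euler_in.
  have Xt : X (zN N t) by exact: euler_in.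
  have := hsq_sub_le (Xdiam Xt Xw) (Xdiam (zX t) Xw); rewrite ler_norml => /andP[h1 _].
  have := hsq_sub_le (Xdiam Xs Xw) (Xdiam (zX s) Xw); rewrite ler_norml => /andP[_ h2].
  have := test_lip Xw Xs (zX s); rewrite ler_norml => /andP[_ h3].
  have := le_trans (cauchy_schwarz_abs (f (zN N s)) (zN N s - w))
    (ler_pM (enorm_ge0 _) (enorm_ge0 _) (fbnd Xs) (Xdiam Xs Xw)).
  rewrite ler_norml => /andP[h4 h5].
  have k1 := ler_wpM2l D0 (ltW N3); have k2 := ler_wpM2l D0 (ltW N2).
  have k3 := ler_wpM2l T0 (le_trans h3 (ler_wpM2l B0 (ltW N2))).
  have md_0 : 0 <= m%:R * n by rewrite mulr_ge0.
  move: h h1 h2 h4 h5 k1 k2 k3 m1 m2 md_0.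
  move: (hsq (zN N t - w)) (hsq (zN N s - w)) (hsq (z t - w)) (hsq (z s - w)).
  move: (dot (f (zN N s)) _) (dot (f (z s)) _) (enorm _) (enorm _) (m%:R * n).
  move=> p p' x y md a a' c c' h h1 h2 h4 h5 k1 k2 k3 m1 m2 md_0.
  have md0 : md * p <= T * p + r * (H * D).
    have : (md - T) * p <= r * (H * D).
      apply: le_trans (ler_norm _) _; rewrite normrM; apply: ler_pM => //.
        by rewrite ler_norml -/T in m1 m2 *; apply/andP; split; lra.
      by rewrite ler_norml h4.
    lra.
  have md1 : md <= T + r by move: m2; rewrite -/T; lra.
  have mdr : - r <= md - T by move: m1; rewrite -/T; lra.
  have k4 : md ^+ 2 <= T ^+ 2 + r * (2 * T + 1).
    have : md ^+ 2 <= (T + r) ^+ 2 by rewrite ler_pXn2r ?nnegrE//; lra.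
    have : r ^+ 2 <= r by rewrite expr2 ler_piMr// ltW.
    lra.
  have k5 : B * H * md ^+ 2 <= B * H * (T ^+ 2 + r * (2 * T + 1)) by exact: ler_wpM2l.
  have k6 : md * n * H ^+ 2 <= r * ((T + 1) * H ^+ 2).
    rewrite [leRHS]mulrA; apply: ler_wpM2r => //.
    have : md * n <= (T + 1) * n by apply: ler_wpM2r => //; lra.
    have : (T + 1) * n <= (T + 1) * r by apply: ler_wpM2l; [lra|exact: ltW].
    lra.
  move: rC; rewrite /C; lra.
have z_0 : z 0 = z0.
  apply/eqP; rewrite -subr_eq0; apply/eqP/enorm_eq0/eqP.
  rewrite eq_le enorm_ge0 andbT; apply/ler_addgt0Pr => e e0; rewrite add0r.
  have [N [_ N2 _]] := zlim 0 0 e e0.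
  by move: N2; rewrite /zN mul0r truncn0/= enormB => /ltW.
have max0 (t : R) : 0 <= t -> Num.max 0 t = t by move=> t0; apply/max_idPr.
exists (fun t => z (Num.max 0 t)); split => [t t0|t|s t|b t w t0 Xw].
- by rewrite (_ : Num.max 0 t = 0)//; apply/max_idPl.
- exact: zX.
- have m0 (x : R) : 0 <= Num.max 0 x by rewrite le_max lexx.
  wlog st : s t / s <= t.
    move=> w; have [/w//|/ltW/w] := leP s t.
    by rewrite enormB distrC.
  have mst : Num.max 0 s <= Num.max 0 t.
    by rewrite ge_max !le_max lexx st orbT.
  apply: le_trans (zlip _ _ (m0 s) mst) _; apply: ler_wpM2l => //.
  rewrite ger0_norm ?subr_ge0//.
  have [s0|s0] := leP 0 s; have [t0|t0] := leP 0 t; rewrite ?(max_idPr _)//; lra.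
- rewrite (max0 _ t0) => e e0.
  have BH : 0 <= B * H by exact: mulr_ge0.
  pose C := 3 * (B * H) + 1.
  have C0 : 0 < C by rewrite /C; lra.
  exists (e / C); first by rewrite divr_gt0.
  move=> s s' s0 st ts sb h1 h2.
  rewrite !max0//; last exact: le_trans t0 ts.
  have := ztest s s' w s0 (le_trans st ts) Xw.
  have := test_lip Xw (zX s) (zX t); rewrite ler_norml => /andP[_ h3].
  have h4 := zlip s t s0 st; rewrite enormB in h4.
  have h5 := le_trans h3 (ler_wpM2l B0 h4).
  move: h1 h2; rewrite !ltr_pdivlMr// => h1 h2.
  have ss : 0 <= s' - s by lra.
  have := ler_wpM2r ss h5.
  move: (hsq _) (hsq _) (dot _ _) (dot _ _) => a a' p p'.
  have h6 : 0 <= (s' - s) * (e - B * H * (t - s) - B * H * (s' - s)).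
    by apply: mulr_ge0 => //; move: h1 h2; rewrite /C; lra.
  lra.
Qed.

End euler.

(** * The decay estimate for small gains *)

Section arithmetic.
Variable R : realType.
Implicit Types X q E k tau L M dd Z W mu : R.

(** Here [X] and [q] are the deviations of the plant and of the integrator state
    from the constant-input comparison solution, [E] the size of the initial
    error and [dd] the output error: Young's inequality absorbs every mixed
    term, leaving a forcing of order [(k E) ^+ 2]. *)
Lemma window_arith X q E k tau L M dd : 0 <= X -> 0 <= q -> 0 <= E ->
  0 <= k -> k <= 1 -> 0 <= tau -> 0 <= L -> 0 <= M -> dd <= M * E + L * X ->
  L * (X + (q + tau * k * dd)) * X + k * dd * q <=
  2 * (2 * L + L ^+ 2 * tau + L ^+ 2 * tau ^+ 2 + 1) * (X ^+ 2 / 2 + q ^+ 2 / 2)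
  + M ^+ 2 * k ^+ 2 * E ^+ 2 / 2.
Proof.
move=> X0 q0 E0 k0 k1 t0 L0 M0 hd.
set P := k * (M * E).
have P0 : 0 <= P by rewrite /P !mulr_ge0.
have h1 : k * dd <= P + L * X.
  have : k * dd <= k * (M * E + L * X) by exact: ler_wpM2l.
  have : k * (L * X) <= 1 * (L * X) by apply: ler_wpM2r => //; exact: mulr_ge0.
  by rewrite /P; lra.
have LtX : 0 <= L * tau * X by rewrite !mulr_ge0.
have h2 : L * tau * X * (k * dd) <= L * tau * X * (P + L * X) by exact: ler_wpM2l.
have h3 : q * (k * dd) <= q * (P + L * X) by exact: ler_wpM2l.
have h4 : P * (L * tau * X + q) <= P ^+ 2 / 2 + (L * tau * X) ^+ 2 + q ^+ 2.
  have := sqr_ge0 (P - (L * tau * X + q)); have := sqr_ge0 (L * tau * X - q).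
  move: (L * tau * X) => y; lra.
have h5 : 2 * L * (X * q) <= L * (X ^+ 2 + q ^+ 2).
  by have := mulr_ge0 L0 (sqr_ge0 (X - q)); lra.
have k1' : 0 <= q ^+ 2 * (L + L ^+ 2 * tau + L ^+ 2 * tau ^+ 2).
  by rewrite mulr_ge0 ?sqr_ge0// !addr_ge0// mulr_ge0 ?sqr_ge0.
have k2' : 0 <= X ^+ 2 by exact: sqr_ge0.
have -> : M ^+ 2 * k ^+ 2 * E ^+ 2 / 2 = P ^+ 2 / 2 by rewrite /P; field.
clearbody P; lra.
Qed.

(** Young's inequality: half of the monotonicity gain [k mu W ^+ 2] pays for the
    effect of the plant error [Z] on the integrator. *)
Lemma decay_arith k mu L Z W : 0 <= k -> 0 < mu ->
  - (k * mu) * W ^+ 2 + k * L * Z * W <=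
  - (k * mu) * (W ^+ 2 / 2) + k * (L ^+ 2 * Z ^+ 2) / (2 * mu).
Proof.
move=> k0 mu0; have h : 0 <= k / (2 * mu) * (mu * W - L * Z) ^+ 2.
  by rewrite mulr_ge0 ?sqr_ge0// divr_ge0// mulr_ge0// ltW.
rewrite -subr_ge0; apply: le_trans h _; rewrite le_eqVlt; apply/orP; left; apply/eqP.
by field; rewrite gt_eqF.
Qed.

Lemma excursion_arith rho C2 k e w Z : 0 <= rho -> 0 <= C2 -> 0 <= k -> k <= 1 ->
  0 <= e -> 0 <= w -> 0 <= Z -> Z <= rho * e + C2 * k * (e + w) ->
  Z ^+ 2 <= (2 * rho ^+ 2 + 4 * C2 ^+ 2) * (e ^+ 2 + k ^+ 2 * w ^+ 2).
Proof.
move=> r0 C0 k0 k1 e0 w0 Z0 hZ.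
have : Z ^+ 2 <= (rho * e + C2 * k * (e + w)) ^+ 2.
  rewrite ler_pXn2r ?nnegrE// !addr_ge0 ?mulr_ge0// addr_ge0//.
move/le_trans; apply.
have h1 := sqr_ge0 (rho * e - C2 * k * (e + w)).
have h2 := mulr_ge0 (sqr_ge0 (C2 * k)) (sqr_ge0 (e - w)).
have kk : k ^+ 2 <= 1 by rewrite expr_le1.
have h3 : 0 <= C2 ^+ 2 * e ^+ 2 * (1 - k ^+ 2).
  by rewrite !mulr_ge0 ?sqr_ge0// subr_ge0.
have h4 : 0 <= rho ^+ 2 * (k ^+ 2 * w ^+ 2) by rewrite !mulr_ge0 ?sqr_ge0.
lra.
Qed.

(** The two error measures at the end of a window, [e'] and [w'], are coupled by
    terms that carry a factor [k]; the plant error is halved by a fixed factor,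
    so small [k] leaves the integrator contraction [1 - k mu T / 2] as the
    slower rate, of which half survives the coupling. *)
Lemma contraction_arith k mu T C2 C4 e w e' w' : 0 < k -> k <= 1 -> 0 < mu -> 0 < T ->
  0 <= C2 -> 0 <= C4 -> k * mu * T <= 1 ->
  k * (C4 + 4 * C2 ^+ 2) <= mu * T / 4 -> k * (C4 + 4 * C2 ^+ 2) <= 1 / 4 ->
  0 <= e -> 0 <= w -> 0 <= e' -> e' <= e / 2 + C2 * k * (e + w) ->
  w' ^+ 2 <= (1 - k * mu * T / 2) * w ^+ 2 + k * C4 * (e ^+ 2 + k ^+ 2 * w ^+ 2) ->
  e' ^+ 2 + w' ^+ 2 <= (1 - k * mu * T / 4) * (e ^+ 2 + w ^+ 2).
Proof.
move=> k0 k1 mu0 T0 C20 C40 kmT hk1 hk2 e0 w0 e'0 he' hw'.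
have he : e' ^+ 2 <= e ^+ 2 / 2 + 4 * C2 ^+ 2 * k ^+ 2 * (e ^+ 2 + w ^+ 2).
  have : e' ^+ 2 <= (e / 2 + C2 * k * (e + w)) ^+ 2.
    by rewrite ler_pXn2r ?nnegrE// (le_trans e'0).
  have h1 := sqr_ge0 (e / 2 - C2 * k * (e + w)).
  have h2 := mulr_ge0 (sqr_ge0 (C2 * k)) (sqr_ge0 (e - w)).
  lra.
have ee : 0 <= e ^+ 2 by exact: sqr_ge0.
have ww : 0 <= w ^+ 2 by exact: sqr_ge0.
have kk : k ^+ 2 <= k by rewrite expr2 ler_piMl// ltW.
have kk3 : k * k ^+ 2 <= k * k by apply: ler_wpM2l; [exact: ltW|].
have c1 : 0 <= C4 * e ^+ 2 by exact: mulr_ge0.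
have c2 : 0 <= C4 * w ^+ 2 by exact: mulr_ge0.
have c3 : 0 <= C2 ^+ 2 * e ^+ 2 by rewrite mulr_ge0 ?sqr_ge0.
have c4 : 0 <= C2 ^+ 2 * w ^+ 2 by rewrite mulr_ge0 ?sqr_ge0.
have hw : k * C4 * (k ^+ 2 * w ^+ 2) + 4 * C2 ^+ 2 * k ^+ 2 * w ^+ 2 <= k * mu * T / 4 * w ^+ 2.
  have h : k * (k * (C4 + 4 * C2 ^+ 2)) * w ^+ 2 <= k * (mu * T / 4) * w ^+ 2.
    by apply: ler_wpM2r => //; apply: ler_wpM2l => //; exact: ltW.
  have : C4 * w ^+ 2 * (k * k ^+ 2) <= C4 * w ^+ 2 * (k * k) by exact: ler_wpM2l.
  lra.
have hee : k * C4 * e ^+ 2 + 4 * C2 ^+ 2 * k ^+ 2 * e ^+ 2 <= 1 / 4 * e ^+ 2.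
  have : k * (C4 + 4 * C2 ^+ 2) * e ^+ 2 <= 1 / 4 * e ^+ 2 by exact: ler_wpM2r.
  have : C2 ^+ 2 * e ^+ 2 * k ^+ 2 <= C2 ^+ 2 * e ^+ 2 * k by exact: ler_wpM2l.
  lra.
have : k * mu * T / 4 * e ^+ 2 <= 1 / 4 * e ^+ 2 by apply: ler_wpM2r => //; lra.
lra.
Qed.

Lemma expR_le_half (x : R) : 0 <= x -> x <= 1 -> expR (- x) <= 1 - x / 2.
Proof.
move=> x0 x1.
have h := expR_ge1Dx x; have p := expR_gt0 (- x).
have e1 : expR x * expR (- x) = 1 by rewrite -expRD subrr expR0.
have := ler_wpM2l (ltW p) h; rewrite [X in _ <= X]mulrC e1 => h1.
have x10 : 0 < 1 + x by lra.
rewrite -(ler_pM2r x10); apply: (le_trans h1).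
have x1' : 0 <= 1 - x by lra.
by have := mulr_ge0 x0 x1'; lra.
Qed.

End arithmetic.

Section closed_loop.
Variables (R : realType) (n p : nat).
Variables (F : 'cV[R]_n -> 'cV[R]_p -> 'cV[R]_n) (g : 'cV[R]_n -> 'cV[R]_p).
Variables (Gam : 'cV[R]_p -> 'cV[R]_n) (U Ut : set 'cV[R]_p).
Variables (L mu eps0 lam rho tau Dm Rb kap0 : R).

(** The closed loop in variational form. The plant is tested against the ball
    of radius [Rb], which is inactive because [x] will be shown to stay in its
    interior; the integrator is tested against [U], which encodes the
    projection [Pi U]. Keeping the two tests separate allows a moving test
    point for [x] and a constant one for [u]. *)
Definition cl_evi (k : R) (r : 'cV[R]_p) (a b : R)
    (x : R -> 'cV[R]_n) (u : R -> 'cV[R]_p) :=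
  [/\ forall t, a <= t -> t <= b -> enorm (x t) <= Rb /\ U (u t),
      forall t, a <= t -> t <= b -> vcont a b x t /\ vcont a b u t,
      forall t w, a <= t -> t <= b -> enorm w <= Rb ->
        upper_rate a b (fun s => hsq (x s - w)) t
          (dot (F (x t) (u t + (tau * k) *: (r - g (x t)))) (x t - w))
    & forall t w, a <= t -> t <= b -> U w ->
        upper_rate a b (fun s => hsq (u s - w)) t
          (dot (k *: (r - g (x t))) (u t - w))].

Lemma cl_evi_sub k r a b a' b' x u : a <= a' -> b' <= b ->
  cl_evi k r a b x u -> cl_evi k r a' b' x u.
Proof.
move=> aa bb [h1 h2 h3 h4].
have H t : a' <= t -> a <= t by exact: le_trans.
have H' t : t <= b' -> t <= b by move=> tb; exact: le_trans tb bb.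
split => [t /H ? /H' ?|t /H h /H' h'|t w /H h /H' h' wB|t w /H h /H' h' wU].
- exact: h1.
- by have [c1 c2] := h2 t h h'; split; apply: vcont_sub c1 || apply: vcont_sub c2.
- by apply: upper_rate_sub (h3 t w h h' wB).
- by apply: upper_rate_sub (h4 t w h h' wU).
Qed.

(* The constant [Rb] bounds all the plant states that occur, with a margin of 2
for the plant solutions [phi] with constant input; [L] is a common Lipschitz
constant on that ball, [Ut] a neighbourhood of [U] that contains the
arguments of the input nonlinearity for gains up to [kap0], and [Gam u] the
equilibrium for the input [u]. *)
Hypothesis L0 : 0 <= L.
Hypothesis mu0 : 0 < mu.
Hypothesis eps00 : 0 < eps0.
Hypothesis lam0 : 0 < lam.
Hypothesis rho1 : 1 <= rho.
Hypothesis tau0 : 0 <= tau.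
Hypothesis UUt : U `<=` Ut.
Hypothesis Flip : forall x x' u u', enorm x <= Rb -> enorm x' <= Rb -> Ut u -> Ut u' ->
  enorm (F x u - F x' u') <= L * (enorm (x - x') + enorm (u - u')).
Hypothesis glip : forall x x', enorm x <= Rb -> enorm x' <= Rb ->
  enorm (g x - g x') <= L * enorm (x - x').
Hypothesis Glip : forall u u', U u -> U u' -> enorm (Gam u - Gam u') <= L * enorm (u - u').
Hypothesis GB : forall u, U u -> enorm (Gam u) <= Rb.
Hypothesis mono : forall u u', U u -> U u' ->
  mu * enorm (u - u') ^+ 2 <= dot (g (Gam u) - g (Gam u')) (u - u').
Hypothesis const_input : forall u x0, U u -> enorm (x0 - Gam u) <= eps0 ->
  exists phi : R -> 'cV[R]_n, [/\ phi 0 = x0,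
    forall t, 0 <= t -> enorm (phi t) <= Rb - 2,
    forall b t, 0 <= t -> t <= b -> vderiv 0 b phi t (F (phi t) u)
  & forall t, 0 <= t -> enorm (phi t - Gam u) <= rho * expR (- lam * t) * enorm (x0 - Gam u)].
Hypothesis Udiam : forall u u', U u -> U u' -> enorm (u - u') <= Dm.
Hypothesis Dm0 : 0 <= Dm.
Hypothesis kap00 : 0 < kap0.
Hypothesis UtI : forall k x u ur, 0 <= k -> k <= kap0 -> enorm x <= Rb -> U u -> U ur ->
  Ut (u + (tau * k) *: (g (Gam ur) - g x)).

(* The window length makes the factor of the plant estimate at most 1/2. *)
Let T := Num.max 1 (ln (2 * rho) / lam).
Let M1 := L ^+ 2 + L * rho.
Let C0 := 2 * (2 * L + L ^+ 2 * tau + L ^+ 2 * tau ^+ 2 + 1).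
Let C1 := M1 * (expR (C0 * T) * T + 1).

Let T1 : 1 <= T. Proof. by rewrite /T le_max lexx. Qed.
Let T0 : 0 < T. Proof. exact: lt_le_trans T1. Qed.
Let rho0 : 0 < rho. Proof. exact: lt_le_trans rho1. Qed.

Let half : rho * expR (- lam * T) <= 1 / 2.
Proof.
have h : ln (2 * rho) <= lam * T.
  by rewrite [leRHS]mulrC -ler_pdivrMr// /T le_max lexx orbT.
have r20 : 0 < 2 * rho by rewrite mulr_gt0.
rewrite mulNr expRN.
have : expR (ln (2 * rho)) <= expR (lam * T) by rewrite ler_expR.
rewrite lnK ?posrE// => h2.
by rewrite ler_pdivrMr ?expR_gt0//; lra.
Qed.

Let M10 : 0 <= M1. Proof. by rewrite addr_ge0 ?sqr_ge0// mulr_ge0// ltW. Qed.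
Let C00 : 0 <= C0.
Proof. by rewrite mulr_ge0// !addr_ge0 ?mulr_ge0 ?sqr_ge0. Qed.
Let C10 : 0 <= C1.
Proof. by rewrite mulr_ge0// addr_ge0// mulr_ge0 ?expR_ge0// ltW. Qed.

Let C2 := C1 * (1 + L).
Let C4 := L ^+ 2 * T / mu * (2 * rho ^+ 2 + 4 * C2 ^+ 2).
Let C5 := 2 * rho ^+ 2 + 4 * C2 ^+ 2 + 1 + C4.

Let C20 : 0 <= C2. Proof. by rewrite mulr_ge0// addr_ge0. Qed.
Let P20 : 0 <= 2 * rho ^+ 2 + 4 * C2 ^+ 2.
Proof. by rewrite addr_ge0// mulr_ge0 ?sqr_ge0. Qed.
Let C40 : 0 <= C4.
Proof.
by apply: mulr_ge0 => //; rewrite divr_ge0// ?mulr_ge0 ?sqr_ge0// ltW.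
Qed.
Let C50 : 0 <= C5.
Proof. by rewrite addr_ge0// addr_ge0. Qed.

Section window.
Variables (k : R) (ur : 'cV[R]_p) (x : R -> 'cV[R]_n) (u : R -> 'cV[R]_p) (a : R).
Hypothesis k0 : 0 < k.
Hypothesis k1 : k <= 1.
Hypothesis kk0 : k <= kap0.
Hypothesis Uur : U ur.
Let r := g (Gam ur).
Let e := enorm (x a - Gam (u a)).
Let w := enorm (u a - ur).
Hypothesis e_le : e <= eps0.

Let e0 : 0 <= e. Proof. exact: enorm_ge0. Qed.
Let w0 : 0 <= w. Proof. exact: enorm_ge0. Qed.

(** Compare with the constant-input solution [y] that starts at [x a]. Testing
    the plant along [y] and the integrator at [u a], the sum [S] of the squared
    deviations satisfies [S' <= C0 S + D] with [D] of order [(k (e + w)) ^+ 2],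
    because the integrator moves with speed [k] times the output error and that
    error is, up to a multiple of the deviation itself, of order [e + w];
    Gronwall concludes, as [S a = 0]. *)
Lemma window_excursion b : a <= b -> b <= a + T -> cl_evi k r a b x u ->
  exists y, [/\ enorm y <= Rb - 2,
    enorm (y - Gam (u a)) <= rho * expR (- lam * (b - a)) * e,
    enorm (x b - y) <= C1 * (k * (e + w))
  & enorm (u b - u a) <= C1 * (k * (e + w))].
Proof.
move=> ab bT [zK zc zx zu].
have [_ Ua] := zK a (lexx _) ab.
have [phi [phi0 phiB phid phie]] := const_input Ua e_le.
have ba0 : 0 <= b - a by rewrite subr_ge0.
exists (phi (b - a)).
have [] := (phiB _ ba0, phie _ ba0).
pose y t := phi (t - a).
have yd t : a <= t -> t <= b -> vderiv a b y t (F (y t) (u a)).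
  move=> at_ tb; move=> eps eps0'.
  have ta0 : 0 <= t - a by rewrite subr_ge0.
  have tba : t - a <= b - a by lra.
  have [d d0 H] := phid (b - a) (t - a) ta0 tba _ eps0'.
  exists d => // s as_ sb st.
  have := H (s - a); have -> : s - a - (t - a) = s - t by ring.
  by apply => //; lra.
pose S t := hsq (x t - y t) + hsq (u t - u a).
pose D := M1 ^+ 2 * k ^+ 2 * (e + w) ^+ 2 / 2.
have D0 : 0 <= D.
  by apply: divr_ge0 => //; apply: mulr_ge0; [apply: mulr_ge0|]; exact: sqr_ge0.
have Sc t : a <= t -> t <= b -> rcont a b S t.
  move=> at_ tb; have [cx cu] := zc t at_ tb.
  have cy := vderiv_vcont (yd t at_ tb).
  have cxy : vcont a b (fun s => x s - y s) t.
    move=> ep ep0; have ep20 : 0 < ep / 2 by rewrite divr_gt0.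
    have [d1 d10 H1] := cx _ ep20; have [d2 d20 H2] := cy _ ep20.
    exists (Num.min d1 d2); first exact: min_gt0.
    move=> s as_ sb st.
    have := enormD (x s - x t) (- (y s - y t)); rewrite enormN.
    have -> : x s - x t - (y s - y t) = x s - y s - (x t - y t).
      by apply/matrixP => i j; rewrite !mxE; ring.
    have := H1 s as_ sb (lt_min_l st); have := H2 s as_ sb (lt_min_r st).
    move: (enorm _) (enorm _) (enorm _) => *; lra.
  have c1 := rcont_hsq 0 cxy; have c2 := rcont_hsq (u a) cu.
  move=> ep ep0; have ep20 : 0 < ep / 2 by rewrite divr_gt0.
  have [d1 d10 H1] := c1 _ ep20; have [d2 d20 H2] := c2 _ ep20.
  exists (Num.min d1 d2); first exact: min_gt0.
  move=> s as_ sb st.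
  have := H1 s as_ sb (lt_min_l st); have := H2 s as_ sb (lt_min_r st).
  rewrite !subr0 /S opprD addrACA => h1 h2.
  by apply: le_trans (ler_normD _ _) _; lra.
have Sr t : a <= t -> t <= b -> upper_rate a b S t (C0 * S t + D).
  move=> at_ tb.
  have [xB uU] := zK t at_ tb; have [cx cu] := zc t at_ tb.
  have ta0 : 0 <= t - a by rewrite subr_ge0.
  have yB' := phiB _ ta0; have yB : enorm (y t) <= Rb by rewrite /y; lra.
  have r1 := moving_test cx (yd t at_ tb) (zx t (y t) at_ tb yB).
  have r2 := zu t (u a) at_ tb Ua.
  apply: upper_rate_le (upper_rateD r1 r2).
  rewrite /S !hsqE dotZl.
  set X := enorm (x t - y t); set q := enorm (u t - u a).
  set dd := enorm (r - g (x t)).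
  have X0 : 0 <= X by exact: enorm_ge0.
  have q0 : 0 <= q by exact: enorm_ge0.
  have dd0 : 0 <= dd by exact: enorm_ge0.
  have hdd : dd <= M1 * (e + w) + L * X.
    have t1 : dd <= enorm (r - g (Gam (u a))) + (enorm (g (Gam (u a)) - g (y t)) + enorm (g (y t) - g (x t))).
      apply: le_trans (enorm_triangle (g (Gam (u a))) _ _) _; rewrite lerD2l.
      exact: enorm_triangle.
    have t2 : enorm (r - g (Gam (u a))) <= L * (L * w).
      apply: le_trans (glip (GB Uur) (GB Ua)) _; apply: ler_wpM2l => //.
      by rewrite /w (enormB (u a)); exact: Glip.
    have t3 : enorm (g (Gam (u a)) - g (y t)) <= L * (rho * e).
      apply: le_trans (glip (GB Ua) yB) _; apply: ler_wpM2l => //.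
      rewrite enormB; apply: le_trans (phie _ ta0) _; rewrite -/e.
      apply: ler_wpM2r => //; apply: ler_piMr; first exact: ltW.
      by rewrite -expR0 ler_expR mulNr oppr_le0 mulr_ge0// ltW.
    have t4 : enorm (g (y t) - g (x t)) <= L * X.
      by apply: le_trans (glip yB xB) _; rewrite enormB.
    have j1 : 0 <= L ^+ 2 * e by rewrite mulr_ge0 ?sqr_ge0.
    have j2 : 0 <= L * rho * w by rewrite !mulr_ge0// ltW.
    move: t1 t2 t3 t4; rewrite /M1 /dd; move: (enorm (_ - _)) (enorm (_ - _)) (enorm (_ - _)) (enorm (_ - _)) => *.
    lra.
  have b1 : dot (F (x t) (u t + (tau * k) *: (r - g (x t))) - F (y t) (u a)) (x t - y t)
      <= L * (X + (q + tau * k * dd)) * X.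
    apply: le_trans (cauchy_schwarz _ _) _; apply: ler_wpM2r => //.
    apply: le_trans (Flip xB yB (UtI (ltW k0) kk0 xB uU Uur) (UUt Ua)) _.
    apply: ler_wpM2l => //; rewrite lerD2l.
    rewrite addrAC; apply: le_trans (enormD _ _) _; rewrite lerD2l enormZ.
    by rewrite ger0_norm// mulr_ge0// ltW.
  have b2 : k * dot (r - g (x t)) (u t - u a) <= k * dd * q.
    by rewrite -mulrA; apply: ler_wpM2l (cauchy_schwarz _ _); exact: ltW.
  apply: le_trans (lerD b1 b2) _.
  have := window_arith X0 q0 (addr_ge0 e0 w0) (ltW k0) k1 tau0 L0 M10 hdd.
  by rewrite /C0 /D.
have Sb := gronwall ab C00 D0 Sc Sr.
have Sa : S a = 0.
  by rewrite /S /y !subrr phi0 !subrr !hsqE !enorm0 expr0n/= mul0r addr0.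
have {}Sb : S b <= (C1 * (k * (e + w))) ^+ 2 / 2.
  apply: (le_trans Sb); rewrite Sa add0r.
  set Eb := expR _.
  have E1 : Eb <= expR (C0 * T) by rewrite ler_expR; apply: ler_wpM2l => //; lra.
  set ET := expR (C0 * T) in E1.
  have E0 : 0 <= Eb by exact: expR_ge0.
  have h1 : Eb * (D * (b - a)) <= ET * (D * T).
    apply: ler_pM => //; first exact: mulr_ge0.
    by apply: ler_wpM2l => //; lra.
  apply: (le_trans h1).
  have ET0 : 0 <= ET * T by rewrite mulr_ge0 ?expR_ge0// ltW.
  have -> : ET * (D * T) = (ET * T) * D by ring.
  have -> : (C1 * (k * (e + w))) ^+ 2 / 2 = (ET * T + 1) ^+ 2 * D.
    by rewrite /C1 /D -/ET; field.
  apply: ler_wpM2r => //; rewrite sqrrD expr1n mulr1.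
  by have := sqr_ge0 (ET * T); move: (ET * T) ET0 => *; lra.
have cE0 : 0 <= C1 * (k * (e + w)).
  by rewrite mulr_ge0// mulr_ge0 ?addr_ge0// ltW.
move=> h1 h2; split => //.
  rewrite -(ler_pXn2r (n:=2))// ?nnegrE ?enorm_ge0//.
  have := hsq_ge0 (u b - u a); move: Sb; rewrite /S !hsqE -/(y b).
  by move: (_ ^+ 2) (_ ^+ 2) (_ ^+ 2) => *; lra.
rewrite -(ler_pXn2r (n:=2))// ?nnegrE ?enorm_ge0//.
have := hsq_ge0 (x b - y b); move: Sb; rewrite /S !hsqE.
by move: (_ ^+ 2) (_ ^+ 2) (_ ^+ 2) => *; lra.
Qed.

Lemma window_dist b : a <= b -> b <= a + T -> cl_evi k r a b x u ->
  enorm (x b - Gam (u b)) <= rho * expR (- lam * (b - a)) * e + C2 * k * (e + w)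
  /\ enorm (x b) <= Rb - 2 + C1 * (k * (e + w)).
Proof.
move=> ab bT hz; have [y [yB yG xy uu]] := window_excursion ab bT hz.
have [zK _ _ _] := hz.
have [_ Ua] := zK a (lexx _) ab; have [_ Ub] := zK b ab (lexx _).
split; last first.
  rewrite -(subrK y (x b)); apply: le_trans (enormD _ _) _; rewrite addrC.
  exact: lerD.
have h1 := enorm_triangle y (x b) (Gam (u b)).
have h2 := enorm_triangle (Gam (u a)) y (Gam (u b)).
have h3 := Glip Ua Ub; rewrite (enormB (u a)) in h3.
have h4 := ler_wpM2l L0 uu.
move: h1 h2 h3 h4 yG xy; rewrite /C2; move: (expR _) => E.
move: (enorm (u b - u a)) (enorm (Gam _ - Gam _)) (enorm (x b - y)) => c1 c2 c3.
move: (enorm (y - Gam (u b))) (enorm (y - Gam (u a))) (enorm (x b - Gam _)) => c4 c5 c6.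
lra.
Qed.

Lemma window_sq b : a <= b -> b <= a + T -> cl_evi k r a b x u ->
  enorm (x b - Gam (u b)) ^+ 2 <= (2 * rho ^+ 2 + 4 * C2 ^+ 2) * (e ^+ 2 + k ^+ 2 * w ^+ 2).
Proof.
move=> ab bT hz; have [h _] := window_dist ab bT hz.
apply: excursion_arith => //; try exact: ltW; first exact: enorm_ge0.
apply: le_trans h _; rewrite lerD2r; apply: ler_wpM2r => //.
apply: ler_piMr; first exact: ltW.
rewrite -expR0 ler_expR mulNr oppr_le0 mulr_ge0 ?subr_ge0//; exact: ltW.
Qed.

(** Testing the integrator at [ur], strong monotonicity gives the decay rate
    [k mu]; the deviation of [x] from [Gam (u t)] acts as a perturbation that
    [window_sq] bounds on the whole window. *)
Lemma window_decay b : a <= b -> b <= a + T -> cl_evi k r a b x u ->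
  enorm (u b - ur) ^+ 2 <= expR (- (k * mu) * (b - a)) * w ^+ 2
    + k * C4 * (e ^+ 2 + k ^+ 2 * w ^+ 2).
Proof.
move=> ab bT hz; have [zK zc zx zu] := hz.
pose Q := e ^+ 2 + k ^+ 2 * w ^+ 2.
have Q0 : 0 <= Q by rewrite addr_ge0 ?sqr_ge0// mulr_ge0 ?sqr_ge0.
pose P := 2 * rho ^+ 2 + 4 * C2 ^+ 2.
have P0 : 0 <= P by rewrite addr_ge0// mulr_ge0 ?sqr_ge0.
pose D := k * (L ^+ 2 * (P * Q)) / (2 * mu).
have L20 : 0 <= L ^+ 2 by exact: sqr_ge0.
have D0 : 0 <= D.
  by rewrite /D divr_ge0 ?mulr_ge0//; exact: ltW.
have kmu : 0 <= k * mu by rewrite mulr_ge0// ltW.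
have := @gronwall_decay R a b (fun s => hsq (u s - ur)) (k * mu) D ab kmu D0.
have fc t : a <= t -> t <= b -> rcont a b (fun s => hsq (u s - ur)) t.
  by move=> at_ tb; apply: rcont_hsq; have [] := zc t at_ tb.
have fr t : a <= t -> t <= b ->
    upper_rate a b (fun s => hsq (u s - ur)) t (- (k * mu) * hsq (u t - ur) + D).
  move=> at_ tb; have [xB uU] := zK t at_ tb.
  apply: upper_rate_le (zu t ur at_ tb Uur).
  have hz' : cl_evi k r a t x u by apply: cl_evi_sub hz.
  have Zsq := window_sq at_ (le_trans tb bT) hz'.
  set Z := enorm (x t - Gam (u t)) in Zsq.
  have h1 := mono uU Uur.
  have h2 : dot (g (Gam (u t)) - g (x t)) (u t - ur) <= L * Z * enorm (u t - ur).
    apply: le_trans (cauchy_schwarz _ _) _; apply: ler_wpM2r; first exact: enorm_ge0.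
    by rewrite /Z (enormB (x t)); apply: glip => //; exact: GB.
  have h3 : dot (r - g (x t)) (u t - ur) = - dot (g (Gam (u t)) - g (Gam ur)) (u t - ur)
      + dot (g (Gam (u t)) - g (x t)) (u t - ur).
    by rewrite -dotNl -dotDl opprB addrA subrK.
  rewrite dotZl h3 hsqE.
  have h4 := decay_arith L Z (enorm (u t - ur)) (ltW k0) mu0.
  have h5 : k * (L ^+ 2 * Z ^+ 2) / (2 * mu) <= D.
    rewrite /D; apply: ler_wpM2r; first by rewrite invr_ge0 mulr_ge0// ltW.
    by apply: ler_wpM2l; [exact: ltW|]; apply: ler_wpM2l.
  apply: le_trans (_ : k * (- (mu * enorm (u t - ur) ^+ 2) + L * Z * enorm (u t - ur)) <= _).
    by apply: ler_wpM2l; [exact: ltW|]; apply: lerD => //; rewrite lerN2.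
  move: h4 h5; move: (enorm (u t - ur)) (_ / _) => y c; lra.
move=> /(_ fc fr); rewrite !hsqE -/w => h.
have hD : 2 * (D * (b - a)) <= k * C4 * Q.
  have : D * (b - a) <= D * T by apply: ler_wpM2l => //; lra.
  have -> : k * C4 * Q = 2 * (D * T).
    by rewrite /C4 /D -/P; field; rewrite gt_eqF.
  lra.
rewrite -/Q; move: h hD; move: (expR _) (D * _) (k * C4 * Q) (enorm (u b - ur)) => *; lra.
Qed.

End window.

Let V (x : R -> 'cV[R]_n) (u : R -> 'cV[R]_p) ur t :=
  enorm (x t - Gam (u t)) ^+ 2 + enorm (u t - ur) ^+ 2.

(* The bounds after the first pair serve, in this order, to linearize the
exponential decay over a window, to absorb the coupling terms in
[contraction_arith], and to keep the plant error below [eps0] and the plant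
state inside the ball. *)
Let kappa := Num.min (Num.min 1 kap0) (Num.min (1 / (mu * T))
  (Num.min (Num.min (mu * T / 4) (1 / 4) / (C4 + 4 * C2 ^+ 2 + 1))
    (Num.min (eps0 / 2) 1 / ((C2 + C1 + 1) * (eps0 + Dm + 1))))).

Let muT : 0 < mu * T. Proof. exact: mulr_gt0. Qed.
Let c40 : 0 < C4 + 4 * C2 ^+ 2 + 1.
Proof. by rewrite ltr_wpDl// addr_ge0 ?C40// mulr_ge0 ?sqr_ge0. Qed.
Let c20 : 0 < (C2 + C1 + 1) * (eps0 + Dm + 1).
Proof.
by rewrite mulr_gt0// ltr_wpDl// addr_ge0// ?C20// ltW.
Qed.

Let kappa0 : 0 < kappa.
Proof.
rewrite /kappa; do 3 ?apply: min_gt0 => //; apply: divr_gt0 => //; apply: min_gt0 => //;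
  exact: divr_gt0.
Qed.

Section decay.
Variables (k : R) (ur : 'cV[R]_p) (x : R -> 'cV[R]_n) (u : R -> 'cV[R]_p).
Hypothesis k0 : 0 < k.
Hypothesis kk : k <= kappa.
Hypothesis Uur : U ur.
Let r := g (Gam ur).

Let k1 : k <= 1.
Proof. by apply: le_trans kk _; rewrite /kappa !ge_min lexx. Qed.
Let kk0 : k <= kap0.
Proof. by apply: le_trans kk _; rewrite /kappa !ge_min lexx orbT. Qed.
Let kmT : k * mu * T <= 1.
Proof.
rewrite -mulrA -ler_pdivlMr//; apply: le_trans kk _.
by rewrite /kappa !ge_min lexx !orbT.
Qed.
Let kC4 : k * (C4 + 4 * C2 ^+ 2) <= Num.min (mu * T / 4) (1 / 4).
Proof.
have : k * (C4 + 4 * C2 ^+ 2 + 1) <= Num.min (mu * T / 4) (1 / 4).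
  rewrite -ler_pdivlMr//; apply: le_trans kk _.
  by rewrite /kappa !ge_min lexx !orbT.
by apply: le_trans; apply: ler_wpM2l; [exact: ltW|rewrite lerDl].
Qed.
Let kC2 : (C2 + C1 + 1) * (k * (eps0 + Dm + 1)) <= Num.min (eps0 / 2) 1.
Proof.
rewrite mulrCA -ler_pdivlMr//; apply: le_trans kk _.
by rewrite /kappa !ge_min lexx !orbT.
Qed.

Let e a := enorm (x a - Gam (u a)).
Let w a := enorm (u a - ur).

Let kE a : U (u a) -> e a <= eps0 -> 0 <= k * (e a + w a) <= k * (eps0 + Dm + 1).
Proof.
move=> Ua ea; have wD := Udiam Ua Uur; rewrite -/(w a) in wD.
have ea0 : 0 <= e a by exact: enorm_ge0.
have wa0 : 0 <= w a by exact: enorm_ge0.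
by rewrite mulr_ge0 ?addr_ge0 ?(ltW k0)//= ler_pM2l//; lra.
Qed.

Let window_bound a b : a <= b -> b <= a + T -> cl_evi k r a b x u -> e a <= eps0 ->
  enorm (x b) <= Rb - 1 /\ V x u ur b <= C5 * V x u ur a.
Proof.
move=> ab bT hz ea; have [zK _ _ _] := hz; have [_ Ua] := zK a (lexx _) ab.
have [_ h1] := window_dist k0 k1 kk0 Uur ea ab bT hz.
have /andP[E0 E1] := kE Ua ea.
have C2' := C20; have C1' := C10.
split.
  apply: le_trans h1 _.
  have : (C2 + C1 + 1) * (k * (eps0 + Dm + 1)) <= 1.
    by apply: le_trans kC2 _; rewrite ge_min lexx orbT.
  have : C1 * (k * (e a + w a)) <= (C2 + C1 + 1) * (k * (eps0 + Dm + 1)).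
    by apply: ler_pM => //; lra.
  rewrite -/(e a) -/(w a); lra.
have h2 := window_sq k0 k1 kk0 Uur ea ab bT hz.
have h3 := window_decay k0 k1 kk0 Uur ea ab bT hz.
rewrite -/(e a) -/(w a) in h2 h3; rewrite /V -/(e a) -/(w a).
have e2 : 0 <= e a ^+ 2 by exact: sqr_ge0.
have w2 : 0 <= w a ^+ 2 by exact: sqr_ge0.
have k2 : k ^+ 2 <= 1 by rewrite expr_le1// ltW.
have kw : k ^+ 2 * w a ^+ 2 <= w a ^+ 2 by exact: ler_piMl.
have Q0 : 0 <= k ^+ 2 * w a ^+ 2 by rewrite mulr_ge0 ?sqr_ge0.
have P0 : 0 <= 2 * rho ^+ 2 + 4 * C2 ^+ 2 by rewrite addr_ge0// mulr_ge0 ?sqr_ge0.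
have h4 := ler_wpM2l P0 (lerD (lexx (e a ^+ 2)) kw).
have h5 : expR (- (k * mu) * (b - a)) * w a ^+ 2 <= w a ^+ 2.
  apply: ler_piMl => //.
  by rewrite -expR0 ler_expR mulNr oppr_le0 mulr_ge0 ?subr_ge0// mulr_ge0// ltW.
have h6 : k * C4 * (e a ^+ 2 + k ^+ 2 * w a ^+ 2) <= C4 * (e a ^+ 2 + w a ^+ 2).
  apply: ler_pM => //; [by rewrite mulr_ge0 ?C40// ltW|exact: addr_ge0| |by rewrite lerD2l].
  by apply: ler_piMl; [exact: C40|].
move: h2 h3 h4 h5 h6; rewrite /C5.
move: (enorm (x b - _) ^+ 2) (enorm (u b - ur) ^+ 2) (expR _ * _) => X W Ew.
move: (2 * rho ^+ 2 + 4 * C2 ^+ 2) => P; lra.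
Qed.

(** Iterating windows needs both conclusions: the plant error at the end is again
    at most [eps0], so that the next constant-input solution exists. *)
Let window_step a : cl_evi k r a (a + T) x u -> e a <= eps0 ->
  e (a + T) <= eps0 /\ V x u ur (a + T) <= (1 - k * mu * T / 4) * V x u ur a.
Proof.
move=> hz ea; have ab : a <= a + T by rewrite lerDl ltW.
have [zK _ _ _] := hz; have [_ Ua] := zK a (lexx _) ab.
have [h1 _] := window_dist k0 k1 kk0 Uur ea ab (lexx _) hz.
have h3 := window_decay k0 k1 kk0 Uur ea ab (lexx _) hz.
rewrite -/(e a) -/(w a) -/(e (a + T)) -/(w (a + T)) in h1 h3.
have -> : V x u ur (a + T) = e (a + T) ^+ 2 + w (a + T) ^+ 2 by [].
have -> : V x u ur a = e a ^+ 2 + w a ^+ 2 by [].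
have aTa : a + T - a = T by rewrite addrAC subrr add0r.
rewrite aTa in h1 h3.
have ea0 : 0 <= e a by exact: enorm_ge0.
have wa0 : 0 <= w a by exact: enorm_ge0.
have h1' : e (a + T) <= e a / 2 + C2 * k * (e a + w a).
  by apply: le_trans h1 _; rewrite lerD2r mulrC; have := ler_wpM2l ea0 half; lra.
have C2' := C20; have C1' := C10.
split.
  have /andP[E0 E1] := kE Ua ea.
  have : (C2 + C1 + 1) * (k * (eps0 + Dm + 1)) <= eps0 / 2.
    by apply: le_trans kC2 _; rewrite ge_min lexx.
  have : C2 * (k * (e a + w a)) <= (C2 + C1 + 1) * (k * (eps0 + Dm + 1)).
    by apply: ler_pM => //; lra.
  move: h1' ea; lra.
apply: (@contraction_arith R k mu T C2 C4) => //; try exact: enorm_ge0.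
- by apply: le_trans kC4 _; rewrite ge_min lexx.
- by apply: le_trans kC4 _; rewrite ge_min lexx orbT.
apply: le_trans h3 _; rewrite lerD2r; apply: ler_wpM2r; first exact: sqr_ge0.
rewrite mulNr; apply: expR_le_half => //.
by rewrite !mulr_ge0// ltW.
Qed.

(** [1 - s <= expR (- s)] turns the geometric decay into an exponential one. *)
Let windows a b j : cl_evi k r a b x u -> e a <= eps0 -> a + j%:R * T <= b ->
  e (a + j%:R * T) <= eps0 /\
  V x u ur (a + j%:R * T) <= expR (- (k * mu * T / 4)) ^+ j * V x u ur a.
Proof.
move=> hz ea; elim: j => [|j IH] hj.
  by rewrite mul0r addr0 expr0 mul1r.
rewrite -natr1 mulrDl mul1r addrA in hj *.
have [|h1 h2] := IH; first by apply: le_trans hj; rewrite lerDl ltW.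
have hz' : cl_evi k r (a + j%:R * T) (a + j%:R * T + T) x u.
  apply: cl_evi_sub hz => //; rewrite lerDl mulr_ge0//; exact: ltW.
have [h3 h4] := window_step hz' h1; split => //.
apply: le_trans h4 _.
have V0 t : 0 <= V x u ur t by rewrite addr_ge0 ?sqr_ge0.
apply: (@le_trans _ _ (expR (- (k * mu * T / 4)) * V x u ur (a + j%:R * T))).
  apply: ler_wpM2r => //; have := expR_ge1Dx (- (k * mu * T / 4)); lra.
by rewrite exprS; apply: le_trans (ler_wpM2l (expR_ge0 _) h2) _; rewrite mulrA.
Qed.

Lemma decay_at a b t : cl_evi k r a b x u -> e a <= eps0 -> a <= t -> t <= b ->
  enorm (x t) <= Rb - 1 /\
  V x u ur t <= C5 * expR (k * mu * T / 4) * expR (- (k * mu / 4) * (t - a)) * V x u ur a.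
Proof.
move=> hz ea at_ tb.
have ta0 : 0 <= (t - a) / T by rewrite divr_ge0 ?subr_ge0// ltW.
have /andP[j1 j2] := truncn_itv ta0.
set j := Num.trunc _ in j1 j2.
rewrite ler_pdivlMr// in j1; rewrite ltr_pdivrMr// -natr1 mulrDl mul1r in j2.
have jb : a + j%:R * T <= b by lra.
have jt : a + j%:R * T <= t by lra.
have tT : t <= a + j%:R * T + T by lra.
have [h1 h2] := windows hz ea jb.
have hz' : cl_evi k r (a + j%:R * T) t x u.
  apply: cl_evi_sub hz => //; rewrite lerDl mulr_ge0//; exact: ltW.
have [h3 h4] := window_bound jt tT hz' h1; split => //.
apply: le_trans h4 _; rewrite -!mulrA; apply: ler_wpM2l; first exact: C50.
apply: (le_trans h2); rewrite mulrA.
have V0 : 0 <= V x u ur a by rewrite addr_ge0 ?sqr_ge0.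
apply: ler_wpM2r => //.
rewrite -expRM_natl -expRD ler_expR.
have kmu : 0 <= k * mu / 4 by rewrite divr_ge0// mulr_ge0// ltW.
have : k * mu / 4 * (t - a) <= k * mu / 4 * (j%:R * T + T).
  by apply: ler_wpM2l => //; rewrite lerBlDl addrA.
by clear h1 h2 h3 hz hz' V0 ea; lra.
Qed.

End decay.

(** A whole number of windows contracts [V], and the remaining part of a window
    costs the factor [C5]. *)
Theorem evi_decay : exists2 kappa : R, 0 < kappa /\ kappa <= kap0 &
  forall k, 0 < k -> k <= kappa -> exists M alpha : R, [/\ 0 < M, 0 < alpha &
    forall ur a b x u, U ur -> cl_evi k (g (Gam ur)) a b x u ->
      enorm (x a - Gam (u a)) <= eps0 -> forall t, a <= t -> t <= b ->
      enorm (x t) <= Rb - 1 /\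
      enorm (x t - Gam (u t)) ^+ 2 + enorm (u t - ur) ^+ 2
        <= M * expR (- alpha * (t - a)) * (enorm (x a - Gam (u a)) ^+ 2 + enorm (u a - ur) ^+ 2)].
Proof.
exists kappa; first by split; [exact: kappa0|rewrite /kappa !ge_min lexx orbT].
move=> k k0 kk; exists ((C5 + 1) * expR (k * mu * T / 4)), (k * mu / 4).
have C5' := C50.
split; [by rewrite mulr_gt0 ?expR_gt0//; lra|by rewrite divr_gt0// mulr_gt0|].
move=> ur a b x u Uur hz ea t at_ tb.
have [h1 h2] := decay_at k0 kk Uur hz ea at_ tb; split => //.
apply: le_trans h2 _; apply: ler_wpM2r; first by rewrite addr_ge0 ?sqr_ge0.
apply: ler_wpM2r; first exact: expR_ge0.
by apply: ler_wpM2r; [exact: expR_ge0|rewrite lerDl].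
Qed.

End closed_loop.

(** * Lipschitz bounds on compact convex sets *)

Section pointwise_lipschitz.
Variables (R : realType) (V W : normedModType R) (d : nat).
Variables (b : 'I_d -> V) (c : V -> 'I_d -> R).
Hypothesis bE : forall v, v = \sum_i c v i *: b i.
Hypothesis cb : forall v i, `|c v i| <= `|v|.

(** The directional derivatives along a basis are continuous, hence bounded on
    the compact set [K]; by linearity this bounds the differential, uniformly
    on [K], and the remainder is at most [enorm (z' - z)] close to [z]. The
    domain is an abstract space with a basis because the plant field lives on a
    product of spaces of columns. *)
Lemma Ck1_pointwise_lipschitz (A K : set V) (f : V -> W) :
  Ck 1 A f -> compact K -> K `<=` A ->
  exists2 C : R, 0 <= C &
    forall z, K z -> \forall z' \near z, `|f z' - f z| <= C * `|z' - z|.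
Proof.
move=> [fd fc] Kc KA.
have [K0|/set0P K0] := eqVneq K set0; first by exists 0 => // z; rewrite K0.
have /choice[M hM] : forall i, exists M : R, 0 <= M /\ forall z, K z -> `|'D_(b i) f z| <= M.
  move=> i; have [|z0 _ hz0] := compact_EVT_max K0 Kc (f := fun z => `|'D_(b i) f z|).
    apply/subspace_continuousP => z Kz.
    have h := fc (b i) z (KA _ Kz).
    apply: (@cvg_within_filter) => //.
    by apply: (continuous_comp h); exact: norm_continuous.
  exists `|'D_(b i) f z0|; split => // z Kz; apply: hz0; exact: mem_set.
have dbound z v : K z -> `|'d f z v| <= (\sum_i M i) * `|v|.
  move=> Kz; rewrite {1}(bE v) linear_sum.
  apply: le_trans (ler_norm_sum _ _ _) _; rewrite mulr_suml; apply: ler_sum => i _.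
  have -> : 'd f z (c v i *: b i) = c v i *: 'd f z (b i) by rewrite linearZ.
  rewrite normrZ mulrC; have [M0 MD] := hM i.
  have h1 : `|'d f z (b i)| <= M i by rewrite -deriveE; [exact: MD|exact/fd/KA].
  exact: (ler_pM (normr_ge0 _) (normr_ge0 _) h1 (cb v i)).
have M0 : 0 <= \sum_i M i by apply: sumr_ge0 => i _; have [] := hM i.
exists (\sum_i M i + 1); first by rewrite addr_ge0.
move=> z Kz.
have fz := fd _ (KA _ Kz).
have h := diff_locallyx fz.
set o := 'o_ _ _ in h.
have ho : \forall h \near (0 : V), `|o h| <= 1 * `|h|.
  by have /eqoP := littleo_eqo o; apply.
have : \forall z' \near z, `|o (z' - z)| <= 1 * `|z' - z|.
  move: ho => /nbhs_ballP[e /= e0 he]; apply/nbhs_ballP; exists e => // y.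
  rewrite -ball_normE/= => zy; apply: he.
  by rewrite -ball_normE/= sub0r normrN distrC.
apply: filterS => z' hz'.
have -> : f z' - f z = 'd f z (z' - z) + o (z' - z).
  by have := h (z' - z); rewrite subrK => ->; rewrite addrC !addrA addNr add0r.
apply: le_trans (ler_normD _ _) _; rewrite mulrDl; apply: lerD => //.
exact: dbound.
Qed.

End pointwise_lipschitz.

(** Local Lipschitz bounds with a common constant, each with respect to its
    own centre, add up along a segment. *)
Lemma local_lipschitz (R : realType) (q q' : nat) (K : set 'cV[R]_q)
    (h : 'cV[R]_q -> 'cV[R]_q') (C : R) : segment_closed K ->
  (forall z, K z -> exists2 d : R, 0 < d & forall z', K z' -> enorm (z' - z) < d ->
     enorm (h z' - h z) <= C * enorm (z' - z)) ->
  forall z z', K z -> K z' -> enorm (h z' - h z) <= C * enorm (z' - z).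
Proof.
move=> Kseg hloc z z' Kz Kz'.
pose y (t : R) := z + t *: (z' - z).
have yE s t : y t - y s = (t - s) *: (z' - z).
  by apply/matrixP => i j; rewrite !mxE; ring.
have Ky t : 0 <= t -> t <= 1 -> K (y t) by move=> *; exact: Kseg.
pose P s s' := enorm (h (y s') - h (y s)) <= C * ((s' - s) * enorm (z' - z)).
have : P 0 1.
  apply: (@cousin R 0 1 P ler01) => [s t v _ _ _ _ h1 h2|t t0 t1].
    rewrite /P; have -> : C * ((v - s) * enorm (z' - z)) =
      C * ((v - t) * enorm (z' - z)) + C * ((t - s) * enorm (z' - z)) by ring.
    apply: le_trans (enorm_triangle (h (y t)) _ _) _; exact: lerD.
  have [d d0 hd] := hloc _ (Ky t t0 t1).
  have E0 : 0 < enorm (z' - z) + 1 by rewrite ltr_wpDl// enorm_ge0.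
  exists (d / (enorm (z' - z) + 1)); first by rewrite divr_gt0.
  have close s : 0 <= s -> s <= 1 -> `|s - t| < d / (enorm (z' - z) + 1) ->
      enorm (h (y s) - h (y t)) <= C * (`|s - t| * enorm (z' - z)).
    move=> s0 s1; rewrite ltr_pdivlMr// => hs.
    rewrite -enormZ -yE; apply: hd; first exact: Ky.
    rewrite yE enormZ; apply: le_lt_trans hs; apply: ler_wpM2l => //.
    by rewrite lerDl.
  move=> s s' s0 st ts s1 h1 h2; rewrite /P.
  have := close s s0 (le_trans st t1); rewrite ler0_norm ?subr_le0// opprB => /(_ h1).
  have := close s' (le_trans t0 ts) s1; rewrite ger0_norm ?subr_ge0// => /(_ h2) k2.
  rewrite enormB => k1.
  have -> : C * ((s' - s) * enorm (z' - z)) =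
      C * ((s' - t) * enorm (z' - z)) + C * ((t - s) * enorm (z' - z)) by ring.
  apply: le_trans (enorm_triangle (h (y t)) _ _) _; exact: lerD.
rewrite /P /y scale1r scale0r addr0 subr0 mul1r.
by rewrite [z + _]addrC subrK.
Qed.

Section cV_topology.
Variable R : realType.

(** Transposition is an isometry onto the space of rows, in which closed and
    bounded sets are compact. *)
Lemma closed_bounded_compact (q : nat) (A : set 'cV[R]_q) (M : R) :
  closed A -> (forall v, A v -> enorm v <= M) -> compact A.
Proof.
move=> Ac AM.
pose A' := [set v : 'rV[R]_q | A v^T].
have ct : continuous (fun v : 'rV[R]_q => v^T : 'cV[R]_q).
  move=> v B /nbhs_ballP[e /= e0 eB]; apply/nbhs_ballP; exists e => // w [_ vw].
  by apply: eB; split => // i j; rewrite !mxE.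
have A'c : compact A'.
  apply: bounded_closed_compact.
    exists M; split; first exact: num_real.
    move=> M' MM' v A'v; apply: le_trans (ltW MM').
    apply: le_trans (AM _ A'v); apply: le_trans (norm_le_enorm _).
    rewrite [leLHS]/Num.norm/= mx_normrE; apply/bigmax_leP; split => // -[i j] _ /=.
    by have := coord_le_norm v^T j; rewrite mxE (ord1 i).
  by apply: preimage_closed => // v _; exact: ct.
have -> : A = (fun v : 'rV[R]_q => v^T : 'cV[R]_q) @` A'.
  apply/seteqP; split => [v Av|_ [v A'v <-]//].
  by exists v^T; rewrite /A'/= trmxK.
by apply: continuous_compact A'c; exact: continuous_subspaceT.
Qed.

Lemma lipschitz_continuous (q q' : nat) (h : 'cV[R]_q -> 'cV[R]_q') (C : R) :
  (forall v w, enorm (h v - h w) <= C * enorm (v - w)) -> continuous h.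
Proof.
move=> hC v A /enorm_nbhsP[e e0 eA]; change (nbhs v (h @^-1` A)); apply/enorm_nbhsP.
have C0 : 0 < `|C| + 1 by rewrite ltr_wpDl.
exists (e / (`|C| + 1)); first by rewrite divr_gt0.
move=> w; rewrite ltr_pdivlMr// => wv; apply: eA; apply: le_lt_trans (hC _ _) _.
apply: le_lt_trans wv; rewrite mulrC; apply: ler_wpM2l; first exact: enorm_ge0.
by have := ler_norm C; lra.
Qed.

Lemma usubmx_continuous (n p : nat) : continuous (fun z : 'cV[R]_(n + p) => usubmx z).
Proof.
by apply: (@lipschitz_continuous _ _ _ 1) => v w; rewrite mul1r -linearB; exact: enorm_usubmx.
Qed.

Lemma dsubmx_continuous (n p : nat) : continuous (fun z : 'cV[R]_(n + p) => dsubmx z).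
Proof.
by apply: (@lipschitz_continuous _ _ _ 1) => v w; rewrite mul1r -linearB; exact: enorm_dsubmx.
Qed.

Lemma ball_closed (q : nat) (Rb : R) : closed [set x : 'cV[R]_q | enorm x <= Rb].
Proof.
have -> : [set x : 'cV[R]_q | enorm x <= Rb] = @enorm R q @^-1` [set y | y <= Rb] by [].
apply: preimage_closed; last exact: closed_le.
by move=> z _; exact: enorm_continuous.
Qed.

Lemma ball_compact (q : nat) (Rb : R) : compact [set x : 'cV[R]_q | enorm x <= Rb].
Proof. exact: closed_bounded_compact (@ball_closed q Rb) (fun _ h => h). Qed.

Lemma ball_segment (q : nat) (Rb : R) : segment_closed [set x : 'cV[R]_q | enorm x <= Rb].
Proof.
move=> x y t /= hx hy t0 t1.
have -> : x + t *: (y - x) = (1 - t) *: x + t *: y.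
  by apply/matrixP => i j; rewrite !mxE; ring.
have t1' : 0 <= 1 - t by rewrite subr_ge0.
apply: le_trans (enormD _ _) _; rewrite !enormZ !ger0_norm//.
have -> : Rb = (1 - t) * Rb + t * Rb by ring.
by apply: lerD; exact: ler_wpM2l.
Qed.

Definition ball_times (n p : nat) (Rb : R) (U : set 'cV[R]_p) : set 'cV[R]_(n + p) :=
  [set z | enorm (usubmx z) <= Rb /\ U (dsubmx z)].

Lemma ball_times_compact (n p : nat) (Rb : R) (U : set 'cV[R]_p) :
  compact U -> compact (@ball_times n p Rb U).
Proof.
move=> Uc; have [M M0 UM] := compact_enorm_bounded Uc.
apply: (@closed_bounded_compact _ _ (Rb + M)).
  have -> : @ball_times n p Rb U =
      (fun z => usubmx z) @^-1` [set x | enorm x <= Rb] `&` (fun z => dsubmx z) @^-1` U.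
    by apply/seteqP; split.
  apply: closedI; apply: preimage_closed.
  - by move=> z _; exact: usubmx_continuous.
  - exact: ball_closed.
  - by move=> z _; exact: dsubmx_continuous.
  - by apply: compact_closed Uc; exact: norm_hausdorff.
move=> z [zR /UM zM]; apply: le_trans (enorm_col_le z) _; exact: lerD.
Qed.

Lemma ball_times_segment (n p : nat) (Rb : R) (U : set 'cV[R]_p) :
  segment_closed U -> segment_closed (@ball_times n p Rb U).
Proof.
move=> Us z z' t [zR zU] [zR' zU'] t0 t1.
by split; rewrite linearD linearZ linearB; [exact: ball_segment|exact: Us].
Qed.

Section thickening.
Variables (p : nat) (U : set 'cV[R]_p).
Hypothesis Uc : compact U.
Hypothesis Us : segment_closed U.
Hypothesis U0 : U !=set0.

(** The closed neighbourhood of [U] of radius [eta]; it is again compact and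
    convex, and leaves room for the proportional term of the controller. *)
Definition thicken (eta : R) : set 'cV[R]_p := [set u | enorm (u - proj U u) <= eta].

Lemma thicken_near eta u v : U v -> enorm (u - v) <= eta -> thicken eta u.
Proof. by move=> Uv; apply: le_trans; exact: proj_le. Qed.

Lemma thicken_sub eta : 0 <= eta -> U `<=` thicken eta.
Proof. by move=> e0 u Uu; apply: (thicken_near Uu); rewrite subrr enorm0. Qed.

Lemma thicken_compact eta : compact (thicken eta).
Proof.
have [M M0 UM] := compact_enorm_bounded Uc.
apply: (@closed_bounded_compact _ _ (eta + M)).
  have -> : thicken eta = (fun u => enorm (u - proj U u)) @^-1` [set y | y <= eta] by [].
  apply: preimage_closed; last exact: closed_le.
  move=> u _ A /nbhs_ballP[e /= e0 eA].
  change (nbhs u ((fun u => enorm (u - proj U u)) @^-1` A)).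
  apply/enorm_nbhsP; exists e => // w wu; apply: eA; rewrite -ball_normE/=.
  apply: le_lt_trans wu; rewrite distrC. exact: (dist_lip Uc U0 u w).
move=> u; rewrite /thicken/= => h; rewrite -(subrK (proj U u) u).
apply: le_trans (enormD _ _) _; exact: (lerD h (UM _ (proj_in Uc U0 u))).
Qed.

Lemma thicken_segment eta : segment_closed (thicken eta).
Proof.
move=> u v t + + t0 t1; rewrite {1 2}/thicken/=.
have := proj_in Uc U0 v; have := proj_in Uc U0 u.
move: (proj U u) (proj U v) => a b Ua Ub hu hv.
apply: (thicken_near (Us Ua Ub t0 t1)).
have -> : u + t *: (v - u) - (a + t *: (b - a)) = (1 - t) *: (u - a) + t *: (v - b).
  by apply/matrixP => i j; rewrite !mxE; ring.
apply: le_trans (enormD _ _) _; rewrite !enormZ !ger0_norm ?subr_ge0//.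
have t1' : 0 <= 1 - t by lra.
have := ler_wpM2l t0 hv; have := ler_wpM2l t1' hu.
by move: (enorm _) (enorm _) => *; lra.
Qed.

(** Otherwise some points outside [A] would have projections on [U] that converge
    along an ultrafilter, and their limit in [U] would be a limit of points of
    the complement of [A]. *)
Lemma thicken_in_open (A : set 'cV[R]_p) : open A -> U `<=` A ->
  exists2 eta : R, 0 < eta & thicken eta `<=` A.
Proof.
move=> oA UA; apply: contrapT => h.
have /choice[v hv] : forall N : nat, exists v, thicken N.+1%:R^-1 v /\ ~ A v.
  move=> N; apply: contrapT => h'; apply: h; exists N.+1%:R^-1 => // v vN.
  by apply: contrapT => Av; apply: h'; exists v.
have [F [FF Foo]] := @ultraFilterLemma nat \oo _.
have Uc' := Uc; rewrite compact_ultra in Uc'.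
have [|u [Uu hu]] := Uc' ((proj U \o v) @ F) (ultra_fmap _ _).
  apply: (@filterS _ F _ setT) => //; last exact: filterT.
  by move=> N _ /=; exact: proj_in.
have /enorm_nbhsP[e e0 eA] : nbhs u A by apply: open_nbhs_nbhs; split => //; exact: UA.
have e20 : 0 < e / 2 by rewrite divr_gt0.
have h1 : \forall N \near F, enorm (proj U (v N) - u) < e / 2.
  exact: ((enorm_cvgP _ _ _).1 hu _ e20).
have h2 : \forall N \near F, N.+1%:R^-1 < e / 2.
  exact: Foo _ (near_infty_natSinv_lt (PosNum e20)).
have [N [N1 N2]] := filter_ex (filterI h1 h2).
have [vN Av] := hv N; apply: Av; apply: eA.
apply: le_lt_trans (enorm_triangle (proj U (v N)) _ _) _.
rewrite (splitr e); apply: ltrD => //; exact: le_lt_trans N2.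
Qed.

End thickening.

End cV_topology.

(** * Velocities of curves satisfying a variational inequality *)

Section velocity.
Variables (R : realType).

Lemma rderiv_step (a b t c e : R) (f : R -> R) : a < t -> t < b -> 0 < e ->
  rderiv a b f t c -> forall m : R, 0 < m -> exists h : R, [/\ 0 < h < m,
    a <= t - h, t + h <= b,
    `|f (t + h) - f t - h * c| <= e * h & `|f (t - h) - f t + h * c| <= e * h].
Proof.
move=> at_ tb e0 hf m m0; have [d d0 H] := hf _ e0.
set M := Num.min (Num.min (b - t) (t - a)) (Num.min d m).
have M0 : 0 < M by rewrite /M !min_gt0// subr_gt0.
exists (M / 2); have h0 : 0 < M / 2 by rewrite divr_gt0.
have hM : M / 2 < M by lra.
have h1 := lt_min_l (lt_min_l hM); have h2 := lt_min_r (lt_min_l hM).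
have h3 := lt_min_l (lt_min_r hM); have h4 := lt_min_r (lt_min_r hM).
move: (M / 2) h0 h1 h2 h3 h4 => h h0 h1 h2 h3 h4.
have k1 : a <= t - h by lra.
have k2 : t + h <= b by lra.
have k3 : a <= t + h by lra.
have k4 : t - h <= b by lra.
have e1 : t + h - t = h by ring.
have e2 : t - h - t = - h by ring.
split => //; first by rewrite h0.
  by have := H _ k3 k2; rewrite e1 (gtr0_norm h0) => /(_ h3).
by have := H _ k1 k4; rewrite e2 normrN (gtr0_norm h0) mulNr opprK => /(_ h3).
Qed.

Lemma rate_ge_deriv (a b t c c' : R) (f : R -> R) : a < t -> t < b ->
  rderiv a b f t c -> upper_rate a b f t c' -> c <= c'.
Proof.
move=> at_ tb hf hr; apply/ler_addgt0Pr => e e0.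
have e20 : 0 < e / 2 by rewrite divr_gt0.
have [d d0 H] := hr _ e20.
have [h [/andP[h0 hd] k1 k2]] := rderiv_step at_ tb e20 hf d0.
rewrite ler_norml => /andP[k3 _] _.
have := H t (t + h) (ltW at_) (lexx _) _ k2; rewrite subrr addrAC subrr add0r.
rewrite lerDl (ltW h0) => /(_ isT d0 hd) k4.
rewrite -(ler_pM2l h0); lra.
Qed.

Lemma deriv_at_max (a b t c : R) (f : R -> R) : a < t -> t < b ->
  rderiv a b f t c -> (forall s, a <= s -> s <= b -> f s <= f t) -> c = 0.
Proof.
move=> at_ tb hf fm.
have key e : 0 < e -> c <= e /\ - e <= c.
  move=> e0; have [h [/andP[h0 _] k1 k2]] := rderiv_step at_ tb e0 hf ltr01.
  rewrite !ler_norml => /andP[k3 _] /andP[k4 _].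
  have k5 : f (t + h) <= f t by apply: fm => //; lra.
  have k6 : f (t - h) <= f t by apply: fm => //; lra.
  by split; rewrite -(ler_pM2l h0); lra.
apply/eqP; rewrite eq_le; apply/andP; split; apply/ler_addgt0Pr => e /key[]; lra.
Qed.

Variables (q : nat) (X : set 'cV[R]_q) (z : R -> 'cV[R]_q) (a b t : R).
Variables (d f : 'cV[R]_q).
Hypothesis at_ : a < t.
Hypothesis tb : t < b.
Hypothesis zX : forall s, a <= s -> s <= b -> X (z s).
Hypothesis zd : vderiv a b z t d.
Hypothesis ztest : forall w, X w ->
  upper_rate a b (fun s => hsq (z s - w)) t (dot f (z t - w)).

(** The derivative [dot d (z t - w)] of [hsq (z s - w)] is at most its rate
    bound [dot f (z t - w)]. *)
Lemma velocity_normal w : X w -> dot (f - d) (w - z t) <= 0.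
Proof.
move=> Xw; have := rate_ge_deriv at_ tb (rderiv_hsq w zd) (ztest Xw).
by rewrite -[w - z t]opprB dotNr dotDl dotNl oppr_le0 subr_ge0.
Qed.

(** The curve stays in [X], so [dot n (z s - z t)] is maximal at the interior
    time [t] and its derivative vanishes. *)
Lemma velocity_tangent n : (forall w, X w -> dot n (w - z t) <= 0) -> dot n d = 0.
Proof.
move=> hn; apply: (deriv_at_max at_ tb (f := fun s => dot n (z s - z t))).
  move=> e e0.
  have n0 : 0 < enorm n + 1 by rewrite ltr_wpDl// enorm_ge0.
  have [r r0 H] := zd (divr_gt0 e0 n0); exists r => // s as_ sb st.
  rewrite (subrr (z t)) dot0r subr0 -dotZr -dotNr -dotDr.
  apply: le_trans (cauchy_schwarz_abs _ _) _.
  apply: le_trans (ler_wpM2l (enorm_ge0 n) (H s as_ sb st)) _.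
  rewrite mulrA; apply: ler_wpM2r => //.
  by rewrite mulrCA ler_piMr ?(ltW e0)// ler_pdivrMr// mul1r lerDl.
by move=> s as_ sb; rewrite subrr dot0r; apply/hn/zX.
Qed.

(** [f = d + (f - d)] with [d] tangent, [f - d] normal, and the two orthogonal. *)
Lemma velocity_Pi : compact X -> segment_closed X -> X !=set0 -> Pi X (z t) f = d.
Proof.
move=> Xc Xs X0; apply: Pi_eq => //.
- by apply: zX; exact: ltW.
- by move=> w; exact: velocity_normal.
- by apply: velocity_tangent => w; exact: velocity_normal.
- by move=> n hn; rewrite velocity_tangent.
Qed.

(** At an interior point the only normal vector is [0]. *)
Lemma velocity_interior : (forall e : 'cV[R]_q, exists2 r : R, 0 < r & X (z t + r *: e)) ->
  d = f.
Proof.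
move=> hint; apply/eqP; rewrite -subr_eq0 -oppr_eq0 opprB; apply/eqP/enorm_eq0/eqP.
rewrite -sqrf_eq0 enormE eq_le dot_ge0 andbT.
have [r r0 /velocity_normal] := hint (f - d).
by rewrite addrAC subrr add0r dotZr pmulr_rle0.
Qed.

End velocity.

Lemma interior_ball (R : realType) (q : nat) (Rb : R) (z e : 'cV[R]_q) :
  enorm z < Rb -> exists2 r : R, 0 < r & enorm (z + r *: e) <= Rb.
Proof.
move=> zR; have e0 : 0 < enorm e + 1 by rewrite ltr_wpDl// enorm_ge0.
have zR' : 0 < Rb - enorm z by rewrite subr_gt0.
exists ((Rb - enorm z) / (enorm e + 1)); first by rewrite divr_gt0.
apply: le_trans (enormD _ _) _; rewrite enormZ ger0_norm ?divr_ge0 ?(ltW e0) ?(ltW zR')//.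
have : (Rb - enorm z) / (enorm e + 1) * enorm e <= Rb - enorm z.
  by rewrite mulrAC ler_pdivrMr//; apply: ler_wpM2l; [exact: ltW|rewrite lerDl].
lra.
Qed.

(** A test point that shares one component with [z t] leaves, in that component,
    only the square of an increment, which is of second order for a Lipschitz
    curve. *)
Section split_test.
Variables (R : realType) (n p : nat) (a b t : R) (z : R -> 'cV[R]_(n + p)) (f : 'cV[R]_(n + p)).
Variable H : R.
Hypothesis zlip : forall s, enorm (z s - z t) <= H * `|s - t|.

Lemma rderiv_sq_lip (q : nat) (y : R -> 'cV[R]_q) :
  (forall s, enorm (y s - y t) <= H * `|s - t|) ->
  rderiv a b (fun s => - hsq (y s - y t)) t 0.
Proof.
move=> hy e e0; have H0 : 0 < `|H| + 1 by rewrite ltr_wpDl.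
exists (e / (`|H| + 1) ^+ 2); first by rewrite divr_gt0// exprn_gt0.
move=> s _ _; rewrite ltr_pdivlMr ?exprn_gt0// => st.
have h0 : hsq (y t - y t) = 0 by rewrite subrr /hsq dot0l mul0r.
rewrite h0 oppr0 mulr0 !subr0 normrN ger0_norm ?hsq_ge0// hsqE.
have h1 : enorm (y s - y t) <= (`|H| + 1) * `|s - t|.
  apply: le_trans (hy s) _; apply: ler_wpM2r => //.
  by have := ler_norm H; lra.
have h2 : enorm (y s - y t) ^+ 2 <= ((`|H| + 1) * `|s - t|) ^+ 2.
  by rewrite ler_pXn2r ?nnegrE ?enorm_ge0// (le_trans (enorm_ge0 _) h1).
rewrite exprMn in h2.
have := ler_wpM2r (normr_ge0 (s - t)) (ltW st).
have : 0 <= e * `|s - t| by rewrite mulr_ge0// ltW.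
move: h2; move: (enorm _ ^+ 2) ((`|H| + 1) ^+ 2) `|s - t| => *; lra.
Qed.

Lemma test_usubmx w :
  upper_rate a b (fun s => hsq (z s - col_mx w (dsubmx (z t)))) t
     (dot f (z t - col_mx w (dsubmx (z t)))) ->
  upper_rate a b (fun s => hsq (usubmx (z s) - w)) t (dot (usubmx f) (usubmx (z t) - w)).
Proof.
move=> h.
have hu s : enorm (dsubmx (z s) - dsubmx (z t)) <= H * `|s - t|.
  by rewrite -linearB; apply: le_trans (enorm_dsubmx _) _.
have := upper_rateD h (rderiv_rate (rderiv_sq_lip hu)).
rewrite addr0 dot_split !linearB/= col_mxKu col_mxKd subrr dot0r addr0.
apply: upper_rate_ext => s.
rewrite /hsq dot_split !linearB/= col_mxKu col_mxKd.
by rewrite mulrDl addrK.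
Qed.

Lemma test_dsubmx w :
  upper_rate a b (fun s => hsq (z s - col_mx (usubmx (z t)) w)) t
     (dot f (z t - col_mx (usubmx (z t)) w)) ->
  upper_rate a b (fun s => hsq (dsubmx (z s) - w)) t (dot (dsubmx f) (dsubmx (z t) - w)).
Proof.
move=> h.
have hu s : enorm (usubmx (z s) - usubmx (z t)) <= H * `|s - t|.
  by rewrite -linearB; apply: le_trans (enorm_usubmx _) _.
have := upper_rateD h (rderiv_rate (rderiv_sq_lip hu)).
rewrite addr0 dot_split !linearB/= col_mxKu col_mxKd subrr dot0r add0r.
apply: upper_rate_ext => s.
rewrite /hsq dot_split !linearB/= col_mxKu col_mxKd.
by rewrite mulrDl addrAC subrr add0r.
Qed.

End split_test.

Lemma evi_exists_lip (R : realType) (q : nat) (X : set 'cV[R]_q) (f : 'cV[R]_q -> 'cV[R]_q)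
    (z0 : 'cV[R]_q) (L : R) : compact X -> segment_closed X -> X z0 -> 0 <= L ->
  (forall u v, X u -> X v -> enorm (f u - f v) <= L * enorm (u - v)) ->
  exists (H : R) (z : R -> 'cV[R]_q),
  [/\ forall t, t <= 0 -> z t = z0, forall t, X (z t),
      forall s t, enorm (z t - z s) <= H * `|t - s|
    & forall b t w, 0 <= t -> X w ->
        upper_rate 0 b (fun s => hsq (z s - w)) t (dot (f (z t)) (z t - w))].
Proof.
move=> Xc Xs Xz0 L0 flip; have [M M0 XM] := compact_enorm_bounded Xc.
have diam u v : X u -> X v -> enorm (u - v) <= M + M.
  by move=> Xu Xv; apply: le_trans (enormD _ _) _; rewrite enormN lerD// XM.
exists (L * (M + M) + enorm (f z0)).
apply: (@evi_exists R q X f z0 L _ (M + M)) => //.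
- by rewrite addr_ge0 ?enorm_ge0// mulr_ge0// addr_ge0.
- move=> u Xu; rewrite -(subrK (f z0) (f u)); apply: le_trans (enormD _ _) _.
  rewrite lerD2r; apply: le_trans (flip _ _ Xu Xz0) _.
  by apply: ler_wpM2l => //; exact: diam.
- exact: addr_ge0.
Qed.

(** * Existence of closed-loop solutions *)

Lemma vderiv_unique (R : realType) (q : nat) (a b t : R) (z : R -> 'cV[R]_q) d d' :
  a < t -> t < b -> vderiv a b z t d -> vderiv a b z t d' -> d = d'.
Proof.
move=> at_ tb hd hd'; apply/eqP; rewrite -subr_eq0; apply/eqP/enorm_eq0/eqP.
rewrite -sqrf_eq0 enormE eq_le dot_ge0 andbT.
pose w := z t - (d - d').
have := rate_ge_deriv at_ tb (rderiv_hsq w hd) (rderiv_rate (rderiv_hsq w hd')).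
by rewrite /w subKr (dotDl d) dotNl subr_le0.
Qed.

Lemma vderiv_usubmx (R : realType) (n p : nat) (a b t : R) (z : R -> 'cV[R]_(n + p)) d :
  vderiv a b z t d -> vderiv a b (fun s => usubmx (z s)) t (usubmx d).
Proof.
move=> h e e0; have [r r0 H] := h e e0; exists r => // s as_ sb st.
by rewrite -linearZ -!linearB; apply: le_trans (enorm_usubmx _) (H s as_ sb st).
Qed.

Lemma vderiv_dsubmx (R : realType) (n p : nat) (a b t : R) (z : R -> 'cV[R]_(n + p)) d :
  vderiv a b z t d -> vderiv a b (fun s => dsubmx (z s)) t (dsubmx d).
Proof.
move=> h e e0; have [r r0 H] := h e e0; exists r => // s as_ sb st.
by rewrite -linearZ -!linearB; apply: le_trans (enorm_dsubmx _) (H s as_ sb st).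
Qed.

Lemma vderiv_ext (R : realType) (q : nat) (a b t : R) (z z' : R -> 'cV[R]_q) d :
  (forall s, a <= s -> s <= b -> z s = z' s) -> a <= t -> t <= b ->
  vderiv a b z t d -> vderiv a b z' t d.
Proof.
move=> zz at_ tb h e e0; have [r r0 H] := h e e0; exists r => // s as_ sb st.
by rewrite -!zz//; exact: H.
Qed.

Lemma lipschitz_vcont (R : realType) (q : nat) (a b t H : R) (z : R -> 'cV[R]_q) :
  (forall s, enorm (z s - z t) <= H * `|s - t|) -> vcont a b z t.
Proof.
move=> zl e e0; have H0 : 0 < `|H| + 1 by rewrite ltr_wpDl.
exists (e / (`|H| + 1)); first by rewrite divr_gt0.
move=> s _ _; rewrite ltr_pdivlMr// => st; apply: le_trans (zl s) _.
apply: le_trans (ltW st); rewrite mulrC; apply: ler_wpM2l => //.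
by have := ler_norm H; lra.
Qed.

Lemma lipschitz_ac (R : realType) (q : nat) (a b H : R) (z : R -> 'cV[R]_q) :
  (forall s t, enorm (z t - z s) <= H * `|t - s|) -> absolutely_continuous_on a b z.
Proof.
move=> zl e e0; have H0 : 0 < `|H| + 1 by rewrite ltr_wpDl.
exists (e / (`|H| + 1)); first by rewrite divr_gt0.
move=> N s t st _; rewrite ltr_pdivlMr// => len.
apply: le_lt_trans len; rewrite mulr_suml; apply: ler_sum => i _.
have [_ sti _] := st i.
apply: le_trans (zl _ _) _; rewrite ger0_norm ?subr_ge0// mulrC.
apply: ler_wpM2l; first by rewrite subr_ge0.
by have := ler_norm H; lra.
Qed.

Section system.
Variables (R : realType) (n p : nat).
Variables (F : 'cV[R]_n -> 'cV[R]_p -> 'cV[R]_n) (g : 'cV[R]_n -> 'cV[R]_p).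
Variables (U Ut calU : set 'cV[R]_p) (L tau Rb eta k : R) (r : 'cV[R]_p).

(** The closed-loop field, with the plant and the input map [N] merged into
    [F x u = f0 x (N u)]. *)
Definition cl_field (z : 'cV[R]_(n + p)) : 'cV[R]_(n + p) :=
  col_mx (F (usubmx z) (dsubmx z + (tau * k) *: (r - g (usubmx z))))
         (Pi U (dsubmx z) (k *: (r - g (usubmx z)))).

Hypothesis Uc : compact U.
Hypothesis Us : segment_closed U.
Hypothesis U0 : U !=set0.
Hypothesis L0 : 0 <= L.
Hypothesis tau0 : 0 <= tau.
Hypothesis eta0 : 0 < eta.
Hypothesis k0 : 0 < k.
Hypothesis Flip : forall x x' u u', enorm x <= Rb -> enorm x' <= Rb -> Ut u -> Ut u' ->
  enorm (F x u - F x' u') <= L * (enorm (x - x') + enorm (u - u')).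
Hypothesis glip : forall x x', enorm x <= Rb -> enorm x' <= Rb ->
  enorm (g x - g x') <= L * enorm (x - x').
Hypothesis UtI : forall x u, enorm x <= Rb -> thicken U eta u ->
  Ut (u + (tau * k) *: (r - g x)).
Hypothesis UtU : Ut `<=` calU.
Hypothesis U1U : thicken U eta `<=` calU.

Definition drift (z : 'cV[R]_(n + p)) := F (usubmx z) (dsubmx z + (tau * k) *: (r - g (usubmx z))).
Let K1 := @ball_times R n p Rb (thicken U eta).
Let K2 := @ball_times R n p Rb U.

Let UU1 : U `<=` thicken U eta.
Proof. by apply: thicken_sub => //; exact: ltW. Qed.

Lemma drift_lip z z' : @ball_times R n p Rb (thicken U eta) z ->
  @ball_times R n p Rb (thicken U eta) z' ->
  enorm (drift z - drift z') <= L * (2 + tau * k * L) * enorm (z - z').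
Proof.
move=> [zB zU] [zB' zU']; apply: le_trans (Flip zB zB' (UtI zB zU) (UtI zB' zU')) _.
rewrite -mulrA; apply: ler_wpM2l => //.
have h1 : enorm (usubmx z - usubmx z') <= enorm (z - z').
  by rewrite -linearB; exact: enorm_usubmx.
have h2 : enorm (dsubmx z - dsubmx z') <= enorm (z - z').
  by rewrite -linearB; exact: enorm_dsubmx.
have tk : 0 <= tau * k by rewrite mulr_ge0// ltW.
have h3 : tau * k * enorm (g (usubmx z') - g (usubmx z)) <= tau * k * (L * enorm (z - z')).
  apply: ler_wpM2l => //; apply: le_trans (glip zB' zB) _.
  by apply: ler_wpM2l => //; rewrite enormB.
have -> : dsubmx z + (tau * k) *: (r - g (usubmx z)) - (dsubmx z' + (tau * k) *: (r - g (usubmx z')))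
   = (dsubmx z - dsubmx z') + (tau * k) *: (g (usubmx z') - g (usubmx z)).
  by apply/matrixP => i j; rewrite !mxE; ring.
have := enormD (dsubmx z - dsubmx z') ((tau * k) *: (g (usubmx z') - g (usubmx z))).
rewrite enormZ (ger0_norm tk) => h4.
apply: le_trans (lerD h1 (le_trans h4 (lerD h2 h3))) _.
by move: (enorm (z - z')) => y; lra.
Qed.

Let drift_const : 0 <= L * (2 + tau * k * L).
Proof. by rewrite mulr_ge0// addr_ge0// !mulr_ge0// ltW. Qed.

Variables (x0 : 'cV[R]_n) (u0 : 'cV[R]_p).
Hypothesis x0B : enorm x0 <= Rb.
Hypothesis u0U : thicken U eta u0.

Let p0 := proj U u0.
Let d0 := enorm (u0 - p0).
Let nu := d0^-1 *: (u0 - p0).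
Let u1 (t : R) := u0 - t *: nu.

Let d00 : 0 <= d0. Proof. exact: enorm_ge0. Qed.
Let p0U : U p0. Proof. exact: proj_in. Qed.

Let d0nu : d0 *: nu = u0 - p0.
Proof.
rewrite /nu scalerA; have [e|e] := eqVneq d0 0; last by rewrite divff// scale1r.
by rewrite e mul0r scale0r (enorm_eq0 e).
Qed.

Let u1E t : u1 t - p0 = (d0 - t) *: nu.
Proof. by rewrite scalerBl d0nu /u1 addrAC. Qed.

Let nu1 : 0 < d0 -> enorm nu = 1.
Proof. by move=> e; rewrite /nu enormZ ger0_norm ?invr_ge0// mulVf// gt_eqF. Qed.

(** Points on the segment from [u0] to its projection keep that projection. *)
Let u1_proj t : t <= d0 -> proj U (u1 t) = p0.
Proof.
move=> td; apply: proj_unique => // w Uw; rewrite u1E dotZl.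
apply: mulr_ge0_le0; first by rewrite subr_ge0.
rewrite /nu dotZl; apply: mulr_ge0_le0; first by rewrite invr_ge0.
exact: proj_obtuse.
Qed.

Let u1_dist t : 0 <= t -> t <= d0 -> enorm (u1 t - p0) <= d0.
Proof.
move=> t0 td; rewrite u1E enormZ ger0_norm ?subr_ge0//.
have [e|e] := eqVneq d0 0.
  have -> : t = 0 by apply/eqP; rewrite eq_le t0 -e td.
  by rewrite e subrr mul0r.
rewrite nu1 ?mulr1; first by rewrite gerBl.
by rewrite lt_neqAle eq_sym e.
Qed.

Let u1U t : 0 <= t -> t <= d0 -> thicken U eta (u1 t).
Proof.
move=> t0 td; rewrite /thicken/= u1_proj//; apply: le_trans (u1_dist t0 td) _.
exact: u0U.
Qed.

Let u1_Pi t v : 0 <= t -> t < d0 -> Pi U (u1 t) v = - nu.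
Proof.
move=> t0 td; have dt : 0 < d0 - t by rewrite subr_gt0.
have d0_gt : 0 < d0 by exact: le_lt_trans td.
have pE : proj U (u1 t) - u1 t = - ((d0 - t) *: nu) by rewrite u1_proj ?(ltW td)// -u1E [RHS]opprB.
rewrite /Pi; case: asboolP => [Ut1|_].
  exfalso; have := nu1 d0_gt.
  have := u1E t; rewrite -(u1_proj (ltW td)) proj_id// subrr => /esym/eqP.
  rewrite scaler_eq0 gt_eqF//= => /eqP ->.
  by rewrite enorm0 => /eqP; rewrite eq_sym oner_eq0.
rewrite pE enormN enormZ (gtr0_norm dt) nu1// mulr1 scalerN scalerA mulVf ?scale1r//.
by rewrite gt_eqF.
Qed.

Let u1_vderiv a b t : vderiv a b u1 t (- nu).
Proof.
move=> e e0; exists 1 => // s _ _ _.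
have -> : u1 s - u1 t - (s - t) *: - nu = 0.
  by rewrite /u1; apply/matrixP => i j; rewrite !mxE; ring.
by rewrite enorm0 mulr_ge0// ltW.
Qed.

(** While the integrator state is outside [U], its equation is that of the
    constant velocity [- nu], so the field is Lipschitz on the ball times the
    thickened set. The solution of the variational inequality follows the
    segment [u1], as the moving test along [u1] shows. *)
Let phase1 : exists (H : R) (z1 : R -> 'cV[R]_(n + p)),
  [/\ z1 0 = col_mx x0 u0,
      forall s t, enorm (z1 t - z1 s) <= H * `|t - s|,
      forall t, K1 (z1 t),
      forall t, 0 <= t -> t <= d0 -> dsubmx (z1 t) = u1 t
    & forall b t w, 0 <= t -> enorm w <= Rb ->
        upper_rate 0 b (fun s => hsq (usubmx (z1 s) - w)) t
          (dot (drift (z1 t)) (usubmx (z1 t) - w))].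
Proof.
have K1c : compact K1 by apply: ball_times_compact; exact: thicken_compact.
have K1s : segment_closed K1 by apply: ball_times_segment; exact: thicken_segment.
have K10 : K1 (col_mx x0 u0) by split; rewrite ?col_mxKu ?col_mxKd.
pose f1 (z : 'cV[R]_(n + p)) := col_mx (drift z) (- nu).
have f1lip z z' : K1 z -> K1 z' -> enorm (f1 z - f1 z') <= L * (2 + tau * k * L) * enorm (z - z').
  move=> Kz Kz'; apply: le_trans (drift_lip Kz Kz').
  rewrite -(ler_pXn2r (n:=2))// ?nnegrE ?enorm_ge0// enorm_split /f1 !linearB/=.
  by rewrite !col_mxKu !col_mxKd subrr enorm0 expr0n/= addr0.
have [H [z1 [z10 z1K z1l z1t]]] := evi_exists_lip K1c K1s K10 drift_const f1lip.
have z1u b t w : 0 <= t -> enorm w <= Rb ->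
    upper_rate 0 b (fun s => hsq (usubmx (z1 s) - w)) t (dot (drift (z1 t)) (usubmx (z1 t) - w)).
  move=> t0 wB.
  have Kw : K1 (col_mx w (dsubmx (z1 t))).
    by split; [rewrite col_mxKu|rewrite col_mxKd; exact: (z1K t).2].
  have := test_usubmx (fun s => z1l t s) (z1t b t _ t0 Kw).
  by rewrite {1}/f1 col_mxKu.
have z1d b t w : 0 <= t -> thicken U eta w ->
    upper_rate 0 b (fun s => hsq (dsubmx (z1 s) - w)) t (dot (- nu) (dsubmx (z1 t) - w)).
  move=> t0 wU.
  have Kw : K1 (col_mx (usubmx (z1 t)) w).
    by split; [rewrite col_mxKu; exact: (z1K t).1|rewrite col_mxKd].
  have := test_dsubmx (fun s => z1l t s) (z1t b t _ t0 Kw).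
  by rewrite {1}/f1 col_mxKd.
exists H, z1; split; [exact: z10 (lexx 0)|exact: z1l|exact: z1K| |exact: z1u].
move=> t t0 td.
have cz s : vcont 0 t (fun s => dsubmx (z1 s)) s.
  apply: (@lipschitz_vcont _ _ _ _ _ H) => s'.
  by rewrite -linearB; apply: le_trans (enorm_dsubmx _) _.
have hs s : 0 <= s -> s <= t -> upper_rate 0 t (fun s => hsq (dsubmx (z1 s) - u1 s)) s 0.
  move=> s0 st.
  have := moving_test (cz s) (@u1_vderiv 0 t s) (z1d t s _ s0 (u1U s0 (le_trans st td))).
  by rewrite subrr dot0l.
have := le_rate t0 hs; rewrite mul0r subr_le0.
have h0 : hsq (dsubmx (z1 0) - u1 0) = 0.
  by rewrite (z10 0 (lexx 0)) col_mxKd /u1 scale0r subr0 subrr /hsq dot0l mul0r.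
rewrite h0 => h.
apply/eqP; rewrite -subr_eq0; apply/eqP/enorm_eq0/eqP.
rewrite -sqrf_eq0 eq_le sqr_ge0 andbT.
by move: h; rewrite hsqE ler_pdivrMr// mul0r.
Qed.

Let K2K1 z : K2 z -> K1 z.
Proof. by move=> [h1 /UU1]. Qed.

Let h2 (z : 'cV[R]_(n + p)) := k *: (r - g (usubmx z)).

(** From the projection [p0] on, the integrator state is confined to [U] by the
    test set itself. *)
Let phase2 (y0 : 'cV[R]_n) : enorm y0 <= Rb -> exists (H : R) (z2 : R -> 'cV[R]_(n + p)),
  [/\ z2 0 = col_mx y0 p0,
      forall s t, enorm (z2 t - z2 s) <= H * `|t - s|,
      forall t, K2 (z2 t),
      forall b t w, 0 <= t -> enorm w <= Rb ->
        upper_rate 0 b (fun s => hsq (usubmx (z2 s) - w)) t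
          (dot (drift (z2 t)) (usubmx (z2 t) - w))
    & forall b t w, 0 <= t -> U w ->
        upper_rate 0 b (fun s => hsq (dsubmx (z2 s) - w)) t
          (dot (h2 (z2 t)) (dsubmx (z2 t) - w))].
Proof.
move=> y0B.
have K2c : compact K2 by exact: ball_times_compact.
have K2s : segment_closed K2 by exact: ball_times_segment.
have K20 : K2 (col_mx y0 p0) by split; rewrite ?col_mxKu ?col_mxKd.
pose f2 (z : 'cV[R]_(n + p)) := col_mx (drift z) (h2 z).
have f2lip z z' : K2 z -> K2 z' ->
    enorm (f2 z - f2 z') <= (L * (2 + tau * k * L) + k * L) * enorm (z - z').
  move=> Kz Kz'; apply: le_trans (enorm_col_le _) _.
  rewrite /f2 !linearB/= !col_mxKu !col_mxKd mulrDl; apply: lerD.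
    by apply: drift_lip; exact: K2K1.
  rewrite /h2 -scalerBr enormZ (gtr0_norm k0) -mulrA; apply: ler_wpM2l; first exact: ltW.
  have -> : r - g (usubmx z) - (r - g (usubmx z')) = g (usubmx z') - g (usubmx z).
    by apply/matrixP => i j; rewrite !mxE; ring.
  apply: le_trans (glip Kz'.1 Kz.1) _; apply: ler_wpM2l => //.
  by rewrite enormB -linearB; exact: enorm_usubmx.
have Lf0 : 0 <= L * (2 + tau * k * L) + k * L.
  by rewrite addr_ge0// mulr_ge0// ltW.
have [H [z2 [z20 z2K z2l z2t]]] := evi_exists_lip K2c K2s K20 Lf0 f2lip.
exists H, z2; split; [exact: z20 (lexx 0)|exact: z2l|exact: z2K| |].
  move=> b t w t0 wB.
  have Kw : K2 (col_mx w (dsubmx (z2 t))).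
    by split; [rewrite col_mxKu|rewrite col_mxKd; exact: (z2K t).2].
  have := test_usubmx (fun s => z2l t s) (z2t b t _ t0 Kw).
  by rewrite {1}/f2 col_mxKu.
move=> b t w t0 wU.
have Kw : K2 (col_mx (usubmx (z2 t)) w).
  by split; [rewrite col_mxKu; exact: (z2K t).1|rewrite col_mxKd].
have := test_dsubmx (fun s => z2l t s) (z2t b t _ t0 Kw).
by rewrite {1}/f2 col_mxKd.
Qed.

Let D := [set z : 'cV[R]_(n + p) | calU (dsubmx z) /\
           calU (dsubmx z + (tau * k) *: (r - g (usubmx z)))].

Let KD z : K1 z -> D z.
Proof. by move=> [zB zU]; split; [exact: U1U|exact/UtU/UtI]. Qed.

Let ball := [set x : 'cV[R]_n | enorm x <= Rb].

Let interior_x (a b t : R) (x : R -> 'cV[R]_n) d f : a < t -> t < b ->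
  enorm (x t) < Rb -> vderiv a b x t d ->
  (forall w, enorm w <= Rb -> upper_rate a b (fun s => hsq (x s - w)) t (dot f (x t - w))) ->
  d = f.
Proof.
move=> at_ tb xR xd xt.
by apply: (velocity_interior (X := ball) at_ tb xd xt) => e; exact: interior_ball.
Qed.

(** The integrator state first moves on a straight line, at unit speed, to
    its projection on [U], which it reaches at time [d0]; afterwards it stays
    in [U]. The concatenation is Lipschitz, so its velocity is identified at
    almost every time; this needs the plant state in the interior of the ball,
    which estimates based on the inequalities listed here will supply. *)
Lemma solution_exists : exists (x1 x2 : R -> 'cV[R]_n) (u1 u2 : R -> 'cV[R]_p),
  [/\ [/\ x1 0 = x0, forall t, enorm (x1 t) <= Rb & forall b t, vcont 0 b x1 t],
      [/\ u1 0 = u0, forall t, 0 <= t -> t <= d0 -> thicken U eta (u1 t),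
          forall b t, vcont 0 b u1 t
        & forall b t w, 0 <= t -> t <= d0 -> U w ->
            upper_rate 0 b (fun s => hsq (u1 s - w)) t 0],
      forall b t w, 0 <= t -> t <= d0 -> enorm w <= Rb ->
        upper_rate 0 b (fun s => hsq (x1 s - w)) t
          (dot (F (x1 t) (u1 t + (tau * k) *: (r - g (x1 t)))) (x1 t - w)),
      [/\ x2 0 = x1 d0, u2 0 = u1 d0, U (u2 0)
        & forall b, 0 <= b -> cl_evi F g U tau Rb k r 0 b x2 u2]
    & (forall t, 0 <= t -> t <= d0 -> enorm (x1 t) < Rb) ->
      (forall t, 0 <= t -> enorm (x2 t) < Rb) ->
      exists z, is_solution D cl_field (col_mx x0 u0) z].
Proof.
have [H1 [z1 [z10 z1l z1K z1u z1t]]] := phase1.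
have y0B : enorm (usubmx (z1 d0)) <= Rb by exact: (z1K d0).1.
have [H2 [z2 [z20 z2l z2K z2t z2u]]] := phase2 y0B.
have z12 : z1 d0 = z2 0.
  by rewrite z20 -[LHS]vsubmxK z1u// /u1 d0nu subKr.
have z1ul s t : enorm (usubmx (z1 t) - usubmx (z1 s)) <= H1 * `|t - s|.
  by rewrite -linearB; apply: le_trans (enorm_usubmx _) _.
have z2ul s t : enorm (usubmx (z2 t) - usubmx (z2 s)) <= H2 * `|t - s|.
  by rewrite -linearB; apply: le_trans (enorm_usubmx _) _.
have z2dl s t : enorm (dsubmx (z2 t) - dsubmx (z2 s)) <= H2 * `|t - s|.
  by rewrite -linearB; apply: le_trans (enorm_dsubmx _) _.
exists (fun t => usubmx (z1 t)), (fun t => usubmx (z2 t)), u1, (fun t => dsubmx (z2 t)); split.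
- split; [by rewrite z10 col_mxKu|by move=> t; exact: (z1K t).1|].
  by move=> b t; apply: (@lipschitz_vcont _ _ _ _ _ H1) => s; exact: z1ul.
- split; [by rewrite /u1 scale0r subr0|exact: u1U| |].
    by move=> b t; apply: vderiv_vcont (@u1_vderiv 0 b t).
  move=> b t w t0 td wU.
  apply: upper_rate_le (rderiv_rate (rderiv_hsq w (@u1_vderiv 0 b t))).
  have -> : u1 t - w = (d0 - t) *: nu + (p0 - w) by rewrite -u1E addrA subrK.
  rewrite dotNl oppr_le0 dotDr dotZr; apply: addr_ge0.
    by rewrite mulr_ge0 ?dot_ge0// subr_ge0.
  rewrite /nu dotZl mulr_ge0 ?invr_ge0// -[p0 - w]opprB dotNr oppr_ge0.
  exact: proj_obtuse.
- by move=> b t w t0 td wB; have := z1t b t w t0 wB; rewrite /drift z1u.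
- split; [by rewrite -z12|by rewrite z20 col_mxKd /u1 d0nu subKr|by rewrite z20 col_mxKd|].
  move=> b b0; split => [t _ _|t _ _|t w t0 _|t w t0 _]; first exact: z2K.
  + by split; apply: (@lipschitz_vcont _ _ _ _ _ H2) => s; [exact: z2ul|exact: z2dl].
  + exact: z2t.
  + exact: z2u.
move=> in1 in2.
pose z t := if t <= d0 then z1 t else z2 (t - d0).
have zE t : d0 <= t -> z t = z2 (t - d0).
  rewrite /z; case: (leP t d0) => // h1 h2'.
  have -> : t = d0 by apply/eqP; rewrite eq_le h1.
  by rewrite subrr.
have zE1 t : t <= d0 -> z t = z1 t by rewrite /z => ->.
have H10 : 0 <= H1.
  by have := z1l 0 1; rewrite subr0 normr1 mulr1; exact/le_trans/enorm_ge0.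
have H20 : 0 <= H2.
  by have := z2l 0 1; rewrite subr0 normr1 mulr1; exact/le_trans/enorm_ge0.
have zl s t : enorm (z t - z s) <= (H1 + H2) * `|t - s|.
  wlog st : s t / s <= t.
    by move=> w; have [/w//|/ltW/w] := leP s t; rewrite enormB distrC.
  have [td|dt] := leP t d0.
    rewrite (zE1 t td) (zE1 s (le_trans st td)); apply: le_trans (z1l _ _) _.
    by apply: ler_wpM2r; rewrite ?lerDl.
  have [sd|ds] := leP s d0; last first.
    rewrite (zE t (ltW dt)) (zE s (ltW ds)); apply: le_trans (z2l _ _) _.
    have -> : t - d0 - (s - d0) = t - s by ring.
    by apply: ler_wpM2r; rewrite ?lerDr.
  rewrite (zE t (ltW dt)) (zE1 s sd).
  apply: le_trans (enorm_triangle (z1 d0) _ _) _; rewrite {1}z12.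
  have k1 := z2l 0 (t - d0); have k2 := z1l s d0.
  have sd' : 0 <= d0 - s by rewrite subr_ge0.
  have td' : 0 <= t - d0 by rewrite subr_ge0 ltW.
  rewrite subr0 (ger0_norm td') in k1; rewrite (ger0_norm sd') in k2.
  rewrite ger0_norm; last by rewrite subr_ge0.
  apply: le_trans (lerD k1 k2) _.
  have -> : (H1 + H2) * (t - s) = H2 * (t - d0) + H1 * (d0 - s) + (H1 * (t - d0) + H2 * (d0 - s)).
    by ring.
  by rewrite lerDl addr_ge0// mulr_ge0.
exists z; split.
- by rewrite zE1.
- move=> t t0; apply: KD; rewrite /z; case: leP => _; first exact: z1K.
  exact/K2K1/z2K.
- by move=> b _; apply: lipschitz_ac zl.
have [E nE hE] := lipschitz_ae_vderiv zl.
have nE' : (@lebesgue_measure R).-negligible (E `|` [set d0]).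
  apply: negligibleU => //; apply/negligibleP; first exact: measurable_set1.
  exact: lebesgue_measure_set1.
apply: negligibleS nE' => t; rewrite /= => ht; apply: contrapT => hn; apply: ht => t0.
have tE : ~ E t by move=> Et; apply: hn; left.
have td : t <> d0 by move=> e; apply: hn; right.
have [d zd] := hE t tE.
apply/is_deriveP; suff <- : d = cl_field (z t) by [].
rewrite -[LHS]vsubmxK /cl_field; move/eqP: td; rewrite neq_lt => /orP[td|dt].
  have zd1 : vderiv 0 d0 z1 t d.
    apply: (@vderiv_ext _ _ _ _ _ z); [by move=> s _ /zE1|exact: ltW|exact: ltW|].
    exact: vderivTW.
  rewrite (zE1 t (ltW td)); congr col_mx.
    apply: (interior_x t0 td _ (vderiv_usubmx zd1)); first by apply: in1; exact: ltW.
    by move=> w wB; exact: z1t (ltW t0) wB.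
  rewrite (z1u t (ltW t0) (ltW td)) u1_Pi ?(ltW t0)//.
  apply: (vderiv_unique t0 td (vderiv_dsubmx zd1)).
  apply: (@vderiv_ext _ _ _ _ _ u1); [|exact: ltW|exact: ltW|exact: u1_vderiv].
  by move=> s s0 sd; rewrite z1u.
have td0 : 0 < t - d0 by rewrite subr_gt0.
have tb : t - d0 < t - d0 + 1 by rewrite ltrDl.
have zd2 : vderiv 0 (t - d0 + 1) z2 (t - d0) d.
  move=> e e0; have [r' r0' Hr] := zd e e0; exists r' => // s s0 _ hs.
  have -> : z2 s = z (s + d0) by rewrite zE ?lerDr// addrK.
  have -> : z2 (t - d0) = z t by rewrite zE ?ltW.
  have es : s - (t - d0) = s + d0 - t by ring.
  by rewrite es in hs *; exact: Hr.
rewrite (zE t (ltW dt)); congr col_mx.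
  apply: (interior_x td0 tb _ (vderiv_usubmx zd2)); first by apply: in2; exact: ltW.
  by move=> w wB; exact: z2t (ltW td0) wB.
apply/esym/(velocity_Pi td0 tb _ (vderiv_dsubmx zd2)) => //.
  by move=> s _ _; exact: (z2K s).2.
by move=> w wU; exact: z2u (ltW td0) wU.
Qed.

End system.

(** * Rate of change of the distance to a convex set *)

Lemma vcont_bounded (R : realType) (q : nat) (a b : R) (z : R -> 'cV[R]_q) : a <= b ->
  (forall t, a <= t -> t <= b -> vcont a b z t) ->
  exists2 M : R, 0 <= M & forall t, a <= t -> t <= b -> enorm (z t) <= M.
Proof.
move=> ab cz.
pose P s s' := exists2 M : R, 0 <= M & forall t, s <= t -> t <= s' -> enorm (z t) <= M.
apply: (@cousin R a b P ab) => [s t u _ _ _ _ [M M0 hM] [N N0 hN]|t at_ tb].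
  exists (M + N); first exact: addr_ge0.
  move=> v sv vu; have [vt|/ltW tv] := leP v t.
    by apply: le_trans (hM v sv vt) _; rewrite lerDl.
  by apply: le_trans (hN v tv vu) _; rewrite lerDr.
have [d d0 hd] := cz t at_ tb 1 ltr01.
exists d => // s s' as_ st ts sb h1 h2; exists (enorm (z t) + 1); first by rewrite addr_ge0// enorm_ge0.
move=> v sv vs; rewrite -(subrK (z t) (z v)); apply: le_trans (enormD _ _) _.
rewrite addrC lerD2l; apply: hd; first lra.
  exact: le_trans vs sb.
by rewrite ltr_norml; apply/andP; split; lra.
Qed.

Lemma rderiv_dot (R : realType) (q : nat) (a b t : R) (z : R -> 'cV[R]_q) d (w y : 'cV[R]_q) :
  vderiv a b z t d -> rderiv a b (fun s => dot w (z s - y)) t (dot w d).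
Proof.
move=> zd e e0; have n0 : 0 < enorm w + 1 by rewrite ltr_wpDl// enorm_ge0.
have [r r0 H] := zd _ (divr_gt0 e0 n0); exists r => // s as_ sb st.
have -> : dot w (z s - y) - dot w (z t - y) - (s - t) * dot w d
    = dot w (z s - z t - (s - t) *: d).
  by rewrite -dotZr -!dotNr -!dotDr; congr dot; apply/matrixP => i j; rewrite !mxE; ring.
apply: le_trans (cauchy_schwarz_abs _ _) _.
apply: le_trans (ler_wpM2l (enorm_ge0 w) (H s as_ sb st)) _.
rewrite mulrA; apply: ler_wpM2r => //.
by rewrite mulrCA ler_piMr ?(ltW e0)// ler_pdivrMr// mul1r lerDl.
Qed.

Lemma straddle_arith (R : realType) (S' S Q C D c e h h' : R) :
  S' <= Q -> C + D <= S -> `|Q - C - h' * c| <= e * h' -> `|D + h * c| <= e * h ->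
  S' - S <= (c + e) * (h' + h).
Proof. by rewrite !ler_norml => k1 k2 /andP[_ k3] /andP[k4 _]; lra. Qed.

(** Passes from the rate [- A] of [S ^+ 2 / 2], at a point where [S] is close to
    [A], to the rate [- 1] of [S]. *)
Lemma sqrt_rate_arith (R : realType) (S S' A l e : R) : 0 < A -> 0 <= S -> 0 <= S' ->
  0 <= l -> 0 < e -> e <= 1 -> S <= A + e * A / 2 -> S' <= A + e * A / 2 ->
  S' ^+ 2 / 2 - S ^+ 2 / 2 <= (- A + e * A / 2) * l -> S' - S <= (- 1 + e) * l.
Proof.
move=> A0 S0 S'0 l0 e0 e1 c1 c2 hs; rewrite leNgt; apply/negP => hn.
have sq : (S' - S) * (S' + S) <= - (2 * (1 - e / 2) * A) * l by lra.
have m1 : S' + S <= 2 * (1 + e / 2) * A by lra.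
have e10 : 0 <= 1 - e by lra.
have e20 : 0 < 1 - e / 2 by lra.
have [m_0|m_0] := eqVneq (S' + S) 0.
  have S'E : S' = 0 by lra.
  have SE : S = 0 by lra.
  have lp : 0 < l.
    rewrite lt_neqAle l0 andbT eq_sym; apply/eqP => lE.
    by move: hn; rewrite S'E SE lE subrr mulr0 ltxx.
  have := mulr_gt0 (mulr_gt0 e20 A0) lp; move: sq; rewrite S'E SE; lra.
have m0 : 0 < S' + S by rewrite lt_neqAle eq_sym m_0 addr_ge0.
have hn' : (- 1 + e) * l * (S' + S) < (S' - S) * (S' + S) by rewrite ltr_pM2r.
have q1 : (1 - e) * l * (S' + S) <= (1 - e) * l * (2 * (1 + e / 2) * A).
  by apply: ler_wpM2l => //; rewrite mulr_ge0.
have q2 : 0 <= e ^+ 2 * A * l by rewrite !mulr_ge0 ?sqr_ge0// ltW.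
lra.
Qed.

Section distance.
Variables (R : realType) (p : nat) (U : set 'cV[R]_p).
Hypothesis Uc : compact U.
Hypothesis Us : segment_closed U.
Hypothesis U0 : U !=set0.
Variables (a b t : R) (u : R -> 'cV[R]_p) (d : 'cV[R]_p).
Hypothesis at_ : a <= t.
Hypothesis tb : t <= b.
Hypothesis ud : vderiv a b u t d.

(** To the right of [t] the squared distance is bounded above by that to the
    fixed point [proj U (u t)], and to the left it is bounded below by its
    tangent; both have the same derivative at [t]. *)
Lemma dist_hsq_rate :
  upper_rate a b (fun s => hsq (u s - proj U (u s))) t (dot (u t - proj U (u t)) d).
Proof.
move=> e e0.
have [r1 r10 H1] := rderiv_hsq (proj U (u t)) ud e0.
have [r2 r20 H2] := rderiv_dot (u t - proj U (u t)) (u t) ud e0.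
exists (Num.min r1 r2); first exact: min_gt0.
move=> s s' as_ st ts sb h1 h2.
have st0 : 0 <= t - s by rewrite subr_ge0.
have ts0 : 0 <= s' - t by rewrite subr_ge0.
have := H1 s' (le_trans at_ ts) sb; rewrite (ger0_norm ts0) => /(_ (lt_min_l h2)) k1.
have := H2 s as_ (le_trans st tb).
have -> : `|s - t| = t - s by rewrite distrC ger0_norm.
move=> /(_ (lt_min_r h1)); rewrite (subrr (u t)) dot0r subr0 (dotC _ d).
rewrite -[s - t]opprB mulNr opprK => k2.
have -> : s' - s = (s' - t) + (t - s) by rewrite addrA subrK.
exact: (straddle_arith (dist_hsq_upper Uc U0 (u t) (u s')) (dist_hsq_lower Uc Us U0 (u t) (u s)) k1 k2).
Qed.

(** The unit velocity [d] is opposite to the gradient of the distance, so half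
    the squared distance changes at minus the distance; dividing by the
    distance gives the rate [- 1]. *)
Lemma dist_rate : ~ U (u t) ->
  d = (enorm (proj U (u t) - u t))^-1 *: (proj U (u t) - u t) ->
  upper_rate a b (fun s => enorm (u s - proj U (u s))) t (- 1).
Proof.
move=> Unt dE.
pose psi s := enorm (u s - proj U (u s)).
have psi0 : 0 < psi t.
  rewrite lt_neqAle enorm_ge0 andbT eq_sym; apply/eqP => /enorm_eq0/eqP.
  rewrite subr_eq0 => /eqP h; apply: Unt; rewrite h; exact: proj_in.
have cE : dot (u t - proj U (u t)) d = - psi t.
  rewrite dE dotZr enormB -[X in dot _ X]opprB dotNr -enormE -/(psi t) mulrN expr2.
  by rewrite mulKf// gt_eqF.
have h := dist_hsq_rate; rewrite cE in h.
move=> e0 e00; pose e := Num.min e0 1.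
have e_0 : 0 < e by rewrite min_gt0.
have e_1 : e <= 1 by rewrite ge_min lexx orbT.
have e_e0 : e <= e0 by rewrite ge_min lexx.
have e1 : 0 < e * psi t / 2 by rewrite divr_gt0// mulr_gt0.
have [r1 r10 H1] := h _ e1.
have [r2 r20 H2] := vderiv_vcont ud e1.
exists (Num.min r1 r2); first exact: min_gt0.
move=> s s' as_ st ts sb k1 k2.
have close v : a <= v -> v <= b -> `|v - t| < r2 -> psi v <= psi t + e * psi t / 2.
  move=> av vb vt; have := le_trans (dist_lip Uc U0 (u t) (u v)) (H2 v av vb vt).
  by rewrite ler_norml => /andP[_]; rewrite lerBlDl.
have c1 : psi s <= psi t + e * psi t / 2.
  apply: close => //; first exact: le_trans st tb.
  by rewrite ler0_norm ?subr_le0// opprB; exact: lt_min_r k1.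
have c2 : psi s' <= psi t + e * psi t / 2.
  apply: close => //; first exact: le_trans at_ ts.
  by rewrite ger0_norm ?subr_ge0//; exact: lt_min_r k2.
have hs := H1 s s' as_ st ts sb (lt_min_l k1) (lt_min_l k2).
have ss : 0 <= s' - s by rewrite subr_ge0 (le_trans st).
have he : (- 1 + e) * (s' - s) <= (- 1 + e0) * (s' - s).
  by apply: ler_wpM2r => //; rewrite lerD2l.
apply: le_trans he.
rewrite (hsqE (u s' - _)) (hsqE (u s - _)) in hs.
exact: (sqrt_rate_arith psi0 (enorm_ge0 _) (enorm_ge0 _) ss e_0 e_1 c1 c2 hs).
Qed.

End distance.

(** * Behaviour of an arbitrary closed-loop solution *)

Lemma half_sq_sub_le (R : realType) (s t M d : R) : 0 <= s -> s <= M -> 0 <= t ->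
  t <= M -> `|t - s| <= d -> `|t ^+ 2 / 2 - s ^+ 2 / 2| <= M * d.
Proof.
move=> s0 sM t0 tM h.
have -> : t ^+ 2 / 2 - s ^+ 2 / 2 = (t + s) / 2 * (t - s) by field.
rewrite normrM; apply: ler_pM => //.
by rewrite ger0_norm ?divr_ge0 ?addr_ge0//; lra.
Qed.

Lemma eq_le_r (R : realType) (x y : R) : x = y -> x <= y.
Proof. by move=> ->. Qed.

Lemma lt1_drop_arith (R : realType) (x y : R) : 0 <= x -> x - y <= - 1 -> y < 1 -> False.
Proof. lra. Qed.

Lemma equilibrium_arith (R : realType) (X q tau L k c : R) : 0 <= X -> 0 <= q ->
  0 <= tau -> 0 <= L -> 0 <= k ->
  c <= L * (X + (q + tau * k * (L * X))) * X ->
  c + k * L * X * q <=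
    2 * (L + tau * k * L ^+ 2 + L + k * L) * (X ^+ 2 / 2 + q ^+ 2 / 2).
Proof.
move=> X0 q0 t0 L0 k0 h.
have h1 : 0 <= (L + k * L) * (X - q) ^+ 2.
  by rewrite mulr_ge0 ?sqr_ge0// addr_ge0// mulr_ge0.
have h2 : 0 <= (L + tau * k * L ^+ 2) * q ^+ 2.
  by rewrite mulr_ge0 ?sqr_ge0// addr_ge0// !mulr_ge0 ?sqr_ge0.
have h3 : 0 <= (L + k * L) * (X ^+ 2 + q ^+ 2).
  by rewrite mulr_ge0 ?addr_ge0 ?sqr_ge0// mulr_ge0.
lra.
Qed.

Lemma growth_arith (R : realType) (E' E v w : R) : 1 <= E -> 0 <= w ->
  v / 2 <= E' * (w / 2) -> E' <= E -> v <= E ^+ 2 * w.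
Proof.
move=> E1 w0 h1 h2.
have h3 : E' * w <= E * w by exact: ler_wpM2r.
have h4 : E * w <= E ^+ 2 * w.
  by apply: ler_wpM2r => //; rewrite expr2; apply: ler_peMl => //; lra.
lra.
Qed.

Section solutions.
Variables (R : realType) (n p : nat).
Variables (F : 'cV[R]_n -> 'cV[R]_p -> 'cV[R]_n) (g : 'cV[R]_n -> 'cV[R]_p).
Variables (U Ut : set 'cV[R]_p) (L tau Rb eta k : R) (r : 'cV[R]_p).
Hypothesis Uc : compact U.
Hypothesis Us : segment_closed U.
Hypothesis U0 : U !=set0.
Hypothesis L0 : 0 <= L.
Hypothesis tau0 : 0 <= tau.
Hypothesis eta0 : 0 < eta.
Hypothesis k0 : 0 < k.
Hypothesis Flip : forall x x' u u', enorm x <= Rb -> enorm x' <= Rb -> Ut u -> Ut u' ->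
  enorm (F x u - F x' u') <= L * (enorm (x - x') + enorm (u - u')).
Hypothesis glip : forall x x', enorm x <= Rb -> enorm x' <= Rb ->
  enorm (g x - g x') <= L * enorm (x - x').
Hypothesis UtI : forall x u, enorm x <= Rb -> thicken U eta u ->
  Ut (u + (tau * k) *: (r - g x)).

Let UU1 : U `<=` thicken U eta.
Proof. by apply: thicken_sub => //; exact: ltW. Qed.

Section one_solution.
Variable z : R -> 'cV[R]_(n + p).
Hypothesis zac : forall b, 0 <= b -> absolutely_continuous_on 0 b z.
Hypothesis zae : {ae (@lebesgue_measure R), forall t, 0 < t ->
  is_derive (t : R^o) 1 (z : R^o -> 'cV[R]_(n + p)) (cl_field F g U tau k r (z t))}.

Let x t := usubmx (z t).
Let u t := dsubmx (z t).

Let zac' a b : 0 <= a -> absolutely_continuous_on a b z.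
Proof.
move=> a0; have [b0|/ltW b0] := leP 0 b.
  exact: (absolutely_continuous_on_sub a0 (lexx _) (zac b0)).
by apply: (absolutely_continuous_on_sub a0 _ (zac (lexx 0))).
Qed.

Let zdiff : exists2 E : set R, (@lebesgue_measure R).-negligible E &
  forall a b t, 0 <= t -> ~ E t -> vderiv a b z t (cl_field F g U tau k r (z t)).
Proof. exact: ae_vderiv zae. Qed.

Let zc a b t : 0 <= a -> a <= t -> t <= b -> vcont a b z t.
Proof. by move=> a0; apply: ac_vcont; exact: zac'. Qed.

Let zus s t : enorm (u t - u s) <= enorm (z t - z s).
Proof. by rewrite /u -linearB; exact: enorm_dsubmx. Qed.

Let zxs s t : enorm (x t - x s) <= enorm (z t - z s).
Proof. by rewrite /x -linearB; exact: enorm_usubmx. Qed.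

Let uder a b t : vderiv a b z t (cl_field F g U tau k r (z t)) ->
  vderiv a b u t (Pi U (u t) (k *: (r - g (x t)))).
Proof. by move=> /vderiv_dsubmx; rewrite /cl_field col_mxKd. Qed.

Let xder a b t : vderiv a b z t (cl_field F g U tau k r (z t)) ->
  vderiv a b x t (F (x t) (u t + (tau * k) *: (r - g (x t)))).
Proof. by move=> /vderiv_usubmx; rewrite /cl_field col_mxKu. Qed.

Let Pi_out v h : ~ U v -> Pi U v h = (enorm (proj U v - v))^-1 *: (proj U v - v).
Proof. by rewrite /Pi; case: asboolP. Qed.

(** The squared distance of the integrator state to [U] cannot grow: outside
    [U] the velocity points towards the projection. *)
Lemma solution_stays a b : 0 <= a -> a <= b -> U (u a) -> U (u b).
Proof.
move=> a0 ab Ua.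
have [M M0 zM] := vcont_bounded ab (fun t at_ tb => zc a0 at_ tb).
have [MU MU0 UM] := compact_enorm_bounded Uc.
pose psi t := enorm (u t - proj U (u t)).
have psiM t : a <= t -> t <= b -> psi t <= M + MU.
  move=> at_ tb; apply: le_trans (enormD _ _) _; rewrite enormN; apply: lerD.
    by apply: le_trans (zM t at_ tb); exact: enorm_dsubmx.
  by apply: UM; exact: proj_in.
have [E nE zE] := zdiff.
pose phi t := hsq (u t - proj U (u t)).
have : phi b - phi a <= 0 * (b - a).
  apply: (@ac_le_rate R _ a b z (zac' b a0) phi (M + MU) 0 E ab _ _ nE).
  - exact: addr_ge0.
  - move=> s t as_ st tb; rewrite /phi (hsqE (u t - _)) (hsqE (u s - _)).
    have h := le_trans (dist_lip Uc U0 (u s) (u t)) (zus s t).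
    have p1 := psiM s as_ (le_trans st tb); have p2 := psiM t (le_trans as_ st) tb.
    exact: (half_sq_sub_le (enorm_ge0 _) p1 (enorm_ge0 _) p2 h).
  - move=> t at_ tb tE.
    have ud := uder (zE a b t (le_trans a0 at_) tE).
    apply: upper_rate_le (dist_hsq_rate Uc Us U0 at_ tb ud).
    have [Uut|Unut] := pselect (U (u t)).
      by rewrite (proj_id Uc Us U0 Uut) subrr dot0l.
    rewrite Pi_out// dotZr; apply: mulr_ge0_le0; first by rewrite invr_ge0 enorm_ge0.
    by rewrite -[X in dot _ X]opprB dotNr oppr_le0 dot_ge0.
rewrite mul0r subr_le0 {2}/phi (proj_id Uc Us U0 Ua) subrr [hsq 0]/hsq dot0l mul0r.
rewrite /phi hsqE => h.
have h0 : enorm (u b - proj U (u b)) = 0.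
  by apply/eqP; rewrite -sqrf_eq0 eq_le sqr_ge0 andbT; move: h; rewrite ler_pdivrMr// mul0r.
by move/enorm_eq0/eqP: h0; rewrite subr_eq0 => /eqP ->; exact: proj_in.
Qed.

(** Outside [U] the distance decreases at unit rate, so the integrator state
    is in [U] after one unit of time if it starts close to [U]. *)
Lemma solution_enters a : 0 <= a -> enorm (u a - proj U (u a)) < 1 -> U (u (a + 1)).
Proof.
move=> a0 ha; have ab : a <= a + 1 by rewrite lerDl.
apply: contrapT => hn.
have out t : a <= t -> t <= a + 1 -> ~ U (u t).
  by move=> at_ tb Ut'; apply: hn; apply: solution_stays Ut' => //; exact: le_trans at_.
have [E nE zE] := zdiff.
pose psi t := enorm (u t - proj U (u t)).
have hpsi : psi (a + 1) - psi a <= (- 1) * (a + 1 - a).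
  apply: (@ac_le_rate R _ a (a + 1) z (zac' _ a0) psi 1 (- 1) E ab _ _ nE) => //.
  - move=> s t _ _ _; rewrite mul1r; exact: le_trans (dist_lip Uc U0 (u s) (u t)) (zus s t).
  - move=> t at_ tb tE.
    have ud := uder (zE a (a + 1) t (le_trans a0 at_) tE).
    have Unt := out t at_ tb.
    by apply: (dist_rate Uc Us U0 at_ tb ud Unt); rewrite Pi_out.
have aE : (- 1) * (a + 1 - a) = - 1 :> R by ring.
exact: (lt1_drop_arith (enorm_ge0 _) (le_trans hpsi (eq_le_r aE)) ha).
Qed.

Let drift_of t : F (x t) (u t + (tau * k) *: (r - g (x t))) = drift F g tau k r (z t).
Proof. by []. Qed.

(** At almost every time the test inequality is the computation of a derivative,
    with [Pi_residual_normal] for the integrator; its right-hand side is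
    continuous in time, so [ac_upper_rate] extends it to every time. *)
Lemma solution_evi a b : 0 <= a -> a <= b ->
  (forall t, a <= t -> t <= b -> enorm (x t) <= Rb /\ U (u t)) ->
  cl_evi F g U tau Rb k r a b x u.
Proof.
move=> a0 ab inK.
have [E nE zE] := zdiff.
have K1z t : a <= t -> t <= b -> @ball_times R n p Rb (thicken U eta) (z t).
  by move=> at_ tb; have [h1 h2] := inK t at_ tb; split => //; exact: UU1.
have LF : 0 <= L * (2 + tau * k * L).
  by rewrite mulr_ge0// addr_ge0// !mulr_ge0// ltW.
have [MU MU0 UM] := compact_enorm_bounded Uc.
have dl s t : a <= s -> s <= b -> a <= t -> t <= b ->
    enorm (drift F g tau k r (z s) - drift F g tau k r (z t)) <=
    L * (2 + tau * k * L) * enorm (z s - z t).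
  by move=> as_ sb at_ tb; exact: (drift_lip L0 tau0 k0 Flip glip UtI (K1z s as_ sb) (K1z t at_ tb)).
have xc t : a <= t -> t <= b -> vcont a b x t.
  move=> at_ tb e e0; have [d d0 H] := zc a0 at_ tb e0; exists d => // s as_ sb st.
  exact: le_trans (zxs t s) (H s as_ sb st).
have uc t : a <= t -> t <= b -> vcont a b u t.
  move=> at_ tb e e0; have [d d0 H] := zc a0 at_ tb e0; exists d => // s as_ sb st.
  exact: le_trans (zus t s) (H s as_ sb st).
have Rb0 : 0 <= Rb by have [h _] := inK a (lexx _) ab; exact: le_trans (enorm_ge0 _) h.
have sub_bnd (q : nat) (v w : 'cV[R]_q) (A : R) : enorm v <= A -> enorm (v - w) <= A + enorm w.
  by move=> vA; apply: le_trans (enormD _ _) _; rewrite enormN lerD2r.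
split; first exact: inK.
- by move=> t at_ tb; split; [exact: xc|exact: uc].
- move=> t w at_ tb wB; rewrite drift_of.
  pose c s := dot (drift F g tau k r (z s)) (x s - w).
  have cc : rcont a b c t.
    pose C := L * (2 + tau * k * L) * (Rb + enorm w) + enorm (drift F g tau k r (z t)).
    have C0 : 0 <= C by rewrite addr_ge0 ?enorm_ge0// mulr_ge0// addr_ge0// enorm_ge0.
    apply: (rcont_lip C0 _ (zc a0 at_ tb)) => s as_ sb.
    have -> : c s - c t = dot (drift F g tau k r (z s) - drift F g tau k r (z t)) (x s - w)
        + dot (drift F g tau k r (z t)) (x s - x t).
      rewrite /c; move: (drift _ _ _ _ _ (z s)) (drift _ _ _ _ _ (z t)) (x s) (x t) => A B X Y.
      by rewrite !dotE; ring.
    apply: le_trans (ler_normD _ _) _; rewrite /C mulrDl; apply: lerD.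
      apply: le_trans (cauchy_schwarz_abs _ _) _; rewrite mulrAC.
      apply: ler_pM; rewrite ?enorm_ge0//; first exact: dl.
      by apply: sub_bnd; have [] := inK s as_ sb.
    apply: le_trans (cauchy_schwarz_abs _ _) _; apply: ler_wpM2l; first exact: enorm_ge0.
    exact: zxs.
  apply: (@ac_upper_rate R _ a b z _ c (Rb + enorm w) E t (zac' b a0) _ _ nE _ cc).
  + by rewrite addr_ge0// enorm_ge0.
  + move=> s s' as_ ss sb.
    have h1 : enorm (x s - w) <= Rb + enorm w.
      by apply: sub_bnd; have [] := inK s as_ (le_trans ss sb).
    have h2 : enorm (x s' - w) <= Rb + enorm w.
      by apply: sub_bnd; have [] := inK s' (le_trans as_ ss) sb.
    apply: le_trans (hsq_sub_le h2 h1) _; apply: ler_wpM2l (zxs _ _).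
    by rewrite addr_ge0// enorm_ge0.
  + move=> s as_ sb sE; apply/rderiv_rate/rderiv_hsq.
    exact: xder (zE a b s (le_trans a0 as_) sE).
- move=> t w at_ tb wU.
  pose c s := dot (k *: (r - g (x s))) (u s - w).
  have cc : rcont a b c t.
    pose C := k * L * (MU + enorm w) + enorm (k *: (r - g (x t))).
    have kL : 0 <= k * L by rewrite mulr_ge0// ltW.
    have C0 : 0 <= C by rewrite addr_ge0 ?enorm_ge0// mulr_ge0// addr_ge0// enorm_ge0.
    apply: (rcont_lip C0 _ (zc a0 at_ tb)) => s as_ sb.
    have [xsB uU] := inK s as_ sb; have [xtB _] := inK t at_ tb.
    have -> : c s - c t = dot (k *: (g (x t) - g (x s))) (u s - w)
        + dot (k *: (r - g (x t))) (u s - u t).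
      rewrite /c; move: (g (x s)) (g (x t)) (u s) (u t) => A B X Y.
      by rewrite !dotE; ring.
    apply: le_trans (ler_normD _ _) _; rewrite /C mulrDl; apply: lerD.
      apply: le_trans (cauchy_schwarz_abs _ _) _; rewrite mulrAC.
      apply: ler_pM; rewrite ?enorm_ge0//; last by apply: sub_bnd; exact: UM.
      rewrite enormZ (gtr0_norm k0) -mulrA; apply: ler_wpM2l; first exact: ltW.
      apply: le_trans (glip xtB xsB) _; apply: ler_wpM2l => //.
      by rewrite (enormB (x t)); exact: zxs.
    apply: le_trans (cauchy_schwarz_abs _ _) _; apply: ler_wpM2l; first exact: enorm_ge0.
    exact: zus.
  apply: (@ac_upper_rate R _ a b z _ c (MU + enorm w) E t (zac' b a0) _ _ nE _ cc).
  + by rewrite addr_ge0// enorm_ge0.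
  + move=> s s' as_ ss sb.
    have h1 : enorm (u s - w) <= MU + enorm w.
      by apply: sub_bnd; apply: UM; have [] := inK s as_ (le_trans ss sb).
    have h2 : enorm (u s' - w) <= MU + enorm w.
      by apply: sub_bnd; apply: UM; have [] := inK s' (le_trans as_ ss) sb.
    apply: le_trans (hsq_sub_le h2 h1) _; apply: ler_wpM2l (zus _ _).
    by rewrite addr_ge0// enorm_ge0.
  + move=> s as_ sb sE.
    have ud := uder (zE a b s (le_trans a0 as_) sE).
    apply: upper_rate_le (rderiv_rate (rderiv_hsq w ud)).
    have [_ Uus] := inK s as_ sb.
    have := Pi_residual_normal Uc Us U0 (k *: (r - g (x s))) Uus wU.
    by rewrite -[w - u s]opprB dotNr (dotDl (k *: _)) dotNl oppr_le0 subr_ge0.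
Qed.

(** Continuation: once the a-priori estimate keeps the state in a smaller
    ball, the solution satisfies the test inequalities forever. *)
Lemma solution_continue a : 0 <= a -> U (u a) -> enorm (x a) <= Rb ->
  (forall b, a <= b -> cl_evi F g U tau Rb k r a b x u -> enorm (x b) <= Rb - 1) ->
  forall b, a <= b -> cl_evi F g U tau Rb k r a b x u.
Proof.
move=> a0 Ua xa hB b ab.
have uU t : a <= t -> U (u t) by move=> at_; exact: solution_stays Ua.
have RR : Rb - 1 < Rb by rewrite ltrBlDr ltrDl.
have xB : forall t, a <= t -> t <= b -> enorm (x t) <= Rb.
  apply: (bound_continuation ab RR) => //.
    move=> t at_ tb; apply: (rcont_lip ler01 _ (zc a0 at_ tb)) => s as_ sb.
    by rewrite mul1r; apply: le_trans (enorm_dist _ _) (zxs _ _).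
  move=> s as_ sb hs; apply: hB => //; apply: solution_evi => // t at_ ts; split; first exact: hs.
  exact: uU.
by apply: solution_evi => // t at_ tb; split; [exact: xB|exact: uU].
Qed.

End one_solution.

Section near_equilibrium.
Variables (xe : 'cV[R]_n) (ue : 'cV[R]_p).
Hypothesis rE : r = g xe.
Hypothesis xeB : enorm xe <= Rb.
Hypothesis Uue : U ue.
Hypothesis Utue : Ut ue.
Hypothesis Fe : F xe ue = 0.

Let Cs := 2 * (L + tau * k * L ^+ 2 + L + k * L).

Let Cs0 : 0 <= Cs.
Proof.
have tk : 0 <= tau * k by rewrite mulr_ge0// ltW.
by rewrite mulr_ge0// !addr_ge0// mulr_ge0 ?sqr_ge0// ltW.
Qed.

Let drift_dissipation x u : enorm x <= Rb -> thicken U eta u ->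
  dot (F x (u + (tau * k) *: (r - g x))) (x - xe) + k * L * enorm (x - xe) * enorm (u - ue)
    <= Cs * (hsq (x - xe) + hsq (u - ue)).
Proof.
move=> xB uU.
have tk : 0 <= tau * k by rewrite mulr_ge0// ltW.
have h1 : enorm (F x (u + (tau * k) *: (r - g x))) <=
    L * (enorm (x - xe) + (enorm (u - ue) + tau * k * (L * enorm (x - xe)))).
  rewrite -[F _ _]subr0 -Fe; apply: le_trans (Flip xB xeB (UtI xB uU) Utue) _.
  apply: ler_wpM2l => //; rewrite lerD2l addrAC; apply: le_trans (enormD _ _) _.
  rewrite lerD2l enormZ (ger0_norm tk); apply: ler_wpM2l => //.
  by rewrite rE (enormB x); exact: glip.
have h2 := le_trans (cauchy_schwarz _ _) (ler_wpM2r (enorm_ge0 (x - xe)) h1).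
rewrite (hsqE (x - xe)) (hsqE (u - ue)).
exact: (equilibrium_arith (enorm_ge0 _) (enorm_ge0 _) tau0 L0 (ltW k0) h2).
Qed.

(** In [U] the projection only decreases the inner product with [u - ue];
    outside, the velocity makes an obtuse angle with [u - ue]. *)
Let Pi_dissipation x u : enorm x <= Rb ->
  dot (Pi U u (k *: (r - g x))) (u - ue) <= k * L * enorm (x - xe) * enorm (u - ue).
Proof.
move=> xB; have [Uu|Unu] := pselect (U u).
  have := Pi_residual_normal Uc Us U0 (k *: (r - g x)) Uu Uue.
  rewrite -[ue - u]opprB dotNr (dotDl (k *: _)) dotNl oppr_le0 subr_ge0 => h.
  apply: (le_trans h); apply: le_trans (cauchy_schwarz _ _) _.
  apply: ler_wpM2r; first exact: enorm_ge0.
  rewrite enormZ (gtr0_norm k0) -mulrA; apply: ler_wpM2l; first exact: ltW.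
  by rewrite rE (enormB x); exact: glip.
have kL : 0 <= k * L * enorm (x - xe) * enorm (u - ue).
  by rewrite !mulr_ge0 ?enorm_ge0// ltW.
apply: le_trans kL; rewrite /Pi; case: asboolP => // _.
rewrite dotZl; apply: mulr_ge0_le0; first by rewrite invr_ge0 enorm_ge0.
have -> : u - ue = (u - proj U u) + (proj U u - ue) by rewrite addrA subrK.
rewrite dotDr -[leRHS]addr0; apply: lerD.
  by rewrite -[proj U u - u]opprB dotNl oppr_le0 dot_ge0.
rewrite -[proj U u - u]opprB -[proj U u - ue]opprB dotNl dotNr opprK.
exact: proj_obtuse.
Qed.

Let ECs1 : 1 <= expR Cs.
Proof. by rewrite -expR0 ler_expR. Qed.

Let growth (q : nat) t (v w : 'cV[R]_q) : t <= 1 -> 0 <= t ->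
  hsq v <= expR (Cs * t) * hsq w -> enorm v <= expR Cs * enorm w.
Proof.
move=> t1 t0 h; have E0 : 0 <= expR Cs by exact: expR_ge0.
rewrite -(ler_pXn2r (n:=2))// ?nnegrE ?mulr_ge0 ?enorm_ge0// exprMn.
have : expR (Cs * t) <= expR Cs by rewrite ler_expR ler_piMr.
move: h; rewrite (hsqE v) (hsqE w).
exact: growth_arith ECs1 (sqr_ge0 _).
Qed.

(** The plant field vanishes at the equilibrium and is Lipschitz around it; the
    projected part is dissipative up to [k L enorm (x - xe) enorm (u - ue)],
    also outside [U]. Gronwall then bounds the growth over one unit of time,
    and [bound_continuation] keeps the solution in the region where these
    estimates hold. *)
Lemma near_solution z (e1 : R) t :
  (forall b, 0 <= b -> absolutely_continuous_on 0 b z) ->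
  {ae (@lebesgue_measure R), forall t, 0 < t ->
    is_derive (t : R^o) 1 (z : R^o -> 'cV[R]_(n + p)) (cl_field F g U tau k r (z t))} ->
  0 < e1 -> enorm xe + e1 <= Rb -> e1 <= eta ->
  expR Cs * enorm (z 0 - col_mx xe ue) <= e1 / 2 -> 0 <= t -> t <= 1 ->
  enorm (z t - col_mx xe ue) <= expR Cs * enorm (z 0 - col_mx xe ue).
Proof.
move=> zac zae e10 xe1 e1eta z0; set ze := col_mx xe ue in z0 *.
have zacs s : 0 <= s -> absolutely_continuous_on 0 s z by move=> s0; exact: zac.
have [E nE zE] := ae_vderiv zae.
have step s : 0 <= s -> s <= 1 -> (forall v, 0 <= v -> v <= s -> enorm (z v - ze) <= e1) ->
    enorm (z s - ze) <= expR Cs * enorm (z 0 - ze).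
  move=> s0 s1 hs.
  have lipS v v' : 0 <= v -> v <= v' -> v' <= s ->
      `|hsq (z v' - ze) - hsq (z v - ze)| <= e1 * enorm (z v' - z v).
    move=> v0 vv vs; apply: hsq_sub_le; apply: hs => //; first exact: le_trans v0 vv.
    exact: le_trans vv vs.
  have zc v : 0 <= v -> v <= s -> vcont 0 s z v.
    by move=> v0 vs; apply: ac_vcont => //; exact: zacs.
  have Sc v : 0 <= v -> v <= s -> rcont 0 s (fun v => hsq (z v - ze)) v.
    by move=> v0 vs; apply: rcont_hsq; exact: zc.
  have cS v : 0 <= v -> v <= s -> rcont 0 s (fun v => Cs * hsq (z v - ze) + 0) v.
    move=> v0 vs; apply: (rcont_lip (C := Cs * e1) _ _ (zc v v0 vs)).
      by rewrite mulr_ge0// ltW.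
    move=> v' v'0 v's; rewrite !addr0 -mulrBr normrM (ger0_norm Cs0) -mulrA.
    apply: ler_wpM2l => //; apply: hsq_sub_le; exact: hs.
  have Sr v : 0 <= v -> v <= s ->
      upper_rate 0 s (fun v => hsq (z v - ze)) v (Cs * hsq (z v - ze) + 0).
    move=> v0 vs.
    apply: (@ac_upper_rate R _ 0 s z _ (fun v => Cs * hsq (z v - ze) + 0) e1 E v (zacs s s0)
      (ltW e10) lipS nE _ (cS v v0 vs)) => w w0 ws wE.
    apply: upper_rate_le (rderiv_rate (rderiv_hsq ze (zE 0 s w w0 wE))).
    have zw := hs w w0 ws.
    have xw : enorm (usubmx (z w) - xe) <= e1.
      apply: le_trans zw; rewrite -[X in _ - X](col_mxKu xe ue) -linearB.
      exact: enorm_usubmx.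
    have uw : enorm (dsubmx (z w) - ue) <= e1.
      apply: le_trans zw; rewrite -[X in _ - X](col_mxKd xe ue) -linearB.
      exact: enorm_dsubmx.
    have xwB : enorm (usubmx (z w)) <= Rb.
      rewrite -(subrK xe (usubmx (z w))); apply: le_trans (enormD _ _) _.
      by apply: le_trans xe1; rewrite addrC lerD2l.
    have uwU : thicken U eta (dsubmx (z w)).
      exact: (thicken_near Uc U0 Uue (le_trans uw e1eta)).
    rewrite addr0 (dot_split (cl_field _ _ _ _ _ _ _)) [hsq (z w - ze)]/hsq (dot_split (z w - ze)).
    rewrite /cl_field col_mxKu col_mxKd !(linearB _ (z w) ze)/= /ze col_mxKu col_mxKd mulrDl.
    apply: le_trans (drift_dissipation xwB uwU); rewrite lerD2l.
    exact: Pi_dissipation.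
  have := gronwall s0 Cs0 (lexx 0) Sc Sr.
  by rewrite mul0r addr0 subr0; exact: growth.
move=> t0 t1.
have e12 : e1 / 2 < e1 by lra.
have z01 : enorm (z 0 - ze) <= e1.
  apply: le_trans (ltW e12); apply: le_trans z0.
  by apply: ler_peMl; [exact: enorm_ge0|exact: ECs1].
have hall : forall s, 0 <= s -> s <= t -> enorm (z s - ze) <= e1.
  apply: (bound_continuation t0 e12) => //.
    move=> s s0 st; apply: (rcont_lip ler01 (z := z)) => [v v0 vt|].
      by rewrite mul1r; apply: le_trans (enorm_dist _ _) _; rewrite opprB addrA subrK.
    by apply: ac_vcont => //; exact: zacs.
  move=> s s0 st hs; apply: le_trans z0; apply: step => //; exact: le_trans st t1.
exact: step.
Qed.

(** The same estimate for the first phase of a constructed solution, where the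
    variational inequality takes the place of the differential equation. *)
Lemma near_approach (x1 : R -> 'cV[R]_n) (u1 : R -> 'cV[R]_p) (d0 t : R) : d0 <= 1 ->
  (forall t, enorm (x1 t) <= Rb) -> (forall b t, vcont 0 b x1 t) ->
  (forall t, 0 <= t -> t <= d0 -> thicken U eta (u1 t)) -> (forall b t, vcont 0 b u1 t) ->
  (forall b t w, 0 <= t -> t <= d0 -> U w ->
     upper_rate 0 b (fun s => hsq (u1 s - w)) t 0) ->
  (forall b t w, 0 <= t -> t <= d0 -> enorm w <= Rb ->
     upper_rate 0 b (fun s => hsq (x1 s - w)) t
       (dot (F (x1 t) (u1 t + (tau * k) *: (r - g (x1 t)))) (x1 t - w))) ->
  0 <= t -> t <= d0 ->
  enorm (col_mx (x1 t) (u1 t) - col_mx xe ue) <=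
  expR Cs * enorm (col_mx (x1 0) (u1 0) - col_mx xe ue).
Proof.
move=> d01 x1B x1c u1U u1c u1t x1t t0 td.
pose S t := hsq (x1 t - xe) + hsq (u1 t - ue).
have SE s : hsq (col_mx (x1 s) (u1 s) - col_mx xe ue) = S s.
  by rewrite /hsq dot_split !linearB/= !col_mxKu !col_mxKd mulrDl.
have Sc s : 0 <= s -> s <= t -> rcont 0 t S s.
  move=> s0 st; have := rcont_hsq (col_mx xe ue) (t := s) (a := 0) (b := t)
     (z := fun s => col_mx (x1 s) (u1 s)).
  have -> : (fun s => hsq (col_mx (x1 s) (u1 s) - col_mx xe ue)) = S by apply/funext => v; exact: SE.
  apply => e e0; have e20 : 0 < e / 2 by rewrite divr_gt0.
  have [r1 r10 h1] := x1c t s _ e20; have [r2 r20 h2] := u1c t s _ e20.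
  exists (Num.min r1 r2); first exact: min_gt0.
  move=> v v0 vt vs; apply: le_trans (enorm_col_le _) _.
  rewrite !linearB/= !col_mxKu !col_mxKd (splitr e); apply: lerD.
    exact: (h1 v v0 vt (lt_min_l vs)).
  exact: (h2 v v0 vt (lt_min_r vs)).
have Sr s : 0 <= s -> s <= t -> upper_rate 0 t S s (Cs * S s + 0).
  move=> s0 st; have sd : s <= d0 by exact: le_trans st td.
  apply: upper_rate_le (upper_rateD (x1t t s xe s0 sd xeB) (u1t t s ue s0 sd Uue)).
  rewrite !addr0; apply: le_trans (drift_dissipation (x1B s) (u1U s s0 sd)).
  by rewrite lerDl !mulr_ge0 ?enorm_ge0// ltW.
have := gronwall t0 Cs0 (lexx 0) Sc Sr.
rewrite mul0r addr0 subr0 -!SE; apply: growth => //; exact: le_trans td d01.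
Qed.

End near_equilibrium.
End solutions.

(** * Lipschitz constants of the plant data *)

Lemma Ck2_Ck1 (R : realType) (V W : normedModType R) (A : set V) (f : V -> W) :
  Ck 2 A f -> Ck 1 A f.
Proof.
move=> [fd fC]; split => // v x Ax; have [fdv _] := fC v.
exact/differentiable_continuous/fdv.
Qed.

Section columns.
Variable R : realType.

Lemma cV_basis (q : nat) (v : 'cV[R]_q) : v = \sum_(i < q) v i 0 *: delta_mx i 0.
Proof.
apply/matrixP => i j; rewrite summxE (bigD1 i)//= big1 => [|k ki].
  by rewrite !mxE (ord1 j) !eqxx mulr1 addr0.
by rewrite !mxE eq_sym (negbTE ki) mulr0.
Qed.

(** Unlike a Lipschitz bound on [K], this compares points of [K] with all nearby
    points, which makes it stable under composition. *)
Definition lip_near (q q' : nat) (K : set 'cV[R]_q) (f : 'cV[R]_q -> 'cV[R]_q') (C : R) :=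
  forall z, K z -> exists2 d : R, 0 < d & forall z', enorm (z' - z) < d ->
    enorm (f z' - f z) <= C * enorm (z' - z).

Lemma Ck1_lip_near (q q' : nat) (A K : set 'cV[R]_q) (f : 'cV[R]_q -> 'cV[R]_q') :
  Ck 1 A f -> compact K -> K `<=` A -> exists2 C : R, 0 <= C & lip_near K f C.
Proof.
move=> fA Kc KA.
have [C C0 hC] := Ck1_pointwise_lipschitz (@cV_basis q) (@coord_le_norm R q) fA Kc KA.
exists (q'%:R * C); first by rewrite mulr_ge0.
move=> z Kz; have /enorm_nbhsP[d d0 hd] := hC z Kz; exists d => // z' /hd h.
apply: le_trans (enorm_le_norm _) _; rewrite -mulrA; apply: ler_wpM2l => //.
by apply: le_trans h _; apply: ler_wpM2l => //; exact: norm_le_enorm.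
Qed.

Lemma Ck1_compact_image (V W : normedModType R) (A K : set V) (f : V -> W) :
  Ck 1 A f -> compact K -> K `<=` A -> compact (f @` K).
Proof.
move=> [fd _] Kc KA; apply: continuous_compact Kc; apply: continuous_in_subspaceT.
by move=> z /set_mem Kz; apply: differentiable_continuous; apply: fd; exact: KA.
Qed.

Lemma lip_near_comp (q q1 q2 : nat) (K : set 'cV[R]_q) (f : 'cV[R]_q -> 'cV[R]_q1)
    (h : 'cV[R]_q1 -> 'cV[R]_q2) (C D : R) : 0 <= C -> 0 <= D ->
  lip_near K f C -> lip_near (f @` K) h D -> lip_near K (h \o f) (D * C).
Proof.
move=> C0 D0 fK hK z Kz; have [d d0 fd] := fK z Kz.
have [e e0 he] := hK (f z) (imageP _ Kz).
have C1 : 0 < C + 1 by lra.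
exists (Num.min d (e / (C + 1))); first by apply: min_gt0 => //; rewrite divr_gt0.
move=> z' hz; have h1 := fd z' (lt_min_l hz).
have := lt_min_r hz; rewrite ltr_pdivlMr// => h2.
rewrite -mulrA; apply: le_trans (he (f z') _) _; last exact: ler_wpM2l.
apply: le_lt_trans h1 _; apply: le_lt_trans h2; rewrite mulrC; apply: ler_wpM2l.
  exact: enorm_ge0.
by rewrite lerDl.
Qed.

(** Along a segment inside [K] the local bounds add up. *)
Lemma lip_near_lipschitz (q q' : nat) (K : set 'cV[R]_q) (f : 'cV[R]_q -> 'cV[R]_q') (C : R) :
  segment_closed K -> lip_near K f C ->
  forall z z', K z -> K z' -> enorm (f z - f z') <= C * enorm (z - z').
Proof.
move=> Ks fK z z' Kz Kz'; apply: (local_lipschitz Ks _ Kz' Kz) => y Ky.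
by have [d d0 hd] := fK y Ky; exists d => // y' _; exact: hd.
Qed.

Definition pair_coord (n m : nat) (v : 'cV[R]_n * 'cV[R]_m) (i : 'I_(n + m)) : R :=
  match fintype.split i with inl j => v.1 j 0 | inr j => v.2 j 0 end.

Definition pair_vec (n m : nat) (i : 'I_(n + m)) : 'cV[R]_n * 'cV[R]_m :=
  match fintype.split i with inl j => (delta_mx j 0, 0) | inr j => (0, delta_mx j 0) end.

Lemma pair_basis (n m : nat) (v : 'cV[R]_n * 'cV[R]_m) :
  v = \sum_(i < n + m) pair_coord v i *: pair_vec i.
Proof.
rewrite big_split_ord/=.
have hl (i : 'I_n) : pair_coord v (lshift m i) *: pair_vec (lshift m i) =
    (v.1 i 0 *: delta_mx i 0, 0).
  by rewrite /pair_coord /pair_vec (unsplitK (inl i) : fintype.split (lshift m i) = inl i); congr pair; rewrite /= scaler0.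
have hr (i : 'I_m) : pair_coord v (rshift n i) *: pair_vec (rshift n i) =
    (0, v.2 i 0 *: delta_mx i 0).
  by rewrite /pair_coord /pair_vec (unsplitK (inr i) : fintype.split (rshift n i) = inr i); congr pair; rewrite /= scaler0.
rewrite (eq_bigr _ (fun i _ => hl i)) (eq_bigr _ (fun i _ => hr i)).
have s1 (I : finType) (h : I -> 'cV[R]_n) :
    \sum_i (h i, 0 : 'cV[R]_m) = (\sum_i h i, 0).
  by elim/big_rec2: _ => // i x y _ ->; congr pair; rewrite /= addr0.
have s2 (I : finType) (h : I -> 'cV[R]_m) :
    \sum_i (0 : 'cV[R]_n, h i) = (0, \sum_i h i).
  by elim/big_rec2: _ => // i x y _ ->; congr pair; rewrite /= addr0.
rewrite s1 s2 -!cV_basis [v in LHS]surjective_pairing.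
by congr pair; rewrite /= ?addr0 ?add0r.
Qed.

Lemma pair_coord_le (n m : nat) (v : 'cV[R]_n * 'cV[R]_m) i : `|pair_coord v i| <= `|v|.
Proof.
rewrite /pair_coord; case: (fintype.split i) => j.
  by apply: le_trans (coord_le_norm _ _) _; rewrite [leRHS]prod_normE le_max lexx.
by apply: le_trans (coord_le_norm _ _) _; rewrite [leRHS]prod_normE le_max lexx orbT.
Qed.

Lemma Ck1_pair_lip_near (n m q : nat) (A : set ('cV[R]_n * 'cV[R]_m))
    (f : 'cV[R]_n -> 'cV[R]_m -> 'cV[R]_q) (K1 : set 'cV[R]_n) (K2 : set 'cV[R]_m) :
  Ck 1 A (fun xv => f xv.1 xv.2) -> compact K1 -> compact K2 -> K1 `*` K2 `<=` A ->
  exists2 C : R, 0 <= C & forall x v, K1 x -> K2 v -> exists2 d : R, 0 < d &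
    forall x' v', enorm (x' - x) < d -> enorm (v' - v) < d ->
    enorm (f x' v' - f x v) <= C * (enorm (x' - x) + enorm (v' - v)).
Proof.
move=> fA K1c K2c KA.
have [C C0 hC] := Ck1_pointwise_lipschitz (@pair_basis n m) (@pair_coord_le n m) fA
  (compact_setX K1c K2c) KA.
exists (q%:R * C); first by rewrite mulr_ge0.
move=> x v K1x K2v.
have /nbhs_ballP[d /= d0 hd] := hC (x, v) (conj K1x K2v); exists d => // x' v' hx hv.
have xv : ball (x, v) d (x', v').
  rewrite -ball_normE/= [ltLHS]prod_normE/= gt_max; apply/andP; split.
    by rewrite distrC; apply: le_lt_trans (norm_le_enorm _) hx.
  by rewrite distrC; apply: le_lt_trans (norm_le_enorm _) hv.
have := hd _ xv => /= h.
apply: le_trans (enorm_le_norm _) _; rewrite -mulrA; apply: ler_wpM2l => //.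
apply: le_trans h _; apply: ler_wpM2l => //; rewrite [leLHS]prod_normE/= ge_max.
apply/andP; split; apply: le_trans (norm_le_enorm _) _.
  by rewrite lerDl enorm_ge0.
by rewrite lerDr enorm_ge0.
Qed.

End columns.

Lemma dotBr (R : realType) (q : nat) (w u v : 'cV[R]_q) : dot w (u - v) = dot w u - dot w v.
Proof. by rewrite dotDr dotNr. Qed.

Lemma scale_rate_arith (R : realType) (W A e d s : R) : 0 < W ->
  A <= (d + W * e) * s -> W * W = A - s * d -> W <= e * s.
Proof. by move=> W0 h1 h2; rewrite -(ler_pM2l W0) h2; move: h1; lra. Qed.

Section data.
Variables (R : realType) (n m p : nat).
Variables (calV : set 'cV[R]_m) (f0 : 'cV[R]_n -> 'cV[R]_m -> 'cV[R]_n).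
Variables (N : 'cV[R]_p -> 'cV[R]_m) (Ut : set 'cV[R]_p).
Hypothesis f0C : Ck 2 (setT `*` calV) (fun xv : 'cV[R]_n * 'cV[R]_m => f0 xv.1 xv.2).
Hypothesis NC : Ck 1 Ut N.
Hypothesis NV : forall u, Ut u -> calV (N u).
Hypothesis Utc : compact Ut.
Hypothesis Uts : segment_closed Ut.

Let NV_sub : N @` Ut `<=` calV.
Proof. by move=> _ [u Uu <-]; exact: NV. Qed.

Lemma field_lipschitz (Rb : R) : exists2 L : R, 0 <= L &
  forall x x' u u', enorm x <= Rb -> enorm x' <= Rb -> Ut u -> Ut u' ->
    enorm (f0 x (N u) - f0 x' (N u')) <= L * (enorm (x - x') + enorm (u - u')).
Proof.
have [CN CN0 hN] := Ck1_lip_near NC Utc (fun _ h => h).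
have NUc := Ck1_compact_image NC Utc (fun _ h => h).
have [C C0 hf] := Ck1_pair_lip_near (Ck2_Ck1 f0C) (@ball_compact R n Rb) NUc
  (fun _ h => conj I (NV_sub h.2)).
pose h (z : 'cV[R]_(n + p)) := f0 (usubmx z) (N (dsubmx z)).
have CN1 : 0 <= 1 + CN by rewrite addr_ge0.
have CN2 : 0 < 1 + CN by rewrite ltr_pwDl.
have hL : lip_near (@ball_times R n p Rb Ut) h (C * (1 + CN)).
  move=> z [zx zu]; have [d d0 hd] := hN _ zu.
  have [e e0 he] := hf _ _ zx (imageP N zu).
  exists (Num.min d (e / (1 + CN))); first by apply: min_gt0 => //; rewrite divr_gt0.
  move=> z' hz; have z1 := lt_min_l hz; have := lt_min_r hz; rewrite ltr_pdivlMr// => z2.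
  have hu : enorm (usubmx z' - usubmx z) <= enorm (z' - z).
    by rewrite -linearB; exact: enorm_usubmx.
  have hv : enorm (dsubmx z' - dsubmx z) <= enorm (z' - z).
    by rewrite -linearB; exact: enorm_dsubmx.
  have hNz := le_trans (hd _ (le_lt_trans hv z1)) (ler_wpM2l CN0 hv).
  have E0 := enorm_ge0 (z' - z).
  rewrite /h -mulrA mulrDl mul1r; apply: le_trans (he _ _ _ _) _.
  - apply: le_lt_trans z2; apply: le_trans hu _.
    by rewrite mulrDr mulr1 lerDl mulr_ge0.
  - apply: le_lt_trans z2; apply: le_trans hNz _.
    by rewrite mulrDr mulr1 mulrC lerDr.
  by apply: ler_wpM2l => //; exact: lerD.
exists (C * (1 + CN)); first by rewrite mulr_ge0.
move=> x x' u u' xB x'B Uu Uu'.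
have := lip_near_lipschitz (ball_times_segment Uts) hL (z := col_mx x u) (z' := col_mx x' u').
rewrite /h /ball_times/= !col_mxKu !col_mxKd => H; apply: le_trans (H _ _) _ => //.
apply: ler_wpM2l; first by rewrite mulr_ge0.
by apply: le_trans (enorm_col_le _) _; rewrite !linearB/= !col_mxKu !col_mxKd.
Qed.

Lemma equilibria_lipschitz (Xi : 'cV[R]_m -> 'cV[R]_n) : Ck 1 calV Xi ->
  exists2 L : R, 0 <= L & forall u u', Ut u -> Ut u' ->
    enorm (Xi (N u) - Xi (N u')) <= L * enorm (u - u').
Proof.
move=> XC.
have [CN CN0 hN] := Ck1_lip_near NC Utc (fun _ h => h).
have NUc := Ck1_compact_image NC Utc (fun _ h => h).
have [C C0 hX] := Ck1_lip_near XC NUc NV_sub.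
exists (C * CN); first by rewrite mulr_ge0.
exact: (lip_near_lipschitz Uts (lip_near_comp CN0 C0 hN hX)).
Qed.

End data.

Lemma output_lipschitz (R : realType) (n p : nat) (g : 'cV[R]_n -> 'cV[R]_p) (Rb : R) :
  Ck 1 setT g -> exists2 L : R, 0 <= L &
  forall x x', enorm x <= Rb -> enorm x' <= Rb -> enorm (g x - g x') <= L * enorm (x - x').
Proof.
move=> gC; have [C C0 hC] := Ck1_lip_near gC (@ball_compact R n Rb) (fun _ _ => I).
exists C => // x x' xB x'B; exact: (lip_near_lipschitz (@ball_segment R n Rb) hC).
Qed.

(** Testing the increment [w = z s' - z s - (s' - s) *: c t] against itself,
    [ac_le_rate] applied to [dot w (z v)] bounds its norm by [e * (s' - s)]. *)
Lemma ac_vderiv (R : realType) (q : nat) (b t : R) (z c : R -> 'cV[R]_q) (E : set R) :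
  absolutely_continuous_on 0 b z -> (@lebesgue_measure R).-negligible E ->
  (forall s, 0 <= s -> s <= b -> ~ E s -> vderiv 0 b z s (c s)) ->
  0 <= t -> t <= b -> vcont 0 b c t -> vderiv 0 b z t (c t).
Proof.
move=> zac nE zE t0 tb cc e e0; have [d d0 hd] := cc e e0; exists d => //.
have key s s' : 0 <= s -> s <= s' -> s' <= b ->
    (forall v, s <= v -> v <= s' -> `|v - t| < d) ->
    enorm (z s' - z s - (s' - s) *: c t) <= e * (s' - s).
  move=> s0 ss sb hv.
  pose w := z s' - z s - (s' - s) *: c t.
  have := ac_le_rate (absolutely_continuous_on_sub s0 sb zac)
    (f := fun v => dot w (z v - 0)) (C := enorm w)
    (k := dot w (c t) + enorm w * e) ss (enorm_ge0 w) _ nE.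
  move=> H.
  have : dot w (z s' - 0) - dot w (z s - 0) <= (dot w (c t) + enorm w * e) * (s' - s).
    apply: H => [v v' sv vv vs|v sv vs vE].
      by rewrite -dotBr !subr0; exact: cauchy_schwarz_abs.
    have v0 := le_trans s0 sv; have vb := le_trans vs sb.
    have zv : vderiv s s' z v (c v).
      move=> e' e'0; have [r r0 h] := zE v v0 vb vE _ e'0; exists r => // v' v'0 v's.
      by apply: h; [exact: le_trans s0 v'0|exact: le_trans v's sb].
    apply: upper_rate_le (rderiv_rate (rderiv_dot w 0 zv)).
    rewrite -(subrK (c t) (c v)) dotDr addrC lerD2l.
    apply: le_trans (cauchy_schwarz _ _) _; apply: ler_wpM2l; first exact: enorm_ge0.
    by apply: hd => //; exact: hv.
  rewrite !subr0 -dotBr => h.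
  have [w0|w0] := eqVneq (enorm w) 0.
    by rewrite -/w w0 mulr_ge0 ?subr_ge0// ltW.
  have wp : 0 < enorm w by rewrite lt_neqAle eq_sym w0 enorm_ge0.
  have wE : enorm w * enorm w = dot w (z s' - z s) - (s' - s) * dot w (c t).
    by rewrite -expr2 enormE {2}/w (dotBr w (z s' - z s)) dotZr.
  exact: (scale_rate_arith wp h wE).
move=> s s0 sb st.
have [ts|ts] := leP t s.
  rewrite ger0_norm ?subr_ge0//; apply: key => // v tv vs.
  rewrite ger0_norm ?subr_ge0//; apply: le_lt_trans st.
  by rewrite ger0_norm ?subr_ge0// lerD2r.
have ts' := ltW ts.
have -> : z s - z t - (s - t) *: c t = - (z t - z s - (t - s) *: c t).
  by apply/matrixP => i j; rewrite !mxE; ring.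
rewrite enormN distrC ger0_norm ?subr_ge0//; apply: key => // v tv vs.
rewrite distrC ger0_norm ?subr_ge0//; apply: le_lt_trans st.
by rewrite distrC ger0_norm ?subr_ge0// lerD2l lerN2.
Qed.

(** Plant solutions for constant inputs are differentiable at every time, as
    [moving_test] requires of the curve along which one tests. *)
Lemma constant_input_vderiv (R : realType) (n : nat) (f : 'cV[R]_n -> 'cV[R]_n) (L Rb : R)
    (x0 : 'cV[R]_n) (phi : R -> 'cV[R]_n) :
  0 <= L ->
  (forall x x', enorm x <= Rb -> enorm x' <= Rb -> enorm (f x - f x') <= L * enorm (x - x')) ->
  is_solution setT f x0 phi -> (forall t, 0 <= t -> enorm (phi t) <= Rb) ->
  forall b t, 0 <= t -> t <= b -> vderiv 0 b phi t (f (phi t)).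
Proof.
move=> L0 flip [_ _ phac phae] phB b t t0 tb.
have b0 := le_trans t0 tb.
have [E nE phiE] := ae_vderiv phae.
apply: (ac_vderiv (c := fun t => f (phi t)) (phac b b0) nE) => // [s s0 _ sE|].
  exact: phiE.
move=> e e0; have L1 : 0 < L + 1 by rewrite ltr_wpDl.
have [d d0 hd] := ac_vcont (phac b b0) t0 tb (divr_gt0 e0 L1).
exists d => // s s0 sb st; apply: le_trans (flip _ _ (phB s s0) (phB t t0)) _.
have := hd s s0 sb st; rewrite ler_pdivlMr// => h; apply: le_trans h.
by rewrite mulrDr mulr1 mulrC lerDl enorm_ge0.
Qed.

(** * Stability and convergence of the closed loop *)

Lemma exp_decay_converges (R : realType) (q : nat) (z : R -> 'cV[R]_q) (l : 'cV[R]_q) (M alpha : R) :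
  0 < alpha -> (forall t, 0 <= t -> enorm (z t - l) <= M * expR (- alpha * t)) ->
  exponentially_converges z l.
Proof.
move=> a0 h; split; last by exists M, alpha.
apply/enorm_cvgP => e e0.
have M0 : 0 < `|M| + 1 by rewrite ltr_wpDl.
have T0 : 0 < (`|M| + 1) / (alpha * e) by rewrite divr_gt0// mulr_gt0.
near=> t.
have tT : (`|M| + 1) / (alpha * e) < t by near: t; apply: nbhs_pinfty_gt; exact: num_real.
have t0 : 0 < t by exact: lt_trans T0 tT.
apply: le_lt_trans (h t (ltW t0)) _.
have E0 : 0 < expR (alpha * t) by exact: expR_gt0.
rewrite mulNr expRN -ltr_pdivlMr ?invr_gt0// invrK.
have h1 := expR_ge1Dx (alpha * t).
apply: (@lt_le_trans _ _ (e * (alpha * t))); last by apply: ler_wpM2l; [exact: ltW|lra].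
move: tT; rewrite ltr_pdivrMr ?mulr_gt0// => tT.
by have := ler_norm M; move: tT; lra.
Unshelve. all: by end_near. Qed.

Lemma decay_linear_arith (R : realType) (M E X q e w : R) : 0 < M -> 0 <= E ->
  0 <= e -> 0 <= w -> 0 <= X -> 0 <= q ->
  X ^+ 2 + q ^+ 2 <= M * E ^+ 2 * (e ^+ 2 + w ^+ 2) ->
  X <= (M + 1) * E * (e + w) /\ q <= (M + 1) * E * (e + w).
Proof.
move=> M0 E0 e0 w0 X0 q0 h.
have ew : 0 <= e + w by rewrite addr_ge0.
have B0 : 0 <= (M + 1) * E * (e + w) by rewrite !mulr_ge0// addr_ge0// ltW.
have h1 : M * E ^+ 2 * (e ^+ 2 + w ^+ 2) <= ((M + 1) * E * (e + w)) ^+ 2.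
  rewrite !exprMn; apply: ler_pM.
  - by rewrite mulr_ge0 ?sqr_ge0// ltW.
  - by rewrite addr_ge0 ?sqr_ge0.
  - by apply: ler_wpM2r; rewrite ?sqr_ge0//; nra.
  - by have := mulr_ge0 e0 w0; nra.
have X2 := sqr_ge0 X; have q2 := sqr_ge0 q.
by split; rewrite -(ler_pXn2r (n:=2)) ?nnegrE//; lra.
Qed.

Lemma early_arith (R : realType) (K C A B q X : R) : 1 <= K -> 0 <= C -> 1 <= A * B -> 0 <= q ->
  X <= C * q -> X <= K * C * A * B * q.
Proof.
move=> K1 C0 AB q0 h; apply: le_trans h _; apply: ler_wpM2r => //.
have -> : K * C * A * B = C * (K * (A * B)) by ring.
by rewrite ler_peMr// -[1]mulr1; apply: ler_pM.
Qed.

Section closed_loop.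
Variables (R : realType) (n p : nat).
Variables (F : 'cV[R]_n -> 'cV[R]_p -> 'cV[R]_n) (g : 'cV[R]_n -> 'cV[R]_p).
Variables (Gam : 'cV[R]_p -> 'cV[R]_n) (U Ut calU : set 'cV[R]_p).
Variables (L eps0 tau Rb eta k M alpha : R) (ur : 'cV[R]_p).
(* The hypothesis [decay] is the conclusion of [evi_decay] for one gain and one
reference. *)
Hypothesis Uc : compact U.
Hypothesis Us : segment_closed U.
Hypothesis L0 : 0 <= L.
Hypothesis eps00 : 0 < eps0.
Hypothesis tau0 : 0 <= tau.
Hypothesis eta0 : 0 < eta.
Hypothesis k0 : 0 < k.
Hypothesis UUt : U `<=` Ut.
Hypothesis UtU : Ut `<=` calU.
Hypothesis U1U : thicken U eta `<=` calU.
Hypothesis Flip : forall x x' u u', enorm x <= Rb -> enorm x' <= Rb -> Ut u -> Ut u' ->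
  enorm (F x u - F x' u') <= L * (enorm (x - x') + enorm (u - u')).
Hypothesis glip : forall x x', enorm x <= Rb -> enorm x' <= Rb ->
  enorm (g x - g x') <= L * enorm (x - x').
Hypothesis Glip : forall u u', U u -> U u' -> enorm (Gam u - Gam u') <= L * enorm (u - u').
Hypothesis start_bound : forall u x, U u -> enorm (x - Gam u) <= eps0 -> enorm x <= Rb - 1.
Hypothesis Uur : U ur.
Hypothesis Feq : F (Gam ur) ur = 0.
Hypothesis UtI : forall x u, enorm x <= Rb -> thicken U eta u ->
  Ut (u + (tau * k) *: (g (Gam ur) - g x)).
Hypothesis M0 : 0 < M.
Hypothesis alpha0 : 0 < alpha.
Hypothesis decay : forall a b x u, cl_evi F g U tau Rb k (g (Gam ur)) a b x u ->
  enorm (x a - Gam (u a)) <= eps0 -> forall t, a <= t -> t <= b ->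
  enorm (x t) <= Rb - 1 /\
  enorm (x t - Gam (u t)) ^+ 2 + enorm (u t - ur) ^+ 2 <=
    M * expR (- alpha * (t - a)) *
      (enorm (x a - Gam (u a)) ^+ 2 + enorm (u a - ur) ^+ 2).

Let r := g (Gam ur).
Let ze := col_mx (Gam ur) ur.
Let D : set 'cV[R]_(n + p) := [set z | calU (dsubmx z) /\
  calU (dsubmx z + (tau * k) *: (r - g (usubmx z)))].
Let beta := alpha / 2.
Let U0 : U !=set0. Proof. by exists ur. Qed.

Let beta0 : 0 < beta. Proof. by rewrite divr_gt0. Qed.

Let xeB1 : enorm (Gam ur) <= Rb - 1.
Proof. by apply: (start_bound Uur); rewrite subrr enorm0 ltW. Qed.

Let xeB : enorm (Gam ur) <= Rb.
Proof. by apply: le_trans xeB1 _; rewrite gerBl. Qed.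

Let expE t : expR (- alpha * t) = expR (- beta * t) ^+ 2.
Proof. by rewrite expr2 -expRD /beta; congr expR; field. Qed.

Lemma decay_linear a b x u t : cl_evi F g U tau Rb k r a b x u ->
  enorm (x a - Gam (u a)) <= eps0 -> a <= t -> t <= b ->
  [/\ enorm (x t) <= Rb - 1,
      enorm (x t - Gam ur) <= (1 + L) * ((M + 1) * expR (- beta * (t - a)) *
        (enorm (x a - Gam (u a)) + enorm (u a - ur)))
    & enorm (u t - ur) <= (M + 1) * expR (- beta * (t - a)) *
        (enorm (x a - Gam (u a)) + enorm (u a - ur))].
Proof.
move=> evi xa at_ tb; have [xt] := decay evi xa at_ tb; rewrite expE => h.
have [h1 h2] := decay_linear_arith M0 (expR_ge0 _) (enorm_ge0 _) (enorm_ge0 _)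
  (enorm_ge0 _) (enorm_ge0 _) h.
split => //; apply: le_trans (enorm_triangle (Gam (u t)) _ _) _.
rewrite mulrDl mul1r; apply: lerD => //.
have Ut' : U (u t) by case: evi => /(_ t at_ tb)[].
by apply: le_trans (Glip Ut' Uur) _; exact: ler_wpM2l.
Qed.

Section one_solution.
Variable z : R -> 'cV[R]_(n + p).
Hypothesis zac : forall b, 0 <= b -> absolutely_continuous_on 0 b z.
Hypothesis zae : {ae (@lebesgue_measure R), forall t, 0 < t ->
  is_derive (t : R^o) 1 (z : R^o -> 'cV[R]_(n + p)) (cl_field F g U tau k r (z t))}.
Let x t := usubmx (z t).
Let u t := dsubmx (z t).

(** The decay estimate keeps [x] inside the ball, which is what the continuation
    argument needs; then it holds for all times. *)
Lemma solution_decay a t : 0 <= a -> U (u a) -> enorm (x a - Gam (u a)) <= eps0 -> a <= t ->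
  [/\ enorm (x t) <= Rb - 1,
      enorm (x t - Gam ur) <= (1 + L) * ((M + 1) * expR (- beta * (t - a)) *
        (enorm (x a - Gam (u a)) + enorm (u a - ur)))
    & enorm (u t - ur) <= (M + 1) * expR (- beta * (t - a)) *
        (enorm (x a - Gam (u a)) + enorm (u a - ur))].
Proof.
move=> a0 Ua xa at_; apply: (decay_linear _ xa at_ (lexx t)).
apply: (solution_continue Uc Us U0 L0 tau0 eta0 k0 Flip glip UtI zac zae a0 Ua _ _ at_).
  by apply: le_trans (start_bound Ua xa) _; rewrite gerBl.
by move=> b ab evi; have [] := decay evi xa ab (lexx b).
Qed.

End one_solution.

Lemma solution_converges x0 u0 z : U u0 -> enorm (x0 - Gam u0) <= eps0 ->
  is_solution D (cl_field F g U tau k r) (col_mx x0 u0) z ->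
  [/\ exponentially_converges (fun t => usubmx (z t)) (Gam ur),
      exponentially_converges (fun t => dsubmx (z t)) ur
    & exponentially_converges (fun t => g (usubmx (z t))) r].
Proof.
move=> Uu0 xu0 [z0 _ zac zae].
have Q : U (dsubmx (z 0)) by rewrite z0 col_mxKd.
have e0 : enorm (usubmx (z 0) - Gam (dsubmx (z 0))) <= eps0 by rewrite z0 col_mxKd col_mxKu.
have H t t0 := solution_decay zac zae (t := t) (lexx 0) Q e0 t0.
move: (enorm _ + enorm _) H => Q0 H.
split.
- apply: (exp_decay_converges (M := (1 + L) * ((M + 1) * Q0)) beta0) => t /H[_ + _].
  by rewrite subr0 => h; apply: le_trans h _; apply: eq_le_r; ring.
- apply: (exp_decay_converges (M := (M + 1) * Q0) beta0) => t /H[_ _].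
  by rewrite subr0 => h; apply: le_trans h _; apply: eq_le_r; ring.
- apply: (exp_decay_converges (M := L * ((1 + L) * ((M + 1) * Q0))) beta0) => t /H[xB + _].
  rewrite subr0 => h.
  have xB' : enorm (usubmx (z t)) <= Rb by apply: le_trans xB _; rewrite gerBl.
  apply: le_trans (glip xB' xeB) _; apply: le_trans (ler_wpM2l L0 h) _.
  by apply: eq_le_r; ring.
Qed.

Let rE : r = g (Gam ur). Proof. by []. Qed.

Lemma solution_exists_in x0 u0 : U u0 -> enorm (x0 - Gam u0) <= eps0 ->
  exists z, is_solution D (cl_field F g U tau k r) (col_mx x0 u0) z.
Proof.
move=> Uu0 xu0.
have x0B1 := start_bound Uu0 xu0.
have x0B : enorm x0 < Rb by apply: le_lt_trans x0B1 _; rewrite gtrBl.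
have d0 : enorm (u0 - proj U u0) = 0 by rewrite (proj_id Uc Us U0 Uu0) subrr enorm0.
have u0t : thicken U eta u0 by exact: (thicken_sub Uc U0 (ltW eta0)).
have [x1 [x2 [u1 [u2]]]] := solution_exists Uc Us U0 L0 tau0 eta0 k0 Flip glip UtI
  UtU U1U (ltW x0B) u0t.
rewrite d0 => -[[x10 _ _] [u10 _ _ _] _ [x20 u20 _ evi]]; apply.
  by move=> t t0 t0'; have -> : t = 0; [by apply/le_anti; rewrite t0 t0'|rewrite x10].
move=> t t0; have [] := decay_linear (evi t t0) _ t0 (lexx t).
  by rewrite x20 u20 x10 u10.
by move=> h _ _; apply: le_lt_trans h _; rewrite gtrBl.
Qed.

Lemma equilibrium : [/\ D ze & cl_field F g U tau k r ze = 0].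
Proof.
have E : ur + (tau * k) *: (r - g (Gam ur)) = ur by rewrite /r subrr scaler0 addr0.
split; first by rewrite /D/= /ze col_mxKu col_mxKd E; split; exact/UtU/UUt.
rewrite /cl_field /ze col_mxKu col_mxKd E Feq /r subrr scaler0.
suff -> : Pi U ur 0 = 0 by exact: col_mx0.
by apply: (Pi_eq Uc Us U0 Uur) => [w _||v _]; rewrite ?subrr ?dot0l ?dot0r.
Qed.

Let err_le z : U (dsubmx z) ->
  enorm (usubmx z - Gam (dsubmx z)) <= (1 + L) * enorm (z - ze) /\
  enorm (dsubmx z - ur) <= enorm (z - ze).
Proof.
move=> Uz.
have hx : enorm (usubmx z - Gam ur) <= enorm (z - ze).
  by rewrite -[X in _ - X](col_mxKu (Gam ur) ur) -linearB; exact: enorm_usubmx.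
have hu : enorm (dsubmx z - ur) <= enorm (z - ze).
  by rewrite -[X in _ - X](col_mxKd (Gam ur) ur) -linearB; exact: enorm_dsubmx.
split => //; apply: le_trans (enorm_triangle (Gam ur) _ _) _.
rewrite mulrDl mul1r; apply: lerD => //.
apply: le_trans (Glip Uur Uz) _; apply: ler_wpM2l => //.
by rewrite enormB.
Qed.

Let Cs := expR (2 * (L + tau * k * L ^+ 2 + L + k * L)).

Let Cs1 : 1 <= Cs.
Proof.
rewrite -expR0 ler_expR mulr_ge0// !addr_ge0// !mulr_ge0 ?sqr_ge0// ?ltW//.
Qed.

(** Initial errors up to [delta] are, after the transient of one unit of time that
    multiplies them by at most [Cs], still in the basin of the decay estimate;
    [q < 1] lets the integrator state reach [U] during that time. *)
Let radius_exists : exists2 delta : R, 0 < delta & forall q : R, 0 <= q -> q <= delta ->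
  [/\ q < 1, Cs * q <= Num.min 1 eta / 2, q <= eta & (1 + L) * (Cs * q) <= eps0].
Proof.
have C0 : 0 < Cs by exact: lt_le_trans Cs1.
have e10 : 0 < Num.min 1 eta by exact: min_gt0.
have e11 : Num.min 1 eta <= 1 by rewrite ge_min lexx.
have e1e : Num.min 1 eta <= eta by rewrite ge_min lexx orbT.
have LC : 0 < (1 + L) * Cs by rewrite mulr_gt0// ltr_pwDl.
move: e10 e11 e1e; move: (Num.min 1 eta) => e1 e10 e11 e1e.
exists (Num.min (e1 / 2 / Cs) (eps0 / ((1 + L) * Cs))).
  by apply: min_gt0; rewrite !divr_gt0.
move=> q q0; rewrite le_min !ler_pdivlMr// => /andP[h1 h2].
have qC : q <= q * Cs by rewrite ler_peMr.
split; [lra|lra|lra|].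
by apply: le_trans h2; apply: eq_le_r; ring.
Qed.

(** Up to time 1 the error grows at most by the factor [Cs]; from time 1 on the
    integrator state is in [U] and the decay estimate applies. The factor
    [expR beta] accounts for its late start. *)
Lemma stability : exists delta Mf b : R, [/\ 0 < delta, 0 < Mf, 0 < b &
  forall z0, calU (dsubmx z0) -> enorm (z0 - ze) <= delta ->
    solution_satisfies D (cl_field F g U tau k r) z0 (fun z => forall t, 0 <= t ->
      enorm (z t - ze) <= Mf * expR (- b * t) * enorm (z0 - ze))].
Proof.
have [delta d0 hd] := radius_exists.
have C0 : 0 <= Cs by exact: le_trans Cs1.
have K1 : 1 <= (2 + L) ^+ 2 * (M + 1) by have := mulr_ge0 L0 L0; have := M0; have := L0; nra.
have Uue : Ut ur by exact: UUt.
exists delta, ((2 + L) ^+ 2 * (M + 1) * Cs * expR beta), beta; split => //.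
  apply: mulr_gt0 (expR_gt0 _); apply: mulr_gt0.
    exact: lt_le_trans ltr01 K1.
  exact: lt_le_trans ltr01 Cs1.
move=> z0 _ z0d; have [q1 qe1 qeta qeps] := hd _ (enorm_ge0 _) z0d.
have e10 : 0 < Num.min 1 eta by exact: min_gt0.
have e11 : Num.min 1 eta <= 1 by rewrite ge_min lexx.
have e1e : Num.min 1 eta <= eta by rewrite ge_min lexx orbT.
have hx : enorm (usubmx z0 - Gam ur) <= enorm (z0 - ze).
  by rewrite -[X in _ - X](col_mxKu (Gam ur) ur) -linearB; exact: enorm_usubmx.
have hu : enorm (dsubmx z0 - ur) <= enorm (z0 - ze).
  by rewrite -[X in _ - X](col_mxKd (Gam ur) ur) -linearB; exact: enorm_dsubmx.
have dist0 : enorm (dsubmx z0 - proj U (dsubmx z0)) <= enorm (z0 - ze).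
  exact: le_trans (proj_le Uc U0 _ Uur) hu.
split.
  have x0B : enorm (usubmx z0) <= Rb.
    rewrite -(subrK (Gam ur) (usubmx z0)); apply: le_trans (enormD _ _) _.
    by apply: le_trans (lerD (le_trans hx (ltW q1)) xeB1) _; rewrite addrCA subrr addr0.
  have u0U : thicken U eta (dsubmx z0).
    exact: (thicken_near Uc U0 Uur (le_trans hu qeta)).
  have [x1 [x2 [u1 [u2 [[x10 x1B x1c] [u10 u1U u1c u1t] x1t [x20 u20 Uu2 evi]]]]]] :=
    solution_exists Uc Us U0 L0 tau0 eta0 k0 Flip glip UtI UtU U1U x0B u0U.
  have near t := near_approach L0 tau0 k0 Flip glip UtI rE xeB Uur Uue Feq (t := t)
    (le_trans dist0 (ltW q1)) x1B x1c u1U u1c u1t x1t.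
  rewrite -/Cs -/ze x10 u10 vsubmxK in near.
  rewrite vsubmxK; apply.
    move=> t t0 td; have := le_trans (near t t0 td) qe1 => h.
    have hx1 : enorm (x1 t - Gam ur) <= Num.min 1 eta / 2.
      apply: le_trans h; rewrite -{1}(col_mxKu (x1 t) (u1 t)) -[X in _ - X](col_mxKu (Gam ur) ur).
      by rewrite -linearB; exact: enorm_usubmx.
    rewrite -(subrK (Gam ur) (x1 t)); apply: le_lt_trans (enormD _ _) _.
    by have := xeB1; move: hx1 e11; lra.
  have near0 := near _ (enorm_ge0 _) (lexx _).
  rewrite -x20 -u20 in near0.
  have e2 : enorm (x2 0 - Gam (u2 0)) <= eps0.
    have := (err_le (z := col_mx (x2 0) (u2 0))).
    rewrite col_mxKu col_mxKd => /(_ Uu2)[h _]; apply: le_trans h _.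
    apply: le_trans qeps; apply: ler_wpM2l near0; exact: addr_ge0.
  move=> t t0; have [h _ _] := decay_linear (evi t t0) e2 t0 (lexx t).
  by apply: le_lt_trans h _; rewrite gtrBl.
move=> z [zz _ zac zae] t t0.
have q1' : Cs * enorm (z 0 - ze) <= Num.min 1 eta / 2 by rewrite zz.
have xe1 : enorm (Gam ur) + Num.min 1 eta <= Rb by have := xeB1; move: e11; lra.
have near s := near_solution Uc Us U0 L0 tau0 k0 Flip glip UtI rE xeB Uur Uue Feq
  (t := s) zac zae e10 xe1 e1e q1'.
rewrite -/Cs -/ze zz in near.
have [t1|t1] := leP t 1.
  apply: (early_arith K1 C0 _ (enorm_ge0 _) (near t t0 t1)).
  rewrite -expRD -expR0 ler_expR mulNr subr_ge0 ler_piMr//; exact: ltW.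
have near1 := near 1 ler01 (lexx 1).
have U1 : U (dsubmx (z 1)).
  have := solution_enters Uc Us U0 zac zae (lexx 0).
  by rewrite zz add0r; apply; exact: le_lt_trans dist0 q1.
have [e1 w1] := err_le U1.
have L1 : 0 <= 1 + L by exact: addr_ge0.
have e1' : enorm (usubmx (z 1) - Gam (dsubmx (z 1))) <= eps0.
  by apply: le_trans e1 _; apply: le_trans qeps; exact: ler_wpM2l.
have [_ hX hW] := solution_decay zac zae ler01 U1 e1' (ltW t1).
have Q : enorm (usubmx (z 1) - Gam (dsubmx (z 1))) + enorm (dsubmx (z 1) - ur) <=
    (2 + L) * (Cs * enorm (z0 - ze)).
  apply: le_trans (lerD e1 w1) _.
  have -> : (1 + L) * enorm (z 1 - ze) + enorm (z 1 - ze) = (2 + L) * enorm (z 1 - ze) by ring.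
  by apply: ler_wpM2l near1; exact: addr_ge0.
have M1 : 0 <= M + 1 by rewrite addr_ge0// ltW.
apply: le_trans (enorm_col_le _) _.
rewrite !linearB/= !col_mxKu !col_mxKd.
apply: le_trans (lerD hX hW) _.
rewrite -[X in _ + X <= _]mul1r -mulrDl.
have -> : 1 + L + 1 = 2 + L by ring.
have E0 : 0 <= (M + 1) * expR (- beta * (t - 1)) by rewrite mulr_ge0// expR_ge0.
have L2 : 0 <= 2 + L by exact: addr_ge0.
apply: le_trans (ler_wpM2l L2 (ler_wpM2l E0 Q)) _.
have -> : expR (- beta * (t - 1)) = expR (- beta * t) * expR beta.
  by rewrite -expRD; congr expR; ring.
by apply: eq_le_r; ring.
Qed.

End closed_loop.

(** * Constants for the plant *)

Lemma Ck1_sub (R : realType) (V W : normedModType R) (A B : set V) (f : V -> W) :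
  A `<=` B -> Ck 1 B f -> Ck 1 A f.
Proof. by move=> AB [fd fc]; split=> [x /AB|v x /AB]; [exact: fd|exact: fc]. Qed.

Lemma gain_arith (R : realType) (tau k L Rb eta c : R) : 0 <= tau -> 0 <= k ->
  0 <= L -> 0 <= Rb -> 0 < eta -> k <= eta / (tau * L * (2 * Rb) + 1) -> c <= L * (2 * Rb) ->
  tau * k * c <= eta.
Proof.
move=> t0 k0 L0 R0 e0; have P0 : 0 <= tau * L * (2 * Rb) by rewrite !mulr_ge0.
rewrite ler_pdivlMr ?ltr_wpDl// => h hc.
have := ler_wpM2l (mulr_ge0 t0 k0) hc; move: h; lra.
Qed.

Theorem theorem4p7 (R : realType) (n m p : nat) (hpm : (p <= m)%N)
    (calV : set 'cV[R]_m) (hV : open calV)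
    (f0 : 'cV[R]_n -> 'cV[R]_m -> 'cV[R]_n)
    (hf0 : Ck 2 (setT `*` calV) (fun xv : 'cV[R]_n * 'cV[R]_m => f0 xv.1 xv.2))
    (g : 'cV[R]_n -> 'cV[R]_p) (hg : Ck 1 setT g)
    (Xi : 'cV[R]_m -> 'cV[R]_n) (eps0 : R)
    (calU : set 'cV[R]_p) (N : 'cV[R]_p -> 'cV[R]_m)
    (hA2 : assumption2 f0 g calV Xi eps0 calU N)
    (U : set 'cV[R]_p) (hUU : U `<=` calU) (hUcompact : compact U)
    (hUconvex : convex_set U) (hUint : interior U !=set0)
    (taup : R) (htaup : 0 <= taup) :
  let G := g \o Xi in
  exists2 kappa : R, 0 < kappa &
  forall k : R, 0 < k -> k <= kappa ->
  forall r : 'cV[R]_p, ((G \o N) @` U) r ->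
  let ur := 'pinv_(fun=> 0) calU (G \o N) r in
  let Dr := closed_loop_domain g calU taup k r in
  let F := closed_loop_field f0 g N U taup k r in
  exponentially_stable_equilibrium (state_space calU) Dr F
    (col_mx (Xi (N ur)) ur)
  /\
  forall (x0 : 'cV[R]_n) (u0 : 'cV[R]_p),
    Dr (col_mx x0 u0) -> U u0 -> enorm (x0 - Xi (N u0)) <= eps0 ->
    solution_satisfies Dr F (col_mx x0 u0) (fun z =>
      [/\ exponentially_converges (fun t => usubmx (z t)) (Xi (N ur)),
          exponentially_converges (fun t => dsubmx (z t)) ur
        & exponentially_converges (fun t => g (usubmx (z t))) r]).
Proof.
move=> G.
have [[XC Xeq eps00 [lam [rho [lam0 rho1 plant]]]] oU [NV N2] [mu mu0 mono]] := hA2.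
have Us := convex_set_segment hUconvex.
have [uu Uuu] : U !=set0 by have [u uI] := hUint; exists u; exact: interior_subset uI.
have U0 : U !=set0 by exists uu.
have [eta2 eta20 UtU] := thicken_in_open hUcompact U0 oU hUU.
have eta0 : 0 < eta2 / 2 by rewrite divr_gt0.
have eta02 : eta2 / 2 <= eta2 by lra.
pose Ut := thicken U eta2.
have UUt : U `<=` Ut by apply: (thicken_sub hUcompact U0 (ltW eta20)).
have Utc : compact Ut by exact: thicken_compact.
have Uts : segment_closed Ut by exact: thicken_segment.
have N1 : Ck 1 Ut N by exact: Ck1_sub UtU (Ck2_Ck1 N2).
have NVt u : Ut u -> calV (N u) by move=> /UtU; exact: NV.
have [L2 L20 Glip] := equilibria_lipschitz N1 NVt Utc Uts XC.
have [MU MU0 UM] := compact_enorm_bounded hUcompact.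
have Udiam u u' : U u -> U u' -> enorm (u - u') <= 2 * MU.
  move=> /UM h /UM h'; apply: le_trans (enormD _ _) _; rewrite enormN.
  by apply: le_trans (lerD h h') _; rewrite mulr2n mulrDl mul1r.
(* [MG] bounds the equilibria. Constant-input solutions deviate from them by at
most [rho * eps0], and [evi_decay] asks for a margin of 2. *)
pose MG := enorm (Xi (N uu)) + L2 * (2 * MU).
have MG0 : 0 <= MG by rewrite addr_ge0 ?enorm_ge0// !mulr_ge0.
have GB0 u : U u -> enorm (Xi (N u)) <= MG.
  move=> Uu; rewrite -(subrK (Xi (N uu)) (Xi (N u))); apply: le_trans (enormD _ _) _.
  rewrite addrC lerD2l; apply: le_trans (Glip _ _ (UUt _ Uu) (UUt _ Uuu)) _.
  by apply: ler_wpM2l => //; exact: Udiam.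
have re0 : eps0 <= rho * eps0 by rewrite ler_peMl// ltW.
have re1 : 0 < rho * eps0 by exact: lt_le_trans re0.
pose Rb := MG + rho * eps0 + 3.
have Rb0 : 0 <= Rb by rewrite addr_ge0// addr_ge0// ltW.
have [L1 L10 Flip] := field_lipschitz hf0 N1 NVt Utc Uts Rb.
have [L3 L30 glip] := output_lipschitz Rb hg.
pose L := L1 + L2 + L3.
have L0 : 0 <= L by rewrite !addr_ge0.
have L1L : L1 <= L by rewrite /L; lra.
have L2L : L2 <= L by rewrite /L; lra.
have L3L : L3 <= L by rewrite /L; lra.
pose F x u := f0 x (N u).
pose Gam u := Xi (N u).
have Flip' x x' u u' : enorm x <= Rb -> enorm x' <= Rb -> Ut u -> Ut u' ->
    enorm (F x u - F x' u') <= L * (enorm (x - x') + enorm (u - u')).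
  move=> h1 h2 h3 h4; apply: le_trans (Flip _ _ _ _ h1 h2 h3 h4) _.
  by apply: ler_wpM2r L1L; rewrite addr_ge0 ?enorm_ge0.
have glip' x x' : enorm x <= Rb -> enorm x' <= Rb -> enorm (g x - g x') <= L * enorm (x - x').
  move=> h1 h2; apply: le_trans (glip _ _ h1 h2) _.
  by apply: ler_wpM2r L3L; exact: enorm_ge0.
have Glip' u u' : U u -> U u' -> enorm (Gam u - Gam u') <= L * enorm (u - u').
  move=> h1 h2; apply: le_trans (Glip _ _ (UUt _ h1) (UUt _ h2)) _.
  by apply: ler_wpM2r L2L; exact: enorm_ge0.
have RbE : MG + rho * eps0 = Rb - 3 by rewrite /Rb; ring.
have Rb31 : Rb - 3 <= Rb - 1 by lra.
have Rb32 : Rb - 3 <= Rb - 2 by lra.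
have Rb3 : Rb - 3 <= Rb by lra.
have GB u : U u -> enorm (Gam u) <= Rb.
  by move=> /GB0 h; apply: le_trans h _; apply: le_trans Rb3; rewrite -RbE lerDl ltW.
have near_bound u x : U u -> enorm (x - Gam u) <= rho * eps0 -> enorm x <= Rb - 3.
  move=> Uu h; rewrite -(subrK (Gam u) x); apply: le_trans (enormD _ _) _.
  by rewrite -RbE addrC; apply: lerD => //; exact: GB0.
have start_bound u x : U u -> enorm (x - Gam u) <= eps0 -> enorm x <= Rb - 1.
  by move=> Uu h; apply: le_trans (near_bound u x Uu (le_trans h re0)) Rb31.
have const_input u (x0 : 'cV[R]_n) : U u -> enorm (x0 - Gam u) <= eps0 -> exists phi : R -> 'cV[R]_n,
    [/\ phi 0 = x0, forall t, 0 <= t -> enorm (phi t) <= Rb - 2,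
        forall b t, 0 <= t -> t <= b -> vderiv 0 b phi t (F (phi t) u)
      & forall t, 0 <= t -> enorm (phi t - Gam u) <= rho * expR (- lam * t) * enorm (x0 - Gam u)].
  move=> Uu xu; have [[phi phis] H] := plant (N u) (NV _ (hUU _ Uu)) x0 xu.
  have phid := H _ phis.
  have phiB t : 0 <= t -> enorm (phi t) <= Rb - 3.
    move=> t0; apply: (near_bound u _ Uu); apply: le_trans (phid t t0) _.
    rewrite -mulrA; apply: ler_wpM2l; first exact: le_trans rho1.
    rewrite -[leRHS]mul1r; apply: ler_pM => //; rewrite ?expR_ge0 ?enorm_ge0//.
    by rewrite -expR0 ler_expR mulNr oppr_le0 mulr_ge0// ltW.
  exists phi; split => //; first by case: phis.
    by move=> t t0; apply: le_trans (phiB t t0) Rb32.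
  apply: (constant_input_vderiv (f := fun x => F x u) L0 _ phis) => [x x' h1 h2|t t0].
    have := Flip' x x' u u h1 h2 (UUt _ Uu) (UUt _ Uu).
    by rewrite (subrr u) enorm0 addr0.
  exact: le_trans (phiB t t0) Rb3.
(* For such gains the proportional term has norm at most [eta2 / 2], so it
moves points at distance [eta2 / 2] from [U] at most to distance [eta2]. *)
pose kap0 := eta2 / 2 / (taup * L * (2 * Rb) + 1).
have kap00 : 0 < kap0.
  by rewrite divr_gt0// ltr_wpDl// !mulr_ge0.
have UtI k (x : 'cV[R]_n) u ur : 0 <= k -> k <= kap0 -> enorm x <= Rb ->
    thicken U (eta2 / 2) u -> U ur -> Ut (u + (taup * k) *: (g (Gam ur) - g x)).
  move=> k0 kk xB uU Uur.
  apply: (thicken_near hUcompact U0 (proj_in hUcompact U0 u)).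
  rewrite addrAC; apply: le_trans (enormD _ _) _; rewrite (splitr eta2); apply: lerD => //.
  rewrite enormZ ger0_norm ?mulr_ge0//.
  apply: (gain_arith htaup k0 L0 Rb0 eta0 kk).
  apply: le_trans (glip' _ _ (GB _ Uur) xB) _; apply: ler_wpM2l => //.
  apply: le_trans (enormD _ _) _; rewrite enormN.
  by apply: le_trans (lerD (GB _ Uur) xB) _; rewrite mulr2n mulrDl mul1r.
have UtI' k x u ur : 0 <= k -> k <= kap0 -> enorm x <= Rb ->
    U u -> U ur -> Ut (u + (taup * k) *: (g (Gam ur) - g x)).
  move=> h1 h2 h3 h4; apply: UtI => //.
  exact: (thicken_sub hUcompact U0 (ltW eta0)).
have MU2 : 0 <= 2 * MU by rewrite mulr_ge0.
have mono' u u' : U u -> U u' ->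
    mu * enorm (u - u') ^+ 2 <= dot (g (Gam u) - g (Gam u')) (u - u').
  by move=> /hUU h /hUU h'; exact: mono.
have [kappa [kappa0 kk0] hdecay] := evi_decay L0 mu0 eps00 lam0 rho1 htaup UUt Flip' glip' Glip'
  GB mono' const_input Udiam MU2 kap00 UtI'.
exists kappa => // k k0 kk r [us Uus rE] ur Dr cF.
(* Strong monotonicity makes the steady-state map injective, so the inverse
image of [r] is the input [us] in [U] that produces it. *)
have injG : {in calU &, injective (G \o N)}.
  move=> u u' /set_mem Uu /set_mem Uu' /= e.
  have := mono _ _ Uu Uu'; rewrite /G/= in e; rewrite e subrr dot0l pmulr_rle0// => h.
  apply/subr0_eq/enorm_eq0/eqP; rewrite -sqrf_eq0; apply/eqP/le_anti.
  by rewrite h sqr_ge0.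
have urE : ur = us.
  by rewrite /ur -rE; apply: pinvKV => //; apply/mem_set/hUU.
have {rE} rE : r = g (Gam us) by rewrite -rE.
move: @Dr @cF; rewrite {}urE rE => Dr cF; move: {ur r rE} us Uus @Dr @cF => ur Uur Dr cF.
have [M [alpha [M0 alpha0 decay]]] := hdecay k k0 kk.
have decay' a b x u evi xa := decay ur a b x u Uur evi xa.
have UtIk x u : enorm x <= Rb -> thicken U (eta2 / 2) u ->
    Ut (u + (taup * k) *: (g (Gam ur) - g x)).
  by move=> h1 h2; apply: UtI => //; [exact: ltW|exact: le_trans kk kk0].
have U1U : thicken U (eta2 / 2) `<=` calU.
  by move=> u h; apply: UtU; apply: le_trans h eta02.
have Feq : F (Gam ur) ur = 0 by apply: Xeq; apply: NV; exact: hUU.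
have [zeD zeF] := equilibrium g taup k hUcompact Us UUt UtU Uur Feq.
split.
  split=> //; first by rewrite /state_space/= col_mxKd; exact: hUU.
  exact: (stability hUcompact Us L0 eps00 htaup eta0 k0 UUt UtU U1U Flip' glip' Glip'
    start_bound Uur Feq UtIk M0 alpha0 decay').
move=> x0 u0 _ Uu0 xu0; split.
  exact: (solution_exists_in hUcompact Us L0 htaup eta0 k0 UtU U1U Flip' glip' Glip'
    start_bound Uur UtIk M0 decay' Uu0 xu0).
move=> z zs.
exact: (solution_converges hUcompact Us L0 eps00 htaup eta0 k0 Flip' glip' Glip'
    start_bound Uur UtIk M0 alpha0 decay' Uu0 xu0 zs).
Qed.
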